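(* For every integer $r\ge 2$ there is an $(O(rN^{1/r}),O(N^{1-1/r}))$-implementation of resizable arrays in which Grow and Shrink operations take $O(r)$ amortized time and access operations (reading or overwriting the $i$-th item) take $O(1)$ worst-case time.
   Context: A resizable array stores a sequence $a_0,\dots,a_{N-1}$ ($N$ is its current size) and supports: creating an empty array, returning its length, reading or overwriting the $i$-th item ($0\le i<N$), Grow$(a)$ which appends a new last item $a$, and Shrink() which removes the last item. An implementation keeps its data in dynamically allocated fixed-length contiguous blocks of memory words; allocating or deallocating a block is assumed to take constant time; each item occupies one word and each pointer one word; every block other than a single main index block must be pointed to by a pointer stored in some block. The space used at any moment is the total length of all currently allocated blocks. For non-decreasing functions $s,t$, an $(s(N),t(N))$-implementation uses at most $N+s(N)$ space to store an array of size $N$, and at most $N+t(N)$ space at any moment during a grow or shrink operation on an array of size $N$. The machine is a word RAM with standard arithmetic, logical and shift operations, in which the index of the most significant set bit of a word can be computed in $O(1)$ time. *)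

(* Defs.v *)
From Stdlib Require Import Arith List.
Import ListNotations.
Set Implicit Arguments.

(** * A word RAM with dynamically allocated blocks

    The machine has word length [w].  A word holds an integer below [2 ^ w], a
    pointer to a block, or an item of the stored sequence.  Items have an
    arbitrary type [A] and are opaque, and so are pointers: a program can move
    them and dereference pointers, but cannot compute with their
    representation, so that several items can never be packed in one word. *)

Inductive value (A : Type) : Type :=
| Undef : value A  (* contents of memory not yet written to *)
| Int : nat -> value A
| Ptr : nat -> value A
| Item : A -> value A.
Arguments Undef {A}.
Arguments Int {A} _.
Arguments Ptr {A} _.

(** [nth_error h b] is [Some (Some c)] if block [b] is currently allocated and
    contains [c], and [Some None] if it has been deallocated.  Block names are
    not reused; they are unobservable, so they do not have to be below
    [2 ^ w]. *)
Definition heap (A : Type) : Type := list (option (list (value A))).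

Definition set_nth {T : Type} (l : list T) (i : nat) (x : T) : list T :=
  firstn i l ++ x :: skipn (S i) l.

Definition allocated {A : Type} (h : heap A) (b : nat) (c : list (value A)) : Prop :=
  nth_error h b = Some (Some c).

Definition block_length {A : Type} (o : option (list (value A))) : nat :=
  match o with Some c => length c | None => 0 end.

Definition space {A : Type} (h : heap A) : nat := list_sum (map block_length h).

Definition heap_load {A : Type} (h : heap A) (b i : nat) : option (value A) :=
  match nth_error h b with Some (Some c) => nth_error c i | _ => None end.

Definition heap_store {A : Type} (h : heap A) (b i : nat) (v : value A)
  : option (heap A) :=
  match nth_error h b with
  | Some (Some c) =>
      if i <? length c then Some (set_nth h b (Some (set_nth c i v))) else None
  | _ => None
  end.

Definition heap_free {A : Type} (h : heap A) (b : nat) : option (heap A) :=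
  match nth_error h b with
  | Some (Some _) => Some (set_nth h b None)
  | _ => None
  end.

Definition heap_alloc {A : Type} (h : heap A) (n : nat) : heap A :=
  h ++ [Some (repeat Undef n)].

Inductive unop := Not | Msb.

Inductive binop :=
| Add | Sub | Mul | Div | Mod | And | Or | Xor | Shl | Shr | Equal | Less.

Definition word (w n : nat) : nat := n mod 2 ^ w.

Definition bool_word (b : bool) : nat := if b then 1 else 0.

(** [None] is a run-time error. *)
Definition eval_unop (w : nat) (o : unop) (x : nat) : option nat :=
  match o with
  | Not => Some (2 ^ w - 1 - x)
  | Msb => if x =? 0 then None else Some (word w (Nat.log2 x))
  end.

Definition eval_binop (w : nat) (o : binop) (x y : nat) : option nat :=
  match o with
  | Add => Some (word w (x + y))
  | Sub => Some (word w (x + 2 ^ w - y))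
  | Mul => Some (word w (x * y))
  | Div => if y =? 0 then None else Some (x / y)
  | Mod => if y =? 0 then None else Some (x mod y)
  | And => Some (Nat.land x y)
  | Or => Some (Nat.lor x y)
  | Xor => Some (Nat.lxor x y)
  | Shl => Some (word w (Nat.shiftl x y))
  | Shr => Some (Nat.shiftr x y)
  | Equal => Some (word w (bool_word (x =? y)))
  | Less => Some (word w (bool_word (x <? y)))
  end.

(** Programs do not mention [A] or [w].  [Var x] is the content of register
    [x]; a program uses only the finitely many registers that occur in it. *)
Inductive expr : Type :=
| Lit : nat -> expr
| Var : nat -> expr
| Unop : unop -> expr -> expr
| Binop : binop -> expr -> expr -> expr
| Deref : expr -> expr -> expr.

Inductive cmd : Type :=
| Skip : cmd
| Assign : nat -> expr -> cmd
| Store : expr -> expr -> expr -> cmd  (* block, offset, value *)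
| Alloc : nat -> expr -> cmd  (* register receiving the pointer, length *)
| Free : expr -> cmd
| Seq : cmd -> cmd -> cmd
| If : expr -> cmd -> cmd -> cmd
| While : expr -> cmd -> cmd.

Definition registers (A : Type) : Type := nat -> value A.

Definition set_reg {A : Type} (rho : registers A) (x : nat) (v : value A)
  : registers A :=
  fun y => if y =? x then v else rho y.

Fixpoint eval {A : Type} (w : nat) (rho : registers A) (h : heap A) (e : expr)
  : option (value A) :=
  match e with
  | Lit n => Some (Int (word w n))
  | Var x => Some (rho x)
  | Unop o e1 =>
      match eval w rho h e1 with
      | Some (Int x) => option_map Int (eval_unop w o x)
      | _ => None
      end
  | Binop o e1 e2 =>
      match eval w rho h e1, eval w rho h e2 with
      | Some (Int x), Some (Int y) => option_map Int (eval_binop w o x y)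
      | _, _ => None
      end
  | Deref e1 e2 =>
      match eval w rho h e1, eval w rho h e2 with
      | Some (Ptr b), Some (Int i) => heap_load h b i
      | _, _ => None
      end
  end.

(** Every node of an expression takes one unit of time. *)
Fixpoint cost (e : expr) : nat :=
  match e with
  | Lit _ | Var _ => 1
  | Unop _ e1 => 1 + cost e1
  | Binop _ e1 e2 | Deref e1 e2 => 1 + cost e1 + cost e2
  end.

(** [exec w c rho h t m rho' h']: started with registers [rho] and memory [h],
    the program [c] halts without run-time error after [t] units of time with
    registers [rho'] and memory [h'], and [m] is the maximum space used at any
    moment of this execution, including its start and its end.  This relation
    is deterministic. *)
Inductive exec {A : Type} (w : nat) :
  cmd -> registers A -> heap A -> nat -> nat -> registers A -> heap A -> Prop :=
| exec_Skip : forall rho h,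
    exec w Skip rho h 0 (space h) rho h
| exec_Assign : forall rho h x e v,
    eval w rho h e = Some v ->
    exec w (Assign x e) rho h (1 + cost e) (space h) (set_reg rho x v) h
| exec_Store : forall rho h h' e1 e2 e3 b i v,
    eval w rho h e1 = Some (Ptr b) ->
    eval w rho h e2 = Some (Int i) ->
    eval w rho h e3 = Some v ->
    heap_store h b i v = Some h' ->
    exec w (Store e1 e2 e3) rho h (1 + cost e1 + cost e2 + cost e3)
      (space h) rho h'
| exec_Alloc : forall rho h x e n,
    eval w rho h e = Some (Int n) ->
    exec w (Alloc x e) rho h (1 + cost e) (space (heap_alloc h n))
      (set_reg rho x (Ptr (length h))) (heap_alloc h n)
| exec_Free : forall rho h h' e b,
    eval w rho h e = Some (Ptr b) ->
    heap_free h b = Some h' ->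
    exec w (Free e) rho h (1 + cost e) (space h) rho h'
| exec_Seq : forall c1 c2 rho h t1 m1 rho1 h1 t2 m2 rho2 h2,
    exec w c1 rho h t1 m1 rho1 h1 ->
    exec w c2 rho1 h1 t2 m2 rho2 h2 ->
    exec w (Seq c1 c2) rho h (t1 + t2) (Nat.max m1 m2) rho2 h2
| exec_If_true : forall e c1 c2 rho h n t m rho' h',
    eval w rho h e = Some (Int n) -> n <> 0 ->
    exec w c1 rho h t m rho' h' ->
    exec w (If e c1 c2) rho h (1 + cost e + t) m rho' h'
| exec_If_false : forall e c1 c2 rho h t m rho' h',
    eval w rho h e = Some (Int 0) ->
    exec w c2 rho h t m rho' h' ->
    exec w (If e c1 c2) rho h (1 + cost e + t) m rho' h'
| exec_While_true : forall e c rho h n t1 m1 rho1 h1 t2 m2 rho2 h2,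
    eval w rho h e = Some (Int n) -> n <> 0 ->
    exec w c rho h t1 m1 rho1 h1 ->
    exec w (While e c) rho1 h1 t2 m2 rho2 h2 ->
    exec w (While e c) rho h (1 + cost e + t1 + t2) (Nat.max m1 m2) rho2 h2
| exec_While_false : forall e c rho h,
    eval w rho h e = Some (Int 0) ->
    exec w (While e c) rho h (1 + cost e) (space h) rho h.

(** * Resizable arrays *)

Inductive operation (A : Type) : Type :=
| Length : operation A
| Read : nat -> operation A
| Overwrite : nat -> A -> operation A
| Grow : A -> operation A
| Shrink : operation A.
Arguments Length {A}.
Arguments Read {A} _.
Arguments Shrink {A}.

Definition legal {A : Type} (l : list A) (o : operation A) : Prop :=
  match o with
  | Read i | Overwrite i _ => i < length l
  | Shrink => l <> []
  | _ => True
  end.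

Definition effect {A : Type} (l : list A) (o : operation A) : list A :=
  match o with
  | Overwrite i a => set_nth l i a
  | Grow a => l ++ [a]
  | Shrink => removelast l
  | _ => l
  end.

Definition answer {A : Type} (l : list A) (o : operation A) (v : value A) : Prop :=
  match o with
  | Length => v = Int (length l)
  | Read i => exists a, nth_error l i = Some a /\ v = Item a
  | _ => True
  end.

Definition resizes {A : Type} (o : operation A) : bool :=
  match o with Grow _ | Shrink => true | _ => false end.

Record implementation : Type := {
  create_code : cmd;
  length_code : cmd;
  read_code : cmd;
  overwrite_code : cmd;
  grow_code : cmd;
  shrink_code : cmd }.

Definition code (I : implementation) {A : Type} (o : operation A) : cmd :=
  match o with
  | Length => length_code I
  | Read _ => read_code I
  | Overwrite _ _ => overwrite_code I
  | Grow _ => grow_code I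
  | Shrink => shrink_code I
  end.

(** Calling convention.  An operation is called with a pointer to the main
    index block in register 0, an index in register 1 and an item in register
    2.  It returns a pointer to the (possibly new) main index block in register
    0 and its answer in register 1.  No other register survives from one
    operation to the next. *)
Definition no_registers {A : Type} : registers A := fun _ => Undef.

Definition call {A : Type} (p : nat) (o : operation A) : registers A :=
  fun x =>
    match x, o with
    | 0, _ => Ptr p
    | 1, Read i | 1, Overwrite i _ => Int i
    | 2, Overwrite _ a | 2, Grow a => Item a
    | _, _ => Undef
    end.

(** Word-length assumption: the integers up to [K * (N + q)] fit in a word. *)
Definition fits (K q w N : nat) : Prop := K * (N + q) < 2 ^ w.

(** [reachable K q w I l p h n T]: some sequence of operations starting with
    the creation of an empty array leads to the array [l], represented by the
    memory [h] with main index block [p]; the sequence contains [n] grow and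
    shrink operations, and the creation and these [n] operations took [T] units
    of time in total.  The word-length assumption holds for all sizes occurring
    in the sequence. *)
Inductive reachable {A : Type} (K q w : nat) (I : implementation) :
  list A -> nat -> heap A -> nat -> nat -> Prop :=
| reachable_create : forall t m rho p h,
    fits K q w 0 ->
    exec w (create_code I) no_registers [] t m rho h ->
    rho 0 = Ptr p ->
    reachable K q w I [] p h 0 t
| reachable_operation : forall l p h n T o t m rho p' h',
    reachable K q w I l p h n T ->
    legal l o ->
    fits K q w (length (effect l o)) ->
    exec w (code I o) (call p o) h t m rho h' ->
    rho 0 = Ptr p' ->
    reachable K q w I (effect l o) p' h'
      (if resizes o then n + 1 else n) (if resizes o then T + t else T).

(** Every allocated block other than the main index block [p], which must be
    allocated itself, is pointed to by a pointer stored in an allocated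
    block. *)
Definition pointed {A : Type} (p : nat) (h : heap A) : Prop :=
  (exists c, allocated h p c) /\
  forall b c, allocated h b c -> b <> p ->
    exists b' c', allocated h b' c' /\ In (Ptr b) c'.

Definition nondecreasing (f : nat -> nat) : Prop :=
  forall m n, m <= n -> f m <= f n.

Definition implements (K q : nat) (I : implementation) : Prop :=
  forall (A : Type) (w : nat),
    (fits K q w 0 ->
     exists t m rho p (h : heap A),
       exec w (create_code I) no_registers [] t m rho h /\ rho 0 = Ptr p) /\
    (forall (l : list A) p h n T, reachable K q w I l p h n T ->
       pointed p h /\
       forall o, legal l o -> fits K q w (length (effect l o)) ->
         exists t m rho p' h',
           exec w (code I o) (call p o) h t m rho h' /\
           rho 0 = Ptr p' /\ answer l o (rho 1)).

(** The space bound [N + s N] applies between operations, and also during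
    creation and during operations other than grow and shrink. *)
Definition space_bounds (K q : nat) (s t : nat -> nat) (I : implementation) : Prop :=
  forall (A : Type) (w : nat),
    (forall tm m rho (h : heap A), fits K q w 0 ->
       exec w (create_code I) no_registers [] tm m rho h -> m <= s 0) /\
    (forall (l : list A) p h n T, reachable K q w I l p h n T ->
       space h <= length l + s (length l) /\
       forall o tm m rho h', legal l o -> fits K q w (length (effect l o)) ->
         exec w (code I o) (call p o) h tm m rho h' ->
         m <= length l + (if resizes o then t else s) (length l)).

Definition st_implementation (K q : nat) (s t : nat -> nat) (I : implementation)
  : Prop :=
  nondecreasing s /\ nondecreasing t /\
  implements K q I /\ space_bounds K q s t I.

(** The creation of the empty array is charged like one grow operation. *)
Definition resize_amortized_time (K q : nat) (I : implementation) (D : nat) : Prop :=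
  forall (A : Type) (w : nat) (l : list A) p h n T,
    reachable K q w I l p h n T -> T <= D * (n + 1).

Definition access_worst_case_time (K q : nat) (I : implementation) (D : nat) : Prop :=
  forall (A : Type) (w : nat) (l : list A) p h n T o t m rho h',
    reachable K q w I l p h n T ->
    legal l o -> resizes o = false -> fits K q w (length l) ->
    exec w (code I o) (call p o) h t m rho h' -> t <= D.

(* Main.v *)
From Stdlib Require Import Arith List Lia Reals Lra.
Require Import Defs.
Import ListNotations.
Set Implicit Arguments.

(** Let [N] be about [2 ^ (m + 1)] and [B = 2 ^ (m / r + 1)], which is of the order
    of [N ^ (1 / r)].  The sequence is cut into full blocks of sizes
    [E_0 = 1, E_1 = B, E_2 = B ^ 2, ...], capped at [E_k = 2 ^ (m - m / r)], where
    [k < r]; larger blocks come before smaller ones.  Let [S_j] be the number of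
    items after the last block of level at least [j].  When [S_j] reaches [3 E_j],
    the first [E_j] of these items are merged into a new block of level [j]; when it
    drops below [E_j], the last block of level [j] is split into blocks of level
    [j - 1].  Either way [S_j] is then close to [2 E_j], so that the [E_j] moves
    are paid for by the [E_j] operations since the last change of that level: each
    level costs amortized constant time.

    Every level has less than [4 B] blocks, so the index has [O(r B)] words.
    Block number [q] of a level occupies slot [q mod 4 B], hence nothing in the
    index is ever shifted.  An item at distance [u] from the end, with
    [E_j <= u < E_(j+1)], is at level [j], [j - 1] or [j - 2], and [j] is found
    from the most significant bit of [u].

    When [N] reaches [2 ^ (m + 2)] or [2 ^ m], the items are moved one by one to a
    new array with [m + 1] or [m - 1] for [m], and old blocks are deallocated as
    soon as they have been read. *)

(** * Memory *)

(** While a level changes, its source and target blocks coexist, so the largest block size enters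
    the peak bound. Hence the cap [2 ^ (m - m / r)], of the order of [N ^ (1 - 1 / r)]. The cap
    times [B] is [2 ^ (m + 1)], so the top level still has only [O(B)] blocks.

    One operation can trigger changes at several levels. Adjacent levels never cross because block
    sizes grow by a factor of at least 2: a merge at level [j + 1] puts its boundary
    [2 E_(j+1) >= 4 E_j] items before the end, farther back than the at most [3 E_j] items after
    level [j]; and a block that is split starts about [2 E_j] before the end, which the
    [E_(j+1) >= 2 E_j] items after the next level leave room for. The parameters of [balanced]
    record how far a pass over the levels has come.

    The potential of a level is the distance from [S_j] to [2 E_j], except that a level without
    blocks is not charged for having few items after it. A second account, linear in the distance of
    [N] from [2 ^ (m + 1)], saves for the next rebuilding.

    Space is not amortized: every specification carries a limit that holds throughout the
    execution. *)

Definition block_at {A : Type} (h : heap A) (b : nat) : option (list (value A)) :=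
  match nth_error h b with Some o => o | None => None end.

Section Memory.
Variable A : Type.
Implicit Types (h : heap A) (c : list (value A)).

Lemma nth_error_set_nth (T : Type) (l : list T) i j x :
  i < length l ->
  nth_error (set_nth l i x) j = if j =? i then Some x else nth_error l j.
Proof.
  intros Hi. unfold set_nth. destruct (Nat.eqb_spec j i) as [->|Hj].
  - rewrite nth_error_app2; rewrite firstn_length_le by lia; [|lia].
    now rewrite Nat.sub_diag.
  - destruct (Nat.lt_ge_cases j i).
    + rewrite nth_error_app1 by (rewrite firstn_length_le; lia).
      rewrite nth_error_firstn. now destruct (Nat.ltb_spec j i); [|lia].
    + rewrite nth_error_app2; rewrite firstn_length_le by lia; [|lia].
      replace (j - i) with (S (j - i - 1)) by lia.
      change (nth_error (skipn (S i) l) (j - i - 1) = nth_error l j).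
      rewrite nth_error_skipn. f_equal. lia.
Qed.

Lemma length_set_nth (T : Type) (l : list T) i x :
  i < length l -> length (set_nth l i x) = length l.
Proof.
  intros Hi. unfold set_nth. rewrite length_app.
  change (length (x :: skipn (S i) l)) with (S (length (skipn (S i) l))).
  rewrite firstn_length_le, length_skipn by lia. lia.
Qed.

Lemma space_set_nth h b o o' :
  nth_error h b = Some o ->
  space (set_nth h b o') + block_length o = space h + block_length o'.
Proof.
  intros Hb. unfold space, set_nth.
  destruct (nth_error_split h b Hb) as (h1 & h2 & -> & <-).
  rewrite firstn_app, Nat.sub_diag, firstn_all, firstn_O, app_nil_r.
  rewrite skipn_app, skipn_all2 by lia.
  replace (S (length h1) - length h1) with 1 by lia.
  cbn. rewrite !map_app, !list_sum_app. cbn. lia.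
Qed.

Lemma block_at_lt h b c : block_at h b = Some c -> b < length h.
Proof.
  unfold block_at. intros H. apply nth_error_Some. now destruct (nth_error h b).
Qed.

Lemma block_at_nth_error h b c :
  block_at h b = Some c <-> nth_error h b = Some (Some c).
Proof.
  unfold block_at. destruct (nth_error h b) as [[]|]; split; congruence.
Qed.

Lemma space_alloc h n : space (heap_alloc h n) = space h + n.
Proof.
  unfold space, heap_alloc. rewrite map_app, list_sum_app. cbn.
  rewrite repeat_length. lia.
Qed.

Lemma block_at_alloc h n b :
  block_at (heap_alloc h n) b =
  if b =? length h then Some (repeat Undef n) else block_at h b.
Proof.
  unfold block_at, heap_alloc. destruct (Nat.eqb_spec b (length h)) as [->|Hb].
  - now rewrite nth_error_app2, Nat.sub_diag by lia.
  - destruct (Nat.lt_ge_cases b (length h)).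
    + now rewrite nth_error_app1.
    + rewrite (proj2 (nth_error_None h b)) by lia.
      rewrite (proj2 (nth_error_None _ _)); [easy|].
      rewrite length_app; cbn; lia.
Qed.

Lemma heap_load_block h b c i v :
  block_at h b = Some c -> nth_error c i = Some v -> heap_load h b i = Some v.
Proof.
  rewrite block_at_nth_error. unfold heap_load. now intros -> ->.
Qed.

Lemma heap_store_block h b c i v :
  block_at h b = Some c -> i < length c ->
  exists h', heap_store h b i v = Some h' /\ space h' = space h /\
    length h' = length h /\
    forall b', block_at h' b' =
      if b' =? b then Some (set_nth c i v) else block_at h b'.
Proof.
  intros Hb Hi. pose proof (block_at_lt _ _ Hb) as Hl.
  apply block_at_nth_error in Hb. unfold heap_store. rewrite Hb.
  destruct (Nat.ltb_spec i (length c)); [|lia].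
  eexists. split; [reflexivity|]. split; [|split].
  - pose proof (space_set_nth h b (Some (set_nth c i v)) Hb) as Hs.
    cbn in Hs. rewrite length_set_nth in Hs by easy. lia.
  - now apply length_set_nth.
  - intros b'. unfold block_at. rewrite nth_error_set_nth by easy.
    now destruct (b' =? b).
Qed.

Lemma heap_free_block h b c :
  block_at h b = Some c ->
  exists h', heap_free h b = Some h' /\ space h' + length c = space h /\
    forall b', block_at h' b' = if b' =? b then None else block_at h b'.
Proof.
  intros Hb. pose proof (block_at_lt _ _ Hb) as Hl.
  apply block_at_nth_error in Hb. unfold heap_free. rewrite Hb.
  eexists. split; [reflexivity|]. split.
  - pose proof (space_set_nth h b None Hb) as Hs. cbn in Hs. lia.
  - intros b'. unfold block_at. rewrite nth_error_set_nth by easy.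
    now destruct (b' =? b).
Qed.

End Memory.

(** * Program logic *)

(** Syntactic, so that [reflexivity] decides it: registers for which it is false keep their values,
    which is the frame rule of the logic. *)
Fixpoint modifies (c : cmd) (x : nat) : bool :=
  match c with
  | Assign y _ | Alloc y _ => x =? y
  | Seq c1 c2 | If _ c1 c2 => modifies c1 x || modifies c2 x
  | While _ c1 => modifies c1 x
  | _ => false
  end.

Definition lim (w : nat) : nat := 2 ^ w.

Section Logic.
Variables (A : Type) (w : nat).
Implicit Types (rho : registers A) (h : heap A).

(** Carries a result about one execution over to any given execution, the form in which space and
    time requirements are stated. *)
Lemma exec_deterministic c rho h t m rho' h' t2 m2 rho2 h2 :
  exec w c rho h t m rho' h' -> exec w c rho h t2 m2 rho2 h2 ->
  t = t2 /\ m = m2 /\ rho' = rho2 /\ h' = h2.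
Proof.
  intros H. revert t2 m2 rho2 h2.
  induction H; intros t2' m2' rho2' h2' H'; inversion H'; subst; clear H';
    repeat match goal with
    | H1 : ?x = Some _, H2 : ?x = Some _ |- _ =>
        rewrite H1 in H2; injection H2 as H2; subst; clear H1
    | H1 : eval _ _ _ _ = Some (Int ?n), H2 : eval _ _ _ _ = Some (Int _) |- _ =>
        rewrite H1 in H2; injection H2 as H2; subst
    | IH : forall _ _ _ _, exec _ ?c ?rho ?h _ _ _ _ -> _,
      H1 : exec _ ?c ?rho ?h _ _ _ _ |- _ =>
        destruct (IH _ _ _ _ H1) as (? & ? & ? & ?); subst; clear IH
    end; try congruence; auto.
Qed.

(** Makes the limit on one part of an execution the precondition of the next part. *)
Lemma exec_space c rho h t m rho' h' :
  exec w c rho h t m rho' h' -> space h <= m /\ space h' <= m.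
Proof.
  induction 1; try lia.
  - unfold heap_store in *. destruct (nth_error h b) as [[c|]|] eqn:E; try easy.
    destruct (i <? length c) eqn:L; [|easy]. injection H2 as <-.
    apply Nat.ltb_lt in L. pose proof (space_set_nth h b (Some (set_nth c i v)) E).
    cbn in *. rewrite length_set_nth in * by easy. lia.
  - rewrite space_alloc. lia.
  - unfold heap_free in *. destruct (nth_error h b) as [[c|]|] eqn:E; try easy.
    injection H0 as <-. pose proof (space_set_nth h b None E). cbn in *. lia.
Qed.

Lemma exec_modifies c rho h t m rho' h' :
  exec w c rho h t m rho' h' -> forall x, modifies c x = false -> rho' x = rho x.
Proof.
  induction 1; cbn; intros y Hy; try reflexivity;
    try (apply Bool.orb_false_iff in Hy; destruct Hy);
    try (unfold set_reg; rewrite Hy; reflexivity); auto.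
  - rewrite IHexec2, IHexec1; auto.
  - rewrite IHexec2, IHexec1; auto.
Qed.

(** Total correctness, with the space limit [M] in force throughout the
    execution. *)
Definition wp (M : nat) (c : cmd) rho h (Q : nat -> registers A -> heap A -> Prop)
  : Prop :=
  space h <= M ->
  exists t m rho' h', exec w c rho h t m rho' h' /\ m <= M /\ Q t rho' h'.

Variable M : nat.

(** Consequence and frame rule in one: the new postcondition may use that the other registers are
    unchanged. *)
Lemma wp_conseq c rho h (Q Q' : nat -> registers A -> heap A -> Prop) :
  wp M c rho h Q ->
  (forall t rho' h', Q t rho' h' ->
     (forall x, modifies c x = false -> rho' x = rho x) -> Q' t rho' h') ->
  wp M c rho h Q'.
Proof.
  intros H HQ Hs. destruct (H Hs) as (t & m & rho' & h' & He & Hm & Hq).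
  exists t, m, rho', h'. repeat split; auto.
  apply HQ; auto. eapply exec_modifies; eauto.
Qed.

Lemma wp_skip rho h (Q : nat -> registers A -> heap A -> Prop) :
  Q 0 rho h -> wp M Skip rho h Q.
Proof.
  intros HQ Hs. do 4 eexists. split; [constructor|auto].
Qed.

Lemma wp_assign x e v rho h (Q : nat -> registers A -> heap A -> Prop) :
  eval w rho h e = Some v ->
  Q (1 + cost e) (set_reg rho x v) h -> wp M (Assign x e) rho h Q.
Proof.
  intros He HQ Hs. do 4 eexists. split; [econstructor; eauto|auto].
Qed.

Lemma wp_store e1 e2 e3 b i v h' rho h (Q : nat -> registers A -> heap A -> Prop) :
  eval w rho h e1 = Some (Ptr b) -> eval w rho h e2 = Some (Int i) ->
  eval w rho h e3 = Some v -> heap_store h b i v = Some h' ->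
  Q (1 + cost e1 + cost e2 + cost e3) rho h' -> wp M (Store e1 e2 e3) rho h Q.
Proof.
  intros ? ? ? ? HQ Hs. do 4 eexists. split; [econstructor; eauto|auto].
Qed.

Lemma wp_alloc x e n rho h (Q : nat -> registers A -> heap A -> Prop) :
  eval w rho h e = Some (Int n) -> space h + n <= M ->
  Q (1 + cost e) (set_reg rho x (Ptr (length h))) (heap_alloc h n) ->
  wp M (Alloc x e) rho h Q.
Proof.
  intros He Hn HQ Hs. do 4 eexists. split; [econstructor; eauto|].
  rewrite space_alloc. auto.
Qed.

Lemma wp_free e b h' rho h (Q : nat -> registers A -> heap A -> Prop) :
  eval w rho h e = Some (Ptr b) -> heap_free h b = Some h' ->
  Q (1 + cost e) rho h' -> wp M (Free e) rho h Q.
Proof.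
  intros ? ? HQ Hs. do 4 eexists. split; [econstructor; eauto|auto].
Qed.

Lemma wp_seq c1 c2 rho h (Q : nat -> registers A -> heap A -> Prop) :
  wp M c1 rho h (fun t1 rho1 h1 =>
    wp M c2 rho1 h1 (fun t2 rho2 h2 => Q (t1 + t2) rho2 h2)) ->
  wp M (Seq c1 c2) rho h Q.
Proof.
  intros H Hs. destruct (H Hs) as (t1 & m1 & rho1 & h1 & He1 & Hm1 & H2).
  destruct H2 as (t2 & m2 & rho2 & h2 & He2 & Hm2 & HQ).
  { apply exec_space in He1. lia. }
  do 4 eexists. split; [econstructor; eauto|]. split; [lia|auto].
Qed.

Lemma wp_seq_spec c1 c2 rho h (Q1 Q : nat -> registers A -> heap A -> Prop) :
  wp M c1 rho h Q1 ->
  (forall t rho1 h1, Q1 t rho1 h1 ->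
     (forall x, modifies c1 x = false -> rho1 x = rho x) ->
     wp M c2 rho1 h1 (fun t2 rho2 h2 => Q (t + t2) rho2 h2)) ->
  wp M (Seq c1 c2) rho h Q.
Proof.
  intros H1 H2. apply wp_seq. eapply wp_conseq; [exact H1|]. auto.
Qed.

Lemma wp_if e n c1 c2 rho h (Q : nat -> registers A -> heap A -> Prop) :
  eval w rho h e = Some (Int n) ->
  (n <> 0 -> wp M c1 rho h (fun t rho' h' => Q (1 + cost e + t) rho' h')) ->
  (n = 0 -> wp M c2 rho h (fun t rho' h' => Q (1 + cost e + t) rho' h')) ->
  wp M (If e c1 c2) rho h Q.
Proof.
  intros He H1 H2 Hs. destruct (Nat.eq_dec n 0) as [->|Hn].
  - destruct (H2 eq_refl Hs) as (t & m & rho' & h' & ? & ? & ?).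
    do 4 eexists. split; [eapply exec_If_false; eauto|auto].
  - destruct (H1 Hn Hs) as (t & m & rho' & h' & ? & ? & ?).
    do 4 eexists. split; [eapply exec_If_true; eauto|auto].
Qed.

(** In [I x t], [t] is the time spent on the first [x] iterations. *)
Lemma wp_while (I : nat -> nat -> registers A -> heap A -> Prop) n e c rho h
  (Q : nat -> registers A -> heap A -> Prop) :
  I 0 0 rho h ->
  (forall x t rho1 h1, x < n -> I x t rho1 h1 ->
     (forall y, modifies c y = false -> rho1 y = rho y) ->
     exists v, eval w rho1 h1 e = Some (Int v) /\ v <> 0 /\
     wp M c rho1 h1 (fun t' rho2 h2 => I (S x) (t + (1 + cost e) + t') rho2 h2)) ->
  (forall t rho1 h1, I n t rho1 h1 ->
     (forall y, modifies c y = false -> rho1 y = rho y) ->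
     eval w rho1 h1 e = Some (Int 0) /\ Q (t + (1 + cost e)) rho1 h1) ->
  wp M (While e c) rho h Q.
Proof.
  intros H0 Hstep Hend.
  assert (Hx : forall d x t rho1 h1, x + d = n -> I x t rho1 h1 ->
    (forall y, modifies c y = false -> rho1 y = rho y) ->
    wp M (While e c) rho1 h1 (fun t' rho2 h2 => Q (t + t') rho2 h2)).
  { induction d as [|d IH]; intros x t rho1 h1 Hd HI Hf Hs.
    - replace x with n in HI by lia. destruct (Hend _ _ _ HI Hf) as [He HQ].
      do 4 eexists. split; [eapply exec_While_false; eauto|]. auto.
    - destruct (Hstep x t rho1 h1) as (v & He & Hv & Hb); auto; [lia|].
      destruct (Hb Hs) as (t1 & m1 & rho2 & h2 & He1 & Hm1 & HI1).
      destruct (IH (S x) _ _ _ ltac:(lia) HI1) as (t2 & m2 & rho3 & h3 & He2 & Hm2 & HQ).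
      { intros y Hy. rewrite <- (Hf y Hy). eapply exec_modifies; eauto. }
      { apply exec_space in He1. lia. }
      do 4 eexists. split; [eapply exec_While_true; eauto|]. split; [lia|].
      rewrite !Nat.add_assoc in *. exact HQ. }
  specialize (Hx n 0 0 rho h eq_refl H0 (fun _ _ => eq_refl)). exact Hx.
Qed.

Lemma eval_lit n rho h : n < lim w -> eval w rho h (Lit n) = Some (Int n).
Proof.
  intros. cbn. unfold word. now rewrite Nat.mod_small.
Qed.

Lemma eval_var x v rho h : rho x = v -> eval w rho h (Var x) = Some v.
Proof.
  now intros <-.
Qed.

Lemma eval_deref e1 e2 b i v rho h :
  eval w rho h e1 = Some (Ptr b) -> eval w rho h e2 = Some (Int i) ->
  heap_load h b i = Some v -> eval w rho h (Deref e1 e2) = Some v.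
Proof.
  cbn. now intros -> -> ->.
Qed.

Lemma eval_add e1 e2 x y rho h :
  eval w rho h e1 = Some (Int x) -> eval w rho h e2 = Some (Int y) ->
  x + y < lim w -> eval w rho h (Binop Add e1 e2) = Some (Int (x + y)).
Proof.
  cbn. intros -> -> ?. unfold eval_binop, word. cbn. now rewrite Nat.mod_small.
Qed.

Lemma eval_sub e1 e2 x y rho h :
  eval w rho h e1 = Some (Int x) -> eval w rho h e2 = Some (Int y) ->
  x < lim w -> y <= x -> eval w rho h (Binop Sub e1 e2) = Some (Int (x - y)).
Proof.
  cbn. intros -> -> ? ?. unfold lim, word in *. cbn.
  replace (x + 2 ^ w - y) with ((x - y) + 1 * 2 ^ w) by lia.
  rewrite Nat.Div0.mod_add, Nat.mod_small by lia. reflexivity.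
Qed.

Lemma eval_mul e1 e2 x y rho h :
  eval w rho h e1 = Some (Int x) -> eval w rho h e2 = Some (Int y) ->
  x * y < lim w -> eval w rho h (Binop Mul e1 e2) = Some (Int (x * y)).
Proof.
  cbn. intros -> -> ?. unfold word. cbn. now rewrite Nat.mod_small.
Qed.

Lemma eval_div e1 e2 x y rho h :
  eval w rho h e1 = Some (Int x) -> eval w rho h e2 = Some (Int y) ->
  0 < y -> eval w rho h (Binop Div e1 e2) = Some (Int (x / y)).
Proof.
  cbn. intros -> -> ?. destruct y; [lia|]. reflexivity.
Qed.

Lemma eval_mod e1 e2 x y rho h :
  eval w rho h e1 = Some (Int x) -> eval w rho h e2 = Some (Int y) ->
  0 < y -> eval w rho h (Binop Mod e1 e2) = Some (Int (x mod y)).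
Proof.
  cbn. intros -> -> ?. destruct y; [lia|]. reflexivity.
Qed.

Lemma eval_shl e1 e2 x y rho h :
  eval w rho h e1 = Some (Int x) -> eval w rho h e2 = Some (Int y) ->
  x * 2 ^ y < lim w -> eval w rho h (Binop Shl e1 e2) = Some (Int (x * 2 ^ y)).
Proof.
  cbn [eval]. intros -> -> ?. unfold eval_binop, word. rewrite Nat.shiftl_mul_pow2.
  cbn [option_map]. now rewrite Nat.mod_small.
Qed.

Lemma word_bool b : 1 < lim w -> word w (bool_word b) = bool_word b.
Proof.
  intros. apply Nat.mod_small. destruct b; cbn; fold (lim w); lia.
Qed.

Lemma eval_less e1 e2 x y rho h :
  eval w rho h e1 = Some (Int x) -> eval w rho h e2 = Some (Int y) ->
  1 < lim w -> eval w rho h (Binop Less e1 e2) = Some (Int (bool_word (x <? y))).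
Proof.
  cbn [eval]. intros -> -> ?. unfold eval_binop, option_map.
  now rewrite word_bool.
Qed.

Lemma eval_equal e1 e2 x y rho h :
  eval w rho h e1 = Some (Int x) -> eval w rho h e2 = Some (Int y) ->
  1 < lim w -> eval w rho h (Binop Equal e1 e2) = Some (Int (bool_word (x =? y))).
Proof.
  cbn [eval]. intros -> -> ?. unfold eval_binop, option_map.
  now rewrite word_bool.
Qed.

Lemma eval_msb e1 x rho h :
  eval w rho h e1 = Some (Int x) -> 0 < x -> x < lim w ->
  eval w rho h (Unop Msb e1) = Some (Int (Nat.log2 x)).
Proof.
  cbn. intros -> ? ?. destruct (Nat.eqb_spec x 0); [lia|]. cbn. unfold word.
  rewrite Nat.mod_small; [reflexivity|].
  apply Nat.le_lt_trans with x; [|easy]. pose proof (Nat.log2_lt_lin x). lia.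
Qed.

End Logic.

Lemma less_true x y : bool_word (x <? y) <> 0 -> x < y.
Proof. now destruct (Nat.ltb_spec x y). Qed.

Lemma less_false x y : bool_word (x <? y) = 0 -> y <= x.
Proof. now destruct (Nat.ltb_spec x y). Qed.

Lemma equal_true x y : bool_word (x =? y) <> 0 -> x = y.
Proof. now destruct (Nat.eqb_spec x y). Qed.

Lemma equal_false x y : bool_word (x =? y) = 0 -> x <> y.
Proof. now destruct (Nat.eqb_spec x y). Qed.

(** * Block sizes *)

Definition bits (r m : nat) : nat := S (m / r).
Definition width (r m : nat) : nat := 4 * 2 ^ bits r m.
Definition top (r m : nat) : nat := m / bits r m.
Definition size (r m j : nat) : nat := 2 ^ Nat.min (j * bits r m) (m - m / r).
(** Word 0 of the index holds the exponent [m]; the record of a level holds [hi j], the block size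
    and then [width r m] slots. *)
Definition record (r m j : nat) : nat := 1 + j * (width r m + 2).
Definition index_length (r m : nat) : nat := record r m (S (top r m)).

Definition upd {T : Type} (f : nat -> T) (j : nat) (v : T) : nat -> T :=
  fun i => if i =? j then v else f i.

Lemma upd_eq (T : Type) (f : nat -> T) j v : upd f j v j = v.
Proof. unfold upd. now rewrite Nat.eqb_refl. Qed.

Lemma upd_neq (T : Type) (f : nat -> T) j v i : i <> j -> upd f j v i = f i.
Proof. unfold upd. intros. now destruct (Nat.eqb_spec i j). Qed.

Section Sizes.
Variables (r m : nat).
Notation b := (bits r m).
Notation k := (top r m).
Notation W := (width r m).
Notation sz := (size r m).

Lemma pow2_pos n : 0 < 2 ^ n.
Proof. apply Nat.neq_0_lt_0, Nat.pow_nonzero. lia. Qed.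

Lemma pow2_gt n : n < 2 ^ n.
Proof. apply Nat.pow_gt_lin_r. lia. Qed.

Lemma pow2_add_1 n : 2 ^ (n + 1) = 2 * 2 ^ n.
Proof. rewrite Nat.add_comm. reflexivity. Qed.

Lemma pow2_add_2 n : 2 ^ (n + 2) = 4 * 2 ^ n.
Proof. rewrite Nat.pow_add_r. cbn [Nat.pow]. lia. Qed.

Lemma size_pos j : 0 < sz j.
Proof. apply pow2_pos. Qed.

Lemma size_0 : sz 0 = 1.
Proof. reflexivity. Qed.

Lemma width_pos : 0 < W.
Proof. unfold width. pose proof (pow2_pos b). lia. Qed.

Lemma width_div : W = 8 * 2 ^ (m / r).
Proof. unfold width, bits. cbn [Nat.pow]. lia. Qed.

Lemma record_slot j s : j <= k -> s < W + 2 -> record r m j + s < index_length r m.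
Proof. unfold index_length, record. nia. Qed.

Lemma record_slot_inj j s j' s' :
  s < W + 2 -> s' < W + 2 -> record r m j + s = record r m j' + s' ->
  j = j' /\ s = s'.
Proof.
  unfold record. intros. assert (j = j'); [|subst; lia].
  destruct (Nat.lt_trichotomy j j') as [|[|]]; nia.
Qed.

Lemma record_S j : record r m (S j) = record r m j + W + 2.
Proof. unfold record. lia. Qed.

Lemma record_le j : j <= k -> record r m j + W + 2 <= index_length r m.
Proof. intros Hj. pose proof (record_slot (j:=j) (s:=W + 1) Hj). lia. Qed.

Lemma top_le_exponent : k <= m.
Proof. apply Nat.Div0.div_le_upper_bound. unfold bits. nia. Qed.

(** Justifies the slot rule [q mod W]: with equal residues but different quotients the two numbers
    would be at least [W] apart. *)
Lemma mod_window q q' q0 :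
  q0 <= q < q0 + W -> q0 <= q' < q0 + W -> q mod W = q' mod W -> q = q'.
Proof.
  intros Hq Hq' He. pose proof width_pos.
  pose proof (Nat.div_mod_eq q W). pose proof (Nat.div_mod_eq q' W).
  assert (q / W = q' / W); [|congruence].
  destruct (Nat.lt_trichotomy (q / W) (q' / W)) as [|[|]]; nia.
Qed.

Lemma div_ge a s n : 0 < s -> n <= a / s -> n * s <= a.
Proof.
  intros Hs H. pose proof (Nat.Div0.mul_div_le a s). nia.
Qed.

Lemma lt_div a s n : 0 < s -> a / s < n -> a < n * s.
Proof.
  intros Hs H. pose proof (Nat.mul_succ_div_gt a s ltac:(lia)). nia.
Qed.

Lemma div_le a s n : 0 < s -> a / s <= n -> a < (n + 1) * s.
Proof.
  intros Hs H. pose proof (Nat.mul_succ_div_gt a s ltac:(lia)). nia.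
Qed.

(** The distance from the number [N - h * s] of items after the level to [2 * s], written with
    truncated subtractions. Without blocks there is nothing to split, so a deficit is free of charge
    if [h = 0]. *)
Definition level_potential (h N s : nat) : nat :=
  (N - (h + 2) * s) + (if h =? 0 then 0 else (h + 2) * s - N).

Fixpoint potential (hi : nat -> nat) (N j : nat) : nat :=
  match j with
  | 0 => 0
  | S i => potential hi N i + level_potential (hi j) N (sz j)
  end.

(** Each of the [j] terms changes by at most one when [N] does. *)
Lemma potential_succ hi N j : potential hi (N + 1) j <= potential hi N j + j.
Proof.
  induction j; cbn [potential]; [lia|]. unfold level_potential.
  destruct (hi (S j) =? 0); lia.
Qed.

Lemma potential_pred hi N j : potential hi N j <= potential hi (N + 1) j + j.
Proof.
  induction j; cbn [potential]; [lia|]. unfold level_potential.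
  destruct (hi (S j) =? 0); lia.
Qed.

Lemma potential_ext hi hi' N j :
  (forall i, 1 <= i <= j -> hi i = hi' i) -> potential hi N j = potential hi' N j.
Proof.
  induction j; intros H; cbn [potential]; [easy|].
  rewrite IHj by (intros; apply H; lia). rewrite H by lia. reflexivity.
Qed.

Lemma potential_upd hi N i v j :
  1 <= i <= j ->
  potential (upd hi i v) N j + level_potential (hi i) N (sz i) =
  potential hi N j + level_potential v N (sz i).
Proof.
  induction j; intros Hi; [lia|]. cbn [potential].
  destruct (Nat.eq_dec i (S j)) as [->|].
  - rewrite upd_eq.
    rewrite (@potential_ext (upd hi (S j) v) hi) by (intros; apply upd_neq; lia). lia.
  - rewrite (upd_neq _ _ (i:=S j)) by lia. specialize (IHj ltac:(lia)). lia.
Qed.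

(** A merge happens exactly [s] above the target value and lands on it; the released [s] pays for
    moving [s] items. *)
Lemma level_potential_combine h s :
  level_potential h ((h + 3) * s) s >= s /\
  level_potential (h + 1) ((h + 3) * s) s = 0.
Proof.
  unfold level_potential. replace (h + 1 + 2) with (h + 3) by lia.
  destruct (h + 1 =? 0); lia.
Qed.

(** A split is detected one item below the threshold, at deficit [s + 1], and leaves a deficit of at
    most 1. *)
Lemma level_potential_split h N s :
  h <> 0 -> N + 1 = (h + 1) * s ->
  level_potential h N s >= s /\ level_potential (h - 1) N s <= 1.
Proof.
  intros H0 HN. unfold level_potential. destruct (Nat.eqb_spec h 0); [lia|].
  replace (h - 1 + 2) with (h + 1) by lia. destruct (h - 1 =? 0); lia.
Qed.

(** * Arithmetic of the capped block sizes and of the index length *)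

Hypothesis Hr : 2 <= r.

Lemma div_r_le : m / r <= m.
Proof. apply Nat.Div0.div_le_upper_bound; nia. Qed.

(** Makes the cap complementary to the number of bits per level; the test in [guess] and the width
    of the top level rest on this identity. *)
Lemma exponent_bits : m - m / r + b = S m.
Proof. pose proof div_r_le. unfold bits. lia. Qed.

Lemma top_bits : k * b <= m < (k + 1) * b.
Proof.
  unfold top. pose proof (Nat.div_mod_eq m b).
  assert (m mod b < b) by (apply Nat.mod_upper_bound; unfold bits; lia). nia.
Qed.

(** From [S j * b <= m] and [exponent_bits], the exponent [j * b] is at least one below the cap. So
    the cap can bite only at the top level, and even there it leaves a ratio of at least 2. *)
Lemma size_ratio j :
  j < k -> exists R, sz (S j) = R * sz j /\ 2 <= R <= 2 ^ b.
Proof.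
  intros Hj. pose proof top_bits. pose proof exponent_bits.
  assert (Hb : 0 < b) by (unfold bits; lia).
  assert (S j * b <= k * b) by (apply Nat.mul_le_mono_r; lia).
  rewrite Nat.mul_succ_l in *.
  exists (2 ^ (Nat.min (S j * b) (m - m / r) - j * b)).
  unfold size. rewrite (Nat.min_l (j * b)) by lia. rewrite Nat.mul_succ_l.
  split; [|split].
  - rewrite <- Nat.pow_add_r. f_equal. lia.
  - change 2 with (2 ^ 1) at 1. apply Nat.pow_le_mono_r; lia.
  - apply Nat.pow_le_mono_r; lia.
Qed.

(** The recurrence by which [new_index] computes the sizes, with one shift and one comparison per
    level. *)
Lemma size_S j : sz (S j) = Nat.min (sz j * 2 ^ b) (2 ^ (m - m / r)).
Proof.
  unfold size. rewrite <- Nat.pow_add_r, Nat.mul_succ_l.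
  set (T := m - m / r). set (x := j * b).
  destruct (Nat.le_ge_cases (Nat.min x T + b) T).
  - rewrite (Nat.min_l (2 ^ _)) by (apply Nat.pow_le_mono_r; lia).
    f_equal. lia.
  - rewrite (Nat.min_r (2 ^ _)) by (apply Nat.pow_le_mono_r; lia).
    f_equal. lia.
Qed.

Lemma size_le j : sz j <= 2 ^ (m - m / r).
Proof. apply Nat.pow_le_mono_r; lia. Qed.

Lemma pow_exponent_bits : 2 ^ (m - m / r) * 2 ^ b = 2 * 2 ^ m.
Proof.
  rewrite <- Nat.pow_add_r, exponent_bits. reflexivity.
Qed.

(** An array of maximal size spans [2 * 2 ^ b] blocks of the top level, so that the width
    [4 * 2 ^ b] suffices there too. *)
Lemma size_top : 2 ^ (m + 2) = 2 * 2 ^ b * sz k.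
Proof.
  pose proof top_bits. pose proof exponent_bits.
  unfold size. rewrite Nat.min_r by lia.
  replace (m + 2) with (2 + m) by lia. rewrite Nat.pow_add_r. cbn [Nat.pow].
  pose proof pow_exponent_bits. lia.
Qed.

(** As [b] exceeds [m / r], the product [r * b] exceeds [m], whereas [k * b] does not. *)
Lemma top_lt : k < r.
Proof.
  pose proof top_bits. unfold bits in *.
  pose proof (Nat.mul_succ_div_gt m r ltac:(lia)). nia.
Qed.

(** There are at most [r] records with [8 * 2 ^ (m / r)] slots each; the two other words of each
    record and the exponent raise 8 to 11. *)
Lemma index_length_le_r : index_length r m <= 11 * r * 2 ^ (m / r).
Proof.
  unfold index_length, record. rewrite width_div. pose proof top_lt.
  pose proof (pow2_pos (m / r)). nia.
Qed.

(** A bound without the factor [r], as the peak bound demands. If [m / r = 0], there are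
    [m + 1 <= 2 ^ m] records; otherwise their number is at most [r <= 2 * 2 ^ (r - 2)], and the
    exponent has room for [r - 2] more. *)
Lemma index_length_le : index_length r m <= 22 * 2 ^ (m - m / r).
Proof.
  unfold index_length, record. rewrite width_div.
  pose proof (pow2_pos (m / r)) as Hp.
  assert (Hk : S k * 2 ^ (m / r) <= 2 * 2 ^ (m - m / r)).
  { unfold top, bits. destruct (m / r) as [|q] eqn:Hq.
    - rewrite Nat.div_1_r, Nat.sub_0_r. pose proof (pow2_gt m). cbn [Nat.pow]. lia.
    - pose proof top_lt as Hk. unfold top, bits in Hk. rewrite Hq in Hk.
      set (k' := m / _) in *.
      assert (Hrm : r * S q <= m) by (rewrite <- Hq; apply Nat.Div0.mul_div_le).
      (* This is [r - 2 <= (r - 2) * S q], combined with [r * S q <= m]. *)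
      assert (Hs : S q + (r - 2) <= m - S q) by nia.
      apply Nat.le_trans with (2 * 2 ^ (S q + (r - 2))).
      + rewrite Nat.pow_add_r.
        assert (r <= 2 * 2 ^ (r - 2)) by (pose proof (pow2_gt (r - 2)); lia).
        nia.
      + apply Nat.mul_le_mono_l, Nat.pow_le_mono_r; lia. }
  nia.
Qed.

(** [hi j] is the number of the first block of level [j] after the blocks in
    use, so that the items before [hi j * size j] are those of the levels at
    least [j]. *)

Definition live (hi : nat -> nat) (j q : nat) : Prop :=
  j <= k /\ q < hi j /\ (j < k -> hi (S j) * sz (S j) <= q * sz j).

(** Unless [hi j = 0], at least [size j] items are at levels below [j], or possibly
    one less if [j <= x]; there are less than [3 * size j] such items, or possibly
    that many if [y < j]. *)
Record balanced (hi : nat -> nat) (N x y : nat) : Prop := {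
  bal_0 : hi 0 = N;
  bal_max : N <= 2 ^ (m + 2);
  bal_mono : forall j, j < k -> hi (S j) * sz (S j) <= hi j * sz j;
  bal_low : forall j, 1 <= j <= k ->
    hi j = 0 \/ (hi j + 1) * sz j <= N + 1 /\ (x < j -> (hi j + 1) * sz j <= N);
  bal_high : forall j, 1 <= j <= k ->
    N <= (hi j + 3) * sz j /\ (j <= y -> N < (hi j + 3) * sz j) }.

(** * Consequences of balance, and its preservation by grows, shrinks, merges and splits *)

Lemma bal_le hi N x y j : balanced hi N x y -> j <= k -> hi j * sz j <= N.
Proof.
  intros H. induction j; intros Hj.
  - rewrite size_0, (bal_0 H). lia.
  - pose proof (bal_mono H (j:=j)). lia.
Qed.

Lemma bal_le_le hi N x y i j :
  balanced hi N x y -> i <= j <= k -> hi j * sz j <= hi i * sz i.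
Proof.
  intros H [Hij Hj]. induction Hij as [|j Hij IH]; [easy|].
  pose proof (bal_mono H (j:=j)). lia.
Qed.

(** Blocks of different levels are disjoint: a live block of level [j] starts no earlier than
    [hi (S j) * sz (S j)], where the blocks of all higher levels have ended. *)
Lemma live_unique hi N x y i j q j' q' :
  balanced hi N x y -> live hi j q -> live hi j' q' ->
  q * sz j <= i < (q + 1) * sz j -> q' * sz j' <= i < (q' + 1) * sz j' ->
  j = j' /\ q = q'.
Proof.
  intros HB.
  assert (Hw : forall j q j' q', live hi j q -> live hi j' q' ->
    q * sz j <= i < (q + 1) * sz j -> q' * sz j' <= i < (q' + 1) * sz j' -> ~ j < j').
  { clear j q j' q'. intros j q j' q' (H1 & H2 & H3) (H1' & H2' & H3') Hi Hi' Hj.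
    pose proof (bal_le_le HB (i:=S j) (j:=j') ltac:(lia)).
    specialize (H3 ltac:(lia)).
    assert ((q' + 1) * sz j' <= hi j' * sz j') by (apply Nat.mul_le_mono_r; lia). lia. }
  intros Hl Hl' Hi Hi'.
  assert (j = j') as ->.
  { pose proof (Hw _ _ _ _ Hl Hl' Hi Hi'). pose proof (Hw _ _ _ _ Hl' Hl Hi' Hi). lia. }
  split; [easy|]. nia.
Qed.

(** Block numbers of level [j] start at [hi (S j) * R], and by [bal_high] at most
    [3 * R <= 3 * 2 ^ b < W] of them follow. At the top level the window starts at 0 and [size_top]
    bounds it. *)
Lemma bal_window hi N x y j :
  balanced hi N x y -> j <= k ->
  exists q0, (forall q, (j < k -> hi (S j) * sz (S j) <= q * sz j) -> q0 <= q) /\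
    N < (q0 + W) * sz j.
Proof.
  intros H Hj. pose proof (size_pos j). pose proof (pow2_pos b).
  destruct (Nat.eq_dec j k) as [->|Hne].
  - exists 0. split; [lia|]. pose proof (bal_max H). rewrite size_top in *.
    unfold width. nia.
  - destruct (@size_ratio j) as (R & HR & HR2); [lia|].
    exists (hi (S j) * R). split.
    + intros q Hq. specialize (Hq ltac:(lia)). rewrite HR in Hq. nia.
    + destruct (bal_high H (j:=S j)) as [Hh _]; [lia|]. rewrite HR in Hh.
      unfold width.
      assert ((hi (S j) + 3) * R < hi (S j) * R + 4 * 2 ^ b) by nia. nia.
Qed.

(** Opens the upward pass of a grow: with [y = 0], any level may just have reached its upper
    threshold, while the lower thresholds remain respected. *)
Lemma bal_grow hi N :
  balanced hi N 0 k -> N < 2 ^ (m + 2) -> balanced (upd hi 0 (N + 1)) (N + 1) 0 0.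
Proof.
  intros H HN. split.
  - apply upd_eq.
  - lia.
  - intros [|j] Hj; rewrite ?upd_eq, ?upd_neq by lia; [|now apply (bal_mono H)].
    pose proof (bal_mono H (j:=0) Hj). rewrite (bal_0 H) in *. rewrite size_0 in *.
    lia.
  - intros j Hj. rewrite upd_neq by lia. destruct (bal_low H Hj); lia.
  - intros j Hj. rewrite upd_neq by lia. pose proof (bal_high H Hj). lia.
Qed.

(** Opens the downward pass of a shrink: with [x = k], any level may just have fallen one item below
    its lower threshold. *)
Lemma bal_shrink hi N :
  balanced hi (N + 1) 0 k -> balanced (upd hi 0 N) N k k.
Proof.
  intros H. split.
  - apply upd_eq.
  - pose proof (bal_max H). lia.
  - intros [|j] Hj; rewrite ?upd_eq, ?upd_neq by lia; [|now apply (bal_mono H)].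
    destruct (bal_low H (j:=1)) as [->|Hl]; [lia|lia|].
    rewrite size_0. pose proof (size_pos 1). lia.
  - intros j Hj. rewrite upd_neq by lia. destruct (bal_low H Hj); lia.
  - intros j Hj. rewrite upd_neq by lia. pose proof (bal_high H Hj). lia.
Qed.

Lemma bal_no_combine hi N j :
  balanced hi N 0 j -> S j <= k -> N / sz (S j) <= hi (S j) + 2 ->
  balanced hi N 0 (S j).
Proof.
  intros [H1 H2 H3 H4 H5] Hj Hd. split; auto. intros i Hi.
  specialize (H5 i Hi). split; [tauto|]. intros Hij.
  destruct (Nat.eq_dec i (S j)) as [->|]; [|apply H5; lia].
  apply div_le in Hd; [lia|apply size_pos].
Qed.

(** The new boundary lies [2 * sz (S j) >= 4 * sz j] items before the end, farther back than the
    items after level [j] reach. Hence the merged items occupy whole blocks of level [j]. *)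
Lemma bal_combine hi N j :
  balanced hi N 0 j -> S j <= k -> hi (S j) + 2 < N / sz (S j) ->
  N = (hi (S j) + 3) * sz (S j) /\
  (hi (S j) + 1) * sz (S j) <= hi j * sz j /\
  balanced (upd hi (S j) (hi (S j) + 1)) N 0 (S j).
Proof.
  intros H Hj Hd. pose proof (size_pos (S j)) as Hs. pose proof (size_pos j).
  assert (HN : N = (hi (S j) + 3) * sz (S j)).
  { pose proof (bal_high H (j:=S j)).
    pose proof (@div_ge N (sz (S j)) (hi (S j) + 3)). lia. }
  assert (Hm : (hi (S j) + 1) * sz (S j) <= hi j * sz j).
  { destruct (Nat.eq_dec j 0) as [->|].
    - rewrite (bal_0 H), size_0. nia.
    - destruct (bal_high H (j:=j)) as [_ Hh]; [lia|]. specialize (Hh ltac:(lia)).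
      destruct (@size_ratio j) as (R & HR & HR2); [lia|]. rewrite HR in *.
      assert ((hi (S j) + 3) * R < hi j + 3) by nia. nia. }
  split; [easy|]. split; [easy|]. split.
  - rewrite upd_neq by lia. apply (bal_0 H).
  - apply (bal_max H).
  - intros i Hi. pose proof (bal_mono H Hi).
    destruct (Nat.eq_dec i j) as [->|]; [rewrite upd_eq, upd_neq; lia|].
    rewrite (upd_neq _ _ (i:=S i)) by lia.
    destruct (Nat.eq_dec i (S j)) as [->|]; [rewrite upd_eq; nia|].
    now rewrite upd_neq.
  - intros i Hi. destruct (Nat.eq_dec i (S j)) as [->|]; [|rewrite upd_neq by easy].
    + rewrite upd_eq. nia.
    + apply (bal_low H Hi).
  - intros i Hi. pose proof (bal_high H Hi).
    destruct (Nat.eq_dec i (S j)) as [->|]; [|rewrite upd_neq by easy].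
    + rewrite upd_eq. nia.
    + split; [lia|]. intros. apply (bal_high H Hi). lia.
Qed.

Lemma bal_no_split hi N j :
  balanced hi N (S j) k -> S j <= k -> hi (S j) = 0 \/ hi (S j) + 1 <= N / sz (S j) ->
  balanced hi N j k.
Proof.
  intros [H1 H2 H3 H4 H5] Hj Hd. split; auto. intros i Hi.
  destruct (H4 i Hi) as [|H]; [tauto|].
  destruct (Nat.eq_dec i (S j)) as [->|]; [|right; split; [tauto|intros; apply H; lia]].
  destruct Hd as [|Hd]; [tauto|]. apply div_ge in Hd; [|apply size_pos]. lia.
Qed.

(** The block to be split starts at [N + 1 - 2 * sz (S j)]. The next level has no blocks or leaves
    at least [sz (S (S j)) >= 2 * sz (S j)] items after it, so it ends no later than that start. *)
Lemma bal_split hi N j :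
  balanced hi N (S j) k -> S j <= k -> hi (S j) <> 0 ->
  N / sz (S j) < hi (S j) + 1 ->
  N + 1 = (hi (S j) + 1) * sz (S j) /\
  balanced (upd hi (S j) (hi (S j) - 1)) N j k.
Proof.
  intros H Hj H0 Hd. pose proof (size_pos (S j)) as Hs. pose proof (size_pos j).
  assert (HN : N + 1 = (hi (S j) + 1) * sz (S j)).
  { destruct (bal_low H (j:=S j)) as [|[? _]]; [lia|lia|].
    pose proof (@div_le N (sz (S j)) (hi (S j))). lia. }
  split; [easy|].
  assert (Hp : (hi (S j) - 1) * sz (S j) + sz (S j) = hi (S j) * sz (S j)) by nia.
  split.
  - rewrite upd_neq by lia. apply (bal_0 H).
  - apply (bal_max H).
  - intros i Hi. pose proof (bal_mono H Hi).
    destruct (Nat.eq_dec i j) as [->|]; [rewrite upd_eq, upd_neq by lia; lia|].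
    rewrite (upd_neq _ _ (i:=S i)) by lia.
    destruct (Nat.eq_dec i (S j)) as [->|]; [rewrite upd_eq|now rewrite upd_neq].
    destruct (bal_low H (j:=S (S j))) as [->|[_ Hl]]; [lia|apply Nat.le_0_l|].
    specialize (Hl ltac:(lia)).
    destruct (@size_ratio (S j)) as (R & HR & HR2); [lia|]. rewrite HR in *.
    assert ((hi (S (S j)) + 1) * R < hi (S j) + 1) by nia.
    assert (hi (S (S j)) * R <= hi (S j) - 1) by nia. nia.
  - intros i Hi. pose proof (bal_low H Hi) as Hl.
    destruct (Nat.eq_dec i (S j)) as [->|]; [|rewrite upd_neq by easy].
    + rewrite upd_eq. right. lia.
    + destruct Hl as [|Hl]; [tauto|]. right. split; [tauto|]. intros. apply Hl. lia.
  - intros i Hi. pose proof (bal_high H Hi).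
    destruct (Nat.eq_dec i (S j)) as [->|]; [|rewrite upd_neq by easy; easy].
    rewrite upd_eq. lia.
Qed.

(** * Locating an item *)

(** By [exponent_bits] the test says that [N - i] is below the cap [2 ^ (m - m / r)]; from the cap
    on, the guess is the top level. *)
Definition guess (N i : nat) : nat :=
  if Nat.log2 (N - i) + b <? m + 1 then Nat.log2 (N - i) / b else k.

Lemma guess_le N i : guess N i <= k.
Proof.
  unfold guess. destruct (Nat.ltb_spec (Nat.log2 (N - i) + b) (m + 1)); [|lia].
  apply Nat.Div0.div_le_mono. unfold bits in *. lia.
Qed.

(** The distance of the item from the end is below [2 ^ S x <= sz j], whereas a level with blocks
    has at least [sz j] items after it. *)
Lemma guess_upper hi N i j :
  balanced hi N 0 k -> i < N -> guess N i < j <= k -> hi j * sz j <= i.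
Proof.
  intros H Hi Hj. unfold guess in Hj. set (x := Nat.log2 (N - i)) in *.
  destruct (Nat.ltb_spec (x + b) (m + 1)) as [Hx|]; [|lia].
  assert (Hu : N - i < 2 ^ S x) by (apply Nat.log2_spec; lia).
  assert (2 ^ S x <= sz j).
  { apply Nat.pow_le_mono_r; [lia|]. pose proof exponent_bits.
    pose proof (Nat.mul_succ_div_gt x b ltac:(unfold bits; lia)). nia. }
  destruct (bal_low H (j:=j)) as [->|[_ Hl]]; lia.
Qed.

(** Fewer than three block sizes of items follow a level. One level down from the guess the distance
    is only known to be at least twice the block size, but two levels down it is at least four
    times. Guesses 0 and 1 end at level 0, which covers all items. *)
Lemma guess_lower hi N i :
  balanced hi N 0 k -> i < N -> i < hi (guess N i - 2) * sz (guess N i - 2).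
Proof.
  intros H Hi. pose proof (guess_le N i) as Hk.
  assert (Hs : sz (guess N i) <= N - i).
  { apply Nat.le_trans with (2 ^ Nat.log2 (N - i)); [|apply Nat.log2_spec; lia].
    unfold guess. set (x := Nat.log2 (N - i)).
    apply Nat.pow_le_mono_r; [lia|].
    destruct (Nat.ltb_spec (x + b) (m + 1)).
    - pose proof (Nat.Div0.mul_div_le x b). nia.
    - pose proof exponent_bits. lia. }
  destruct (guess N i) as [|[|j]]; cbn [Nat.sub];
    rewrite ?Nat.sub_0_r, ?(bal_0 H), ?size_0; try lia.
  destruct (@size_ratio j) as (R & HR & HR2); [lia|].
  destruct (@size_ratio (S j)) as (R' & HR' & HR2'); [lia|].
  rewrite HR', HR in Hs.
  assert (4 * sz j <= N - i) by (assert (4 <= R' * R) by nia; nia).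
  destruct (Nat.eq_dec j 0) as [->|].
  - rewrite (bal_0 H), size_0. lia.
  - destruct (bal_high H (j:=j)) as [? _]; nia.
Qed.

Lemma live_div hi j i :
  j <= k -> i < hi j * sz j -> (j < k -> hi (S j) * sz (S j) <= i) ->
  live hi j (i / sz j).
Proof.
  intros Hj Hi Hn. pose proof (size_pos j). split; [easy|]. split.
  - apply Nat.Div0.div_lt_upper_bound. lia.
  - intros Hk. specialize (Hn Hk).
    destruct (@size_ratio j) as (R & HR & _); [easy|]. rewrite HR in *.
    assert (hi (S j) * R <= i / sz j) by (apply Nat.div_le_lower_bound; lia). nia.
Qed.

End Sizes.

(** * Representation *)

Section Representation.
Variables (A : Type) (r : nat).
Implicit Types (h : heap A) (C c : list (value A)) (hi : nat -> nat).

(** [G j q] is the address and the content of block [q] of level [j]. *)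
Definition blocks : Type := nat -> nat -> option (nat * list (value A)).

Definition bupd (G : blocks) (j q : nat) (v : option (nat * list (value A))) : blocks :=
  fun j' q' => if ((j' =? j) && (q' =? q))%bool then v else G j' q'.

Lemma bupd_eq G j q v : bupd G j q v j q = v.
Proof. unfold bupd. now rewrite !Nat.eqb_refl. Qed.

Lemma bupd_neq G j q v j' q' : j' <> j \/ q' <> q -> bupd G j q v j' q' = G j' q'.
Proof.
  unfold bupd. intros. destruct (Nat.eqb_spec j' j), (Nat.eqb_spec q' q); cbn; tauto.
Qed.

Definition slot (m j q : nat) : nat := record r m j + 2 + q mod width r m.

Record index_ok (m : nat) C hi (G : blocks) : Prop := {
  ix_length : length C = index_length r m;
  ix_exponent : nth_error C 0 = Some (Int m);
  ix_hi : forall j, j <= top r m -> nth_error C (record r m j) = Some (Int (hi j));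
  ix_size : forall j, j <= top r m ->
    nth_error C (record r m j + 1) = Some (Int (size r m j));
  ix_slot : forall j q b c, G j q = Some (b, c) ->
    j <= top r m /\ nth_error C (slot m j q) = Some (Ptr b) }.

(** The memory consists of the index block [p], the blocks in [G], and the
    blocks described by [D], which are left alone. *)
Record stored_with (D : nat -> list (value A) -> Prop) h (p m : nat) hi (G : blocks)
  (s : nat) C : Prop := {
  st_index : block_at h p = Some C;
  st_ok : index_ok m C hi G;
  st_block : forall j q b c, G j q = Some (b, c) -> block_at h b = Some c /\ b <> p;
  st_inj : forall j q j' q' b c c', G j q = Some (b, c) -> G j' q' = Some (b, c') ->
    j = j' /\ q = q';
  st_other : forall b c, D b c ->
    block_at h b = Some c /\ b <> p /\ forall j q c', G j q <> Some (b, c');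
  st_all : forall b c, block_at h b = Some c ->
    b = p \/ (exists j q, G j q = Some (b, c)) \/ D b c;
  st_space : space h = s }.

Definition stored D h p m hi G s : Prop := exists C, stored_with D h p m hi G s C.

(** What locating an item relies on. During a rebuilding the old index still satisfies it although
    some of the blocks in [G] are already deallocated. *)
Definition index_at h (p m : nat) hi (G : blocks) : Prop :=
  exists C, block_at h p = Some C /\ index_ok m C hi G.

Lemma stored_index D h p m hi G s : stored D h p m hi G s -> index_at h p m hi G.
Proof. intros [C H]. exists C. split; apply H. Qed.

Section Index.
Variables (h : heap A) (p m : nat) (hi : nat -> nat) (G : blocks).
Hypothesis HI : index_at h p m hi G.

Lemma load_exponent : heap_load h p 0 = Some (Int m).
Proof.
  destruct HI as (C & Hb & H). eapply heap_load_block; [exact Hb|apply H].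
Qed.

Lemma load_hi j : j <= top r m -> heap_load h p (record r m j) = Some (Int (hi j)).
Proof.
  intros Hj. destruct HI as (C & Hb & H).
  eapply heap_load_block; [exact Hb|]. now apply (ix_hi H).
Qed.

Lemma load_size j :
  j <= top r m -> heap_load h p (record r m j + 1) = Some (Int (size r m j)).
Proof.
  intros Hj. destruct HI as (C & Hb & H).
  eapply heap_load_block; [exact Hb|]. now apply (ix_size H).
Qed.

Lemma load_slot j q b c :
  G j q = Some (b, c) -> heap_load h p (slot m j q) = Some (Ptr b).
Proof.
  intros E. destruct HI as (C & Hb & H).
  eapply heap_load_block; [exact Hb|]. apply (ix_slot H _ _ E).
Qed.

End Index.

(** * Effect of the memory primitives on the representation *)

Section Accesses.
Variables (D : nat -> list (value A) -> Prop) (h : heap A) (p m : nat)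
  (hi : nat -> nat) (G : blocks) (s : nat).
Hypothesis HS : stored D h p m hi G s.

Lemma load_block j q b c x v :
  G j q = Some (b, c) -> nth_error c x = Some v -> heap_load h b x = Some v.
Proof.
  intros E. destruct HS as [C H]. apply heap_load_block, (st_block H _ _ E).
Qed.

Lemma stored_space : space h = s.
Proof. destruct HS as [C H]. apply (st_space H). Qed.

Lemma slot_lt j q : j <= top r m -> slot m j q < index_length r m.
Proof.
  intros. unfold slot. rewrite <- Nat.add_assoc. apply record_slot; [easy|].
  pose proof (Nat.mod_upper_bound q (width r m)). pose proof (width_pos r m). lia.
Qed.

Lemma slot_inj j q j' q' :
  slot m j q = slot m j' q' -> j = j' /\ q mod width r m = q' mod width r m.
Proof.
  unfold slot. rewrite <- !Nat.add_assoc. intros H. pose proof (width_pos r m).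
  pose proof (Nat.mod_upper_bound q (width r m)).
  pose proof (Nat.mod_upper_bound q' (width r m)).
  apply record_slot_inj in H; lia.
Qed.

Lemma store_hi j v :
  j <= top r m ->
  exists h', heap_store h p (record r m j) (Int v) = Some h' /\
    stored D h' p m (upd hi j v) G s.
Proof.
  intros Hj. destruct HS as [C [H1 H2 H3 H4 H5 H6 H7]].
  pose proof (@record_slot r m j 0 Hj ltac:(lia)) as Hl. rewrite Nat.add_0_r in Hl.
  rewrite <- (ix_length H2) in Hl.
  destruct (@heap_store_block _ h p C (record r m j) (Int v) H1 Hl)
    as (h' & E & Hs & _ & Hb).
  exists h'. split; [exact E|]. eexists. split.
  - rewrite Hb, Nat.eqb_refl. reflexivity.
  - destruct H2 as [I1 I2 I3 I4 I5]. split.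
    + now rewrite length_set_nth.
    + rewrite nth_error_set_nth by easy. unfold record at 1. cbn. exact I2.
    + intros i Hi. rewrite nth_error_set_nth by easy.
      destruct (Nat.eqb_spec (record r m i) (record r m j)) as [Ei|Ei].
      * assert (i = j) as -> by (apply (@record_slot_inj r m i 0 j 0); lia).
        now rewrite upd_eq.
      * rewrite upd_neq by (intros ->; tauto). auto.
    + intros i Hi. rewrite nth_error_set_nth by easy.
      destruct (Nat.eqb_spec (record r m i + 1) (record r m j)) as [Ei|Ei]; auto.
      pose proof (@record_slot_inj r m i 1 j 0). lia.
    + intros i q b c E'. split; [now apply (I5 _ _ _ _ E')|].
      rewrite nth_error_set_nth by easy.
      destruct (Nat.eqb_spec (slot m i q) (record r m j)) as [Ei|Ei].
      * pose proof (width_pos r m).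
        pose proof (Nat.mod_upper_bound q (width r m)). unfold slot in Ei.
        pose proof (@record_slot_inj r m i (2 + q mod width r m) j 0). lia.
      * now apply (I5 _ _ _ _ E').
  - intros i q b c E'. rewrite Hb. destruct (H3 i q b c E') as [E'' Hne].
    destruct (Nat.eqb_spec b p); [tauto|easy].
  - exact H4.
  - intros b c Hd. destruct (H5 b c Hd) as (E' & Hne & Hg). rewrite Hb.
    destruct (Nat.eqb_spec b p); [tauto|easy].
  - intros b c. rewrite Hb. destruct (Nat.eqb_spec b p); [tauto|]. apply H6.
  - congruence.
Qed.

Lemma store_block j q b c x v :
  G j q = Some (b, c) -> x < length c ->
  exists h', heap_store h b x v = Some h' /\
    stored D h' p m hi (bupd G j q (Some (b, set_nth c x v))) s.
Proof.
  intros Eg Hx. destruct HS as [C [H1 H2 H3 H4 H5 H6 H7]].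
  destruct (H3 _ _ _ _ Eg) as [Eb Hne].
  destruct (@heap_store_block _ h b c x v Eb Hx) as (h' & E & Hs & _ & Hb).
  exists h'. split; [exact E|]. exists C.
  assert (HG : forall i q' b' c',
    bupd G j q (Some (b, set_nth c x v)) i q' = Some (b', c') ->
    i = j /\ q' = q /\ b' = b /\ c' = set_nth c x v /\ G i q' = Some (b', c) \/
    b' <> b /\ G i q' = Some (b', c')).
  { intros i q' b' c'. unfold bupd.
    destruct (Nat.eqb_spec i j) as [->|Hi], (Nat.eqb_spec q' q) as [->|Hq]; cbn.
    1: { intros [= <- <-]. left. tauto. }
    all: intros E'; right; (split; [|exact E']); intros ->;
      destruct (H4 _ _ _ _ _ _ _ Eg E'); congruence. }
  split.
  - rewrite Hb. destruct (Nat.eqb_spec p b); [congruence|easy].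
  - destruct H2 as [I1 I2 I3 I4 I5]. split; auto. intros i q' b' c' E'.
    destruct (HG _ _ _ _ E') as [(-> & -> & -> & _ & E'')|[_ E'']]; eauto.
  - intros i q' b' c' E'. rewrite Hb.
    destruct (HG _ _ _ _ E') as [(-> & -> & -> & -> & E'')|[Hn E'']].
    + now rewrite Nat.eqb_refl.
    + destruct (Nat.eqb_spec b' b); [tauto|eauto].
  - intros i q' i' q'' b' c' c'' E' E''.
    destruct (HG _ _ _ _ E') as [(_ & _ & _ & _ & E1)|[_ E1]];
    destruct (HG _ _ _ _ E'') as [(_ & _ & _ & _ & E2)|[_ E2]]; eauto.
  - intros b' c' Hd. destruct (H5 b' c' Hd) as (E' & Hn & Hg). rewrite Hb.
    destruct (Nat.eqb_spec b' b) as [->|]; [now destruct (Hg j q c)|].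
    split; [easy|]. split; [easy|]. intros i q' c'' E''.
    destruct (HG _ _ _ _ E'') as [(_ & _ & _ & _ & E1)|[_ E1]];
      [now destruct (Hg _ _ _ E1)|now destruct (Hg _ _ _ E1)].
  - intros b' c'. rewrite Hb. destruct (Nat.eqb_spec b' b) as [->|Hn].
    + intros [= <-]. right. left. exists j, q. apply bupd_eq.
    + intros E'. destruct (H6 _ _ E') as [|[(i & q' & E'')|]]; [tauto| |tauto].
      right. left. exists i, q'. rewrite bupd_neq; [easy|].
      destruct (Nat.eq_dec i j), (Nat.eq_dec q' q); subst; try tauto. congruence.
  - congruence.
Qed.

(** The slot keeps its stale pointer: [ix_slot] constrains only the slots of blocks in [G], and
    [new_block] overwrites the slot when it is reused. *)
Lemma free_block j q b c :
  G j q = Some (b, c) ->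
  length c <= s /\
  exists h', heap_free h b = Some h' /\
    stored D h' p m hi (bupd G j q None) (s - length c).
Proof.
  intros Eg. destruct HS as [C [H1 H2 H3 H4 H5 H6 H7]].
  destruct (H3 _ _ _ _ Eg) as [Eb Hne].
  destruct (heap_free_block h b Eb) as (h' & E & Hs & Hb).
  split; [lia|]. exists h'. split; [exact E|]. exists C.
  assert (HG : forall i q' b' c',
    bupd G j q None i q' = Some (b', c') -> b' <> b /\ G i q' = Some (b', c')).
  { intros i q' b' c'. unfold bupd.
    destruct (Nat.eqb_spec i j) as [->|Hi], (Nat.eqb_spec q' q) as [->|Hq]; cbn;
      [easy| | |]; intros E'; (split; [|exact E']); intros ->;
      destruct (H4 _ _ _ _ _ _ _ Eg E'); congruence. }
  split.
  - rewrite Hb. destruct (Nat.eqb_spec p b); [congruence|easy].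
  - destruct H2 as [I1 I2 I3 I4 I5]. split; auto. intros i q' b' c' E'.
    destruct (HG _ _ _ _ E'). eauto.
  - intros i q' b' c' E'. rewrite Hb. destruct (HG _ _ _ _ E').
    destruct (Nat.eqb_spec b' b); [tauto|eauto].
  - intros i q' i' q'' b' c' c'' E' E''.
    destruct (HG _ _ _ _ E'), (HG _ _ _ _ E''). eauto.
  - intros b' c' Hd. destruct (H5 b' c' Hd) as (E' & Hn & Hg). rewrite Hb.
    destruct (Nat.eqb_spec b' b) as [->|]; [now destruct (Hg j q c)|].
    split; [easy|]. split; [easy|]. intros i q' c'' E''.
    destruct (HG _ _ _ _ E'') as [_ E1]. now destruct (Hg _ _ _ E1).
  - intros b' c'. rewrite Hb. destruct (Nat.eqb_spec b' b) as [->|Hn]; [easy|].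
    intros E'. destruct (H6 _ _ E') as [|[(i & q' & E'')|]]; [tauto| |tauto].
    right. left. exists i, q'. rewrite bupd_neq; [easy|].
    destruct (Nat.eq_dec i j), (Nat.eq_dec q' q); subst; try tauto. congruence.
  - lia.
Qed.

(** Allocation and the store of the pointer are treated together, because the heap between them
    contains a block that is neither in [G] nor in [D]. *)
Lemma new_block j q n :
  j <= top r m ->
  (forall q' b c, G j q' = Some (b, c) -> q' mod width r m <> q mod width r m) ->
  exists h', heap_store (heap_alloc h n) p (slot m j q) (Ptr (length h)) = Some h' /\
    stored D h' p m hi (bupd G j q (Some (length h, repeat Undef n))) (s + n).
Proof.
  intros Hj Hq. destruct HS as [C [H1 H2 H3 H4 H5 H6 H7]].
  pose proof (block_at_lt _ _ H1) as Hp.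
  assert (Hl : slot m j q < length C)
    by (rewrite (ix_length H2); now apply slot_lt).
  assert (H1' : block_at (heap_alloc h n) p = Some C).
  { rewrite block_at_alloc. destruct (Nat.eqb_spec p (length h)); [lia|easy]. }
  destruct (@heap_store_block _ (heap_alloc h n) p C (slot m j q) (Ptr (length h)) H1' Hl)
    as (h' & E & Hs & _ & Hb).
  exists h'. split; [exact E|]. exists (set_nth C (slot m j q) (Ptr (length h))).
  assert (HG : forall i q' b' c',
    bupd G j q (Some (length h, repeat Undef n)) i q' = Some (b', c') ->
    i = j /\ q' = q /\ b' = length h /\ c' = repeat Undef n \/
    b' < length h /\ G i q' = Some (b', c') /\ block_at h b' = Some c' /\ b' <> p).
  { intros i q' b' c'. unfold bupd.
    destruct (Nat.eqb_spec i j) as [->|Hi], (Nat.eqb_spec q' q) as [->|Hq']; cbn.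
    1: { intros [= <- <-]. left. tauto. }
    all: intros E'; right; destruct (H3 _ _ _ _ E') as [Eb ?];
      pose proof (block_at_lt _ _ Eb); auto. }
  assert (Hb' : forall b' c', block_at h b' = Some c' -> b' <> p ->
    block_at h' b' = Some c').
  { intros b' c' E' Hn. rewrite Hb, block_at_alloc. pose proof (block_at_lt _ _ E').
    destruct (Nat.eqb_spec b' p), (Nat.eqb_spec b' (length h)); [lia..|easy]. }
  split.
  - rewrite Hb. now rewrite Nat.eqb_refl.
  - destruct H2 as [I1 I2 I3 I4 I5]. pose proof (width_pos r m).
    pose proof (Nat.mod_upper_bound q (width r m)) as Hm.
    split.
    + now rewrite length_set_nth.
    + rewrite nth_error_set_nth by easy. unfold slot, record. cbn. exact I2.
    + intros i Hi. rewrite nth_error_set_nth by easy.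
      destruct (Nat.eqb_spec (record r m i) (slot m j q)) as [Ei|Ei]; auto.
      unfold slot in Ei.
      pose proof (@record_slot_inj r m i 0 j (2 + q mod width r m)). lia.
    + intros i Hi. rewrite nth_error_set_nth by easy.
      destruct (Nat.eqb_spec (record r m i + 1) (slot m j q)) as [Ei|Ei]; auto.
      unfold slot in Ei.
      pose proof (@record_slot_inj r m i 1 j (2 + q mod width r m)). lia.
    + intros i q' b' c' E'. rewrite nth_error_set_nth by easy.
      destruct (HG _ _ _ _ E') as [(-> & -> & -> & _)|(_ & E'' & _)].
      * now rewrite Nat.eqb_refl.
      * destruct (I5 _ _ _ _ E'') as [Hi Es]. split; [easy|].
        destruct (Nat.eqb_spec (slot m i q') (slot m j q)) as [Ei|]; [|easy].
        apply slot_inj in Ei. destruct Ei as [-> Ei].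
        now destruct (Hq _ _ _ E'').
  - intros i q' b' c' E'.
    destruct (HG _ _ _ _ E') as [(-> & -> & -> & ->)|(_ & _ & Eb & Hn)].
    + rewrite Hb, block_at_alloc, Nat.eqb_refl.
      destruct (Nat.eqb_spec (length h) p); [lia|split; [easy|lia]].
    + auto.
  - intros i q' i' q'' b' c' c'' E' E''.
    destruct (HG _ _ _ _ E') as [(-> & -> & Hl1 & _)|(Hl1 & E1 & _)];
    destruct (HG _ _ _ _ E'') as [(-> & -> & Hl2 & _)|(Hl2 & E2 & _)];
      [easy|lia|lia|eauto].
  - intros b' c' Hd. destruct (H5 b' c' Hd) as (E' & Hn & Hg).
    pose proof (block_at_lt _ _ E').
    split; [auto|]. split; [easy|]. intros i q' c'' E''.
    destruct (HG _ _ _ _ E'') as [(_ & _ & -> & _)|(_ & E1 & _)]; [lia|].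
    now destruct (Hg i q' c'').
  - intros b' c'. rewrite Hb, block_at_alloc.
    destruct (Nat.eqb_spec b' p); [tauto|].
    destruct (Nat.eqb_spec b' (length h)) as [->|].
    + intros [= <-]. right. left. exists j, q. apply bupd_eq.
    + intros E'. destruct (H6 _ _ E') as [|[(i & q' & E'')|]]; [tauto| |tauto].
      right. left. exists i, q'. rewrite bupd_neq; [easy|].
      destruct (Nat.eq_dec i j), (Nat.eq_dec q' q); subst; try tauto.
      destruct (Hq _ _ _ E''). reflexivity.
  - rewrite Hs, space_alloc. lia.
Qed.

Lemma free_other b c :
  D b c ->
  length c <= s /\
  exists h', heap_free h b = Some h' /\
    stored (fun b' c' => D b' c' /\ b' <> b) h' p m hi G (s - length c).
Proof.
  intros Hd. destruct HS as [C [H1 H2 H3 H4 H5 H6 H7]].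
  destruct (H5 _ _ Hd) as (Eb & Hne & Hg).
  destruct (heap_free_block h b Eb) as (h' & E & Hs & Hb).
  split; [lia|]. exists h'. split; [exact E|]. exists C. split; auto.
  - rewrite Hb. destruct (Nat.eqb_spec p b); [congruence|easy].
  - intros i q' b' c' E'. rewrite Hb.
    destruct (Nat.eqb_spec b' b) as [->|]; [now destruct (Hg i q' c')|eauto].
  - intros b' c' [Hd' Hn]. destruct (H5 b' c' Hd') as (E' & Hn' & Hg'). rewrite Hb.
    destruct (Nat.eqb_spec b' b); [tauto|easy].
  - intros b' c'. rewrite Hb. destruct (Nat.eqb_spec b' b) as [->|Hn]; [easy|].
    intros E'. destruct (H6 _ _ E') as [|[|]]; tauto.
  - lia.
Qed.

Lemma stored_other b c i v :
  D b c -> nth_error c i = Some v -> heap_load h b i = Some v.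
Proof.
  intros Hd. destruct HS as [C H]. apply heap_load_block, (st_other H _ _ Hd).
Qed.

Lemma stored_ext D' :
  (forall b c, D b c <-> D' b c) -> stored D' h p m hi G s.
Proof.
  intros HD. destruct HS as [C [H1 H2 H3 H4 H5 H6 H7]]. exists C.
  split; auto; intros b c; rewrite <- HD; auto.
Qed.

End Accesses.

Definition holds (m : nat) (g : nat -> value A) (j q : nat) c : Prop :=
  length c = size r m j /\
  forall x, x < size r m j -> nth_error c x = Some (g (q * size r m j + x)).

Definition represents (m : nat) hi (g : nat -> value A) (G : blocks) : Prop :=
  (forall j q, G j q <> None <-> live r m hi j q) /\
  forall j q b c, G j q = Some (b, c) -> holds m g j q c.

Lemma represents_live m hi g G j q :
  represents m hi g G -> live r m hi j q ->
  exists b c, G j q = Some (b, c) /\ holds m g j q c.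
Proof.
  intros [H1 H2] Hl. apply H1 in Hl. destruct (G j q) as [[b c]|] eqn:E; [|easy].
  eauto.
Qed.

End Representation.

(** * Moving items between levels *)

Declare Scope code_scope.
Delimit Scope code_scope with code.
Notation "$ x" := (Var x) (at level 1, format "$ x") : code_scope.
Notation "e1 + e2" := (Binop Add e1 e2) : code_scope.
Notation "e1 - e2" := (Binop Sub e1 e2) : code_scope.
Notation "e1 * e2" := (Binop Mul e1 e2) : code_scope.
Notation "e1 / e2" := (Binop Div e1 e2) : code_scope.
Notation "e1 'mod' e2" := (Binop Mod e1 e2) : code_scope.
Notation "e1 << e2" := (Binop Shl e1 e2) (at level 55, left associativity) : code_scope.
Notation "e1 < e2" := (Binop Less e1 e2) : code_scope.
Notation "e1 == e2" := (Binop Equal e1 e2) (at level 70) : code_scope.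
Notation "e1 @ e2" := (Deref e1 e2) (at level 31, left associativity) : code_scope.
Notation "x ::= e" := (Assign x e) (at level 80) : code_scope.
Notation "c1 ;; c2" := (Seq c1 c2) (at level 90, right associativity) : code_scope.

Definition slot_expr (base width size position : expr) : expr :=
  (base + Lit 2 + (position / size) mod width)%code.

(** Registers: 40 index block, 41 first position, 42 number of positions, 43 and
    44 records of the source and target levels, 45 width, 46 and 47 block sizes
    of the two levels. *)

Definition allocate_target : cmd :=
 (While ($48 < $42)
   (Alloc 49 $47;;
    Store $40 (slot_expr $44 $45 $47 ($41 + $48)) $49;;
    48 ::= $48 + $47))%code.

Definition copy_source : cmd :=
 (While ($48 < $42)
   (Store ($40 @ slot_expr $44 $45 $47 ($41 + $48)) (($41 + $48) mod $47)
      ($40 @ slot_expr $43 $45 $46 ($41 + $48) @ (($41 + $48) mod $46));;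
    48 ::= $48 + Lit 1))%code.

Definition free_source : cmd :=
 (While ($48 < $42)
   (Free ($40 @ slot_expr $43 $45 $46 ($41 + $48));;
    48 ::= $48 + $46))%code.

(** One routine serves merges ([R] blocks into one) and splits (one into [R]). All targets are
    allocated before any source is deallocated, which costs as many extra words as there are
    items. *)
Definition transfer : cmd :=
 (46 ::= $40 @ ($43 + Lit 1);;
  47 ::= $40 @ ($44 + Lit 1);;
  48 ::= Lit 0;;
  allocate_target;;
  48 ::= Lit 0;;
  copy_source;;
  48 ::= Lit 0;;
  free_source)%code.

(** Looks a register up through [set_reg], falling back on the frame hypotheses left by called
    routines. *)
Ltac reg :=
  unfold set_reg; cbn [Nat.eqb];
  first
  [ eassumption
  | match goal with
    | Hf : forall y, modifies _ y = false -> ?rho y = _ |- ?rho ?x = _ =>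
        rewrite (Hf x) by reflexivity; reg
    end
  | reflexivity ].

(** Evaluates an expression syntactically; the side conditions that no word overflows are tried with
    [lia]. *)
Ltac ev :=
  lazymatch goal with
  | |- eval _ _ _ (Lit _) = _ => apply eval_lit; try lia
  | |- eval _ _ _ (Var _) = _ => apply eval_var; reg
  | |- eval _ _ _ (Deref _ _) = _ => eapply eval_deref; [ev|ev|try eassumption]
  | |- eval _ _ _ (Binop Add _ _) = _ => eapply eval_add; [ev|ev|try lia]
  | |- eval _ _ _ (Binop Sub _ _) = _ => eapply eval_sub; [ev|ev|try lia|try lia]
  | |- eval _ _ _ (Binop Mul _ _) = _ => eapply eval_mul; [ev|ev|try lia]
  | |- eval _ _ _ (Binop Div _ _) = _ => eapply eval_div; [ev|ev|try lia]
  | |- eval _ _ _ (Binop Mod _ _) = _ => eapply eval_mod; [ev|ev|try lia]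
  | |- eval _ _ _ (Binop Shl _ _) = _ => eapply eval_shl; [ev|ev|try lia]
  | |- eval _ _ _ (Binop Less _ _) = _ => eapply eval_less; [ev|ev|try lia]
  | |- eval _ _ _ (Binop Equal _ _) = _ => eapply eval_equal; [ev|ev|try lia]
  | |- eval _ _ _ (Unop Msb _) = _ => eapply eval_msb; [ev|try lia|try lia]
  | |- _ => idtac
  end.

Ltac step_assign := apply wp_seq; eapply wp_assign; [ev|cbv beta].
Ltac less_tac H := match goal with
  | |- context [bool_word (?x <? ?y)] =>
      destruct (Nat.ltb_spec x y) as [H|H]; cbn [bool_word]
  end.

Section Transfer.
Variables (A : Type) (w M r m : nat) (D : nat -> list (value A) -> Prop)
  (p : nat) (hi : nat -> nat) (g : nat -> value A) (js jd qs qd ns nd a len q0 : nat).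

Notation W := (width r m).
Notation Es := (size r m js).
Notation Ed := (size r m jd).

Hypothesis Hjs : js <= top r m.
Hypothesis Hjd : jd <= top r m.
Hypothesis Hne : js <> jd.
Hypothesis Has : a = qs * Es.
Hypothesis Had : a = qd * Ed.
Hypothesis Hls : len = ns * Es.
Hypothesis Hld : len = nd * Ed.
Hypothesis Hlen : 0 < len.
Hypothesis Hlim : index_length r m < lim w.
Hypothesis Halen : a + len < lim w.
Hypothesis Hq0 : q0 <= qd.
Hypothesis Hq0W : qd + nd <= q0 + W.

Implicit Types (rho : registers A) (h : heap A) (G : blocks A).

Definition in_source (j q : nat) : Prop := j = js /\ qs <= q < qs + ns.
Definition in_target (j q : nat) : Prop := j = jd /\ qd <= q < qd + nd.

Record transfer_registers rho : Prop := {
  tr_40 : rho 40 = Ptr p;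
  tr_41 : rho 41 = Int a;
  tr_42 : rho 42 = Int len;
  tr_43 : rho 43 = Int (record r m js);
  tr_44 : rho 44 = Int (record r m jd);
  tr_45 : rho 45 = Int W }.

Lemma slot_mod_lt j q : j <= top r m -> record r m j + 2 + q mod W < lim w.
Proof. intros Hj. pose proof (slot_lt _ _ q Hj) as H. unfold slot in H. lia. Qed.

Lemma record_lt j : j <= top r m -> record r m j + 2 < lim w.
Proof. intros Hj. pose proof (slot_mod_lt 0 Hj). lia. Qed.

(** The last premise confines the existing blocks of the target level to a window of length [W] that
    also contains the new ones; by [mod_window] no slot in use is overwritten. *)
Lemma allocate_target_spec rho h G s :
  stored r D h p m hi G s -> s + len <= M ->
  transfer_registers rho -> rho 47 = Int Ed -> rho 48 = Int 0 ->
  (forall q b c, G jd q = Some (b, c) -> q0 <= q < q0 + W /\ ~ in_target jd q) ->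
  wp w M allocate_target rho h (fun t rho' h' => t <= 25 * len + 4 /\
    exists G', stored r D h' p m hi G' (s + len) /\
      (forall q, in_target jd q -> exists b, G' jd q = Some (b, repeat Undef Ed)) /\
      (forall j q, ~ in_target j q -> G' j q = G j q)).
Proof.
  intros HS HM [R40 R41 R42 R43 R44 R45] R47 R48 HG.
  pose proof (size_pos r m jd) as Hd. pose proof (width_pos r m).
  pose proof (slot_mod_lt 0 Hjd).
  apply wp_while with (n := nd) (I := fun x t rho1 h1 =>
    rho1 48 = Int (x * Ed) /\ t <= x * 25 /\
    exists G', stored r D h1 p m hi G' (s + x * Ed) /\
      (forall q, qd <= q < qd + x -> exists b, G' jd q = Some (b, repeat Undef Ed)) /\
      (forall j q, ~ (j = jd /\ qd <= q < qd + x) -> G' j q = G j q)).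
  - split; [exact R48|]. split; [lia|]. exists G. split; [now rewrite Nat.add_0_r|].
    split; [lia|auto].
  - intros x t rho1 h1 Hx (Q48 & Ht & G' & HS' & K1 & K2) Hf.
    assert (Hxl : S x * Ed <= len) by (rewrite Hld; apply Nat.mul_le_mono_r; lia).
    rewrite Nat.mul_succ_l in Hxl.
    assert (Hq : (a + x * Ed) / Ed = qd + x)
      by (rewrite Had, <- Nat.mul_add_distr_r; apply Nat.div_mul; lia).
    eexists. split; [ev|]. less_tac Hlt; [|lia]. split; [lia|].
    apply wp_seq. eapply wp_alloc; [ev| |].
    { rewrite (stored_space HS'). lia. }
    destruct (new_block HS' (qd + x) Ed Hjd) as (h2 & Es2 & HS2).
    { intros q' b c E Hm.
      destruct (Nat.lt_ge_cases q' qd); [|destruct (Nat.lt_ge_cases q' (qd + x))].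
      - rewrite K2 in E by lia. apply HG in E. apply mod_window with (q0 := q0) in Hm; lia.
      - apply mod_window with (q0 := q0) in Hm; lia.
      - rewrite K2 in E by lia. apply HG in E. unfold in_target in E.
        apply mod_window with (q0 := q0) in Hm; lia. }
    pose proof (slot_mod_lt (qd + x) Hjd).
    apply wp_seq. eapply wp_store; [ev|unfold slot_expr; ev; rewrite ?Hq; lia|ev| |].
    { rewrite Hq. exact Es2. }
    eapply wp_assign; [ev|]. split; [unfold set_reg; cbn [Nat.eqb]; f_equal; lia|].
    split; [unfold slot_expr; cbn [cost]; lia|]. eexists. split; [|split].
    + replace (s + S x * Ed) with (s + x * Ed + Ed) by lia. exact HS2.
    + intros q Hqq. destruct (Nat.eq_dec q (qd + x)) as [->|].
      * rewrite bupd_eq. eauto.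
      * rewrite bupd_neq by lia. apply K1. lia.
    + intros j q Hn. rewrite bupd_neq by lia. apply K2. lia.
  - intros t rho1 h1 (Q48 & Ht & G' & HS' & K1 & K2) Hf. split.
    + rewrite <- Hld in Q48.
      replace (Int 0) with (@Int A (bool_word (len <? len)))
        by (now rewrite Nat.ltb_irrefl). ev.
    + split; [unfold slot_expr; cbn [cost]; nia|]. exists G'. rewrite Hld. split; [exact HS'|].
      split; [intros q [_ Hq]; auto|intros j q Hn; apply K2; exact Hn].
Qed.

Lemma copy_source_spec rho h G s :
  stored r D h p m hi G s ->
  transfer_registers rho -> rho 46 = Int Es -> rho 47 = Int Ed -> rho 48 = Int 0 ->
  (forall q, in_source js q -> exists b c, G js q = Some (b, c) /\ holds r m g js q c) ->
  (forall q, in_target jd q -> exists b, G jd q = Some (b, repeat Undef Ed)) ->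
  wp w M copy_source rho h (fun t rho' h' => t <= 50 * len + 4 /\
    exists G', stored r D h' p m hi G' s /\
      (forall q, in_target jd q ->
         exists b c, G' jd q = Some (b, c) /\ holds r m g jd q c) /\
      (forall j q, ~ in_target j q -> G' j q = G j q)).
Proof.
  intros HS [R40 R41 R42 R43 R44 R45] R46 R47 R48 Hsrc Hdst.
  pose proof (size_pos r m jd) as Hd. pose proof (size_pos r m js) as Hs.
  pose proof (width_pos r m).
  pose proof (record_lt Hjs). pose proof (record_lt Hjd).
  apply wp_while with (n := len) (I := fun x t rho1 h1 =>
    rho1 48 = Int x /\ t <= x * 50 /\
    exists G', stored r D h1 p m hi G' s /\
      (forall q, in_target jd q -> exists b c, G' jd q = Some (b, c) /\
         length c = Ed /\
         forall y, y < Ed -> q * Ed + y < a + x -> nth_error c y = Some (g (q * Ed + y))) /\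
      (forall j q, ~ in_target j q -> G' j q = G j q)).
  - split; [exact R48|]. split; [lia|]. exists G. split; [easy|]. split; [|auto].
    intros q Hq. destruct (Hdst q Hq) as [b Hb]. exists b, (repeat Undef Ed).
    split; [easy|]. split; [apply repeat_length|]. destruct Hq. nia.
  - intros x t rho1 h1 Hx (Q48 & Ht & G' & HS' & K1 & K2) Hf.
    pose proof (Nat.div_mod_eq (a + x) Ed) as Ed1.
    pose proof (Nat.mod_upper_bound (a + x) Ed ltac:(lia)) as Ed2.
    pose proof (Nat.div_mod_eq (a + x) Es) as Es1.
    pose proof (Nat.mod_upper_bound (a + x) Es ltac:(lia)) as Es2.
    assert (Htd : in_target jd ((a + x) / Ed)) by (split; [easy|nia]).
    assert (Hts : in_source js ((a + x) / Es)) by (split; [easy|nia]).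
    destruct (Hsrc _ Hts) as (bs & cs & Gs & Ls & Cs).
    rewrite <- (K2 js) in Gs by (intros [? _]; lia).
    destruct (K1 _ Htd) as (bd & cd & Gd & Ld & Cd).
    pose proof (load_slot (stored_index HS') _ _ Gs) as Ls1.
    pose proof (load_slot (stored_index HS') _ _ Gd) as Ld1.
    pose proof (load_block HS' _ _ _ Gs (Cs _ Es2)) as Lv.
    replace ((a + x) / Es * Es + (a + x) mod Es) with (a + x) in Lv by lia.
    destruct (store_block HS' _ _ (x := (a + x) mod Ed) (g (a + x)) Gd)
      as (h2 & E2 & HS2); [lia|].
    pose proof (slot_mod_lt ((a + x) / Ed) Hjd).
    pose proof (slot_mod_lt ((a + x) / Es) Hjs).
    unfold slot in *.
    eexists. split; [ev|]. less_tac Hlt; [|lia]. split; [lia|].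
    apply wp_seq. eapply wp_store; [unfold slot_expr; ev|ev|unfold slot_expr; ev|eassumption|].
    eapply wp_assign; [ev|]. split; [unfold set_reg; cbn [Nat.eqb]; f_equal; lia|].
    split; [unfold slot_expr; cbn [cost]; lia|]. eexists. split; [exact HS2|]. split.
    + intros q Hq. destruct (Nat.eq_dec q ((a + x) / Ed)) as [->|Hnq].
      * rewrite bupd_eq. do 2 eexists. split; [reflexivity|].
        split; [rewrite length_set_nth; lia|].
        intros y Hy Hyx. rewrite nth_error_set_nth by lia.
        destruct (Nat.eqb_spec y ((a + x) mod Ed)) as [->|];
          [do 2 f_equal; lia|apply Cd; lia].
      * rewrite bupd_neq by lia. destruct (K1 q Hq) as (b & c & E & L & C).
        exists b, c. split; [easy|]. split; [easy|]. intros y Hy Hyx.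
        apply C; [easy|]. destruct (Nat.eq_dec (q * Ed + y) (a + x)); [|lia].
        destruct Hnq. apply Nat.div_unique with y; lia.
    + intros j q Hn. rewrite bupd_neq; [auto|].
      destruct (Nat.eq_dec j jd) as [->|]; [|tauto]. right. intros ->. tauto.
  - intros t rho1 h1 (Q48 & Ht & G' & HS' & K1 & K2) Hf. split.
    + replace (Int 0) with (@Int A (bool_word (len <? len)))
        by (now rewrite Nat.ltb_irrefl). ev.
    + split; [unfold slot_expr; cbn [cost]; nia|]. exists G'. split; [exact HS'|]. split; [|auto].
      intros q Hq. destruct (K1 q Hq) as (b & c & E & L & C).
      exists b, c. split; [easy|]. split; [easy|]. intros y Hy. apply C; [easy|].
      destruct Hq. nia.
Qed.

Lemma free_source_spec rho h G s :
  stored r D h p m hi G s ->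
  transfer_registers rho -> rho 46 = Int Es -> rho 48 = Int 0 ->
  (forall q, in_source js q -> exists b c, G js q = Some (b, c) /\ length c = Es) ->
  wp w M free_source rho h (fun t rho' h' => t <= 25 * len + 4 /\
    exists G', stored r D h' p m hi G' (s - len) /\
      (forall j q, in_source j q -> G' j q = None) /\
      (forall j q, ~ in_source j q -> G' j q = G j q)).
Proof.
  intros HS [R40 R41 R42 R43 R44 R45] R46 R48 Hsrc.
  pose proof (size_pos r m js) as Hs. pose proof (width_pos r m).
  pose proof (record_lt Hjs).
  apply wp_while with (n := ns) (I := fun x t rho1 h1 =>
    rho1 48 = Int (x * Es) /\ t <= x * 25 /\
    exists G', stored r D h1 p m hi G' (s - x * Es) /\
      (forall q, qs <= q < qs + x -> G' js q = None) /\
      (forall j q, ~ (j = js /\ qs <= q < qs + x) -> G' j q = G j q)).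
  - split; [exact R48|]. split; [lia|]. exists G. split; [now rewrite Nat.sub_0_r|].
    split; [lia|auto].
  - intros x t rho1 h1 Hx (Q48 & Ht & G' & HS' & K1 & K2) Hf.
    assert (Hxl : S x * Es <= len) by (rewrite Hls; apply Nat.mul_le_mono_r; lia).
    rewrite Nat.mul_succ_l in Hxl.
    assert (Hq : (a + x * Es) / Es = qs + x)
      by (rewrite Has, <- Nat.mul_add_distr_r; apply Nat.div_mul; lia).
    destruct (Hsrc (qs + x)) as (b & c & E & L); [split; lia|].
    rewrite <- (K2 js) in E by lia.
    pose proof (load_slot (stored_index HS') _ _ E) as Lb.
    unfold slot in Lb. rewrite <- Hq in Lb.
    destruct (free_block HS' _ _ E) as (_ & h2 & E2 & HS2).
    pose proof (slot_mod_lt ((a + x * Es) / Es) Hjs).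
    eexists. split; [ev|]. less_tac Hlt; [|lia]. split; [lia|].
    apply wp_seq. eapply wp_free; [unfold slot_expr; ev|eassumption|].
    eapply wp_assign; [ev|]. split; [unfold set_reg; cbn [Nat.eqb]; f_equal; lia|].
    split; [unfold slot_expr; cbn [cost]; lia|]. eexists. split; [|split].
    + replace (s - S x * Es) with (s - x * Es - length c) by lia. exact HS2.
    + intros q Hqq. destruct (Nat.eq_dec q (qs + x)) as [->|].
      * apply bupd_eq.
      * rewrite bupd_neq by lia. apply K1. lia.
    + intros j q Hn. rewrite bupd_neq by lia. apply K2. lia.
  - intros t rho1 h1 (Q48 & Ht & G' & HS' & K1 & K2) Hf. split.
    + rewrite <- Hls in Q48.
      replace (Int 0) with (@Int A (bool_word (len <? len)))
        by (now rewrite Nat.ltb_irrefl). ev.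
    + split; [unfold slot_expr; cbn [cost]; nia|]. exists G'. rewrite Hls. split; [exact HS'|].
      split; [intros j q [-> Hq]; auto|intros j q Hn; apply K2; exact Hn].
Qed.

(** The three loops cost 25, 50 and 25 per item; as [len] is positive, another 50 per item absorb
    the constant overheads. *)
Lemma transfer_spec rho h G s :
  stored r D h p m hi G s -> s + len <= M -> transfer_registers rho ->
  (forall q, in_source js q -> exists b c, G js q = Some (b, c) /\ holds r m g js q c) ->
  (forall q b c, G jd q = Some (b, c) -> q0 <= q < q0 + W /\ ~ in_target jd q) ->
  wp w M transfer rho h (fun t rho' h' => t <= 150 * len /\
    exists G', stored r D h' p m hi G' s /\
      (forall j q, in_source j q -> G' j q = None) /\
      (forall q, in_target jd q ->
         exists b c, G' jd q = Some (b, c) /\ holds r m g jd q c) /\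
      (forall j q, ~ in_source j q -> ~ in_target j q -> G' j q = G j q)).
Proof.
  intros HS HM HR Hsrc Hdst.
  pose proof (load_size (stored_index HS) Hjs) as Ls.
  pose proof (load_size (stored_index HS) Hjd) as Ld.
  pose proof (record_lt Hjs). pose proof (record_lt Hjd).
  pose proof HR as [R40 R41 R42 R43 R44 R45].
  step_assign. step_assign. step_assign.
  eapply wp_seq_spec.
  { apply allocate_target_spec; [eassumption|lia| | | |exact Hdst]; [split|..]; reg. }
  intros t1 rho1 h1 (Ht1 & G1 & HS1 & T1 & F1) Hf1.
  step_assign. eapply wp_seq_spec.
  { eapply copy_source_spec; [eassumption| | | | | |exact T1]; [split; reg|reg..|].
    intros q Hq. rewrite F1 by (unfold in_source, in_target in *; lia). auto. }
  intros t2 rho2 h2 (Ht2 & G2 & HS2 & T2 & F2) Hf2.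
  step_assign. eapply wp_conseq.
  { eapply free_source_spec; [eassumption| | | |]; [split; reg|reg..|].
    intros q Hq. rewrite F2, F1 by (unfold in_source, in_target in *; lia).
    destruct (Hsrc q Hq) as (b & c & ? & [? _]). eauto. }
  intros t3 rho3 h3 (Ht3 & G3 & HS3 & T3 & F3) _.
  split; [unfold slot_expr; cbn [cost]; lia|]. exists G3.
  replace (s + len - len) with s in HS3 by lia. split; [easy|]. split; [easy|].
  split.
  - intros q Hq. rewrite F3 by (unfold in_source, in_target in *; lia). auto.
  - intros j q K1 K2. now rewrite F3, F2, F1.
Qed.

End Transfer.

(** * Growing and shrinking *)

(** Registers: 20 index block, 21 exponent, 22 bits per level, 23 width, 24
    number of items, 26 and 28 records of two adjacent levels, 27 loop counter,
    29 block size and 30 content of record 28. *)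

Definition set_parameters (r : nat) : cmd :=
 (21 ::= $20 @ Lit 0;;
  22 ::= $21 / Lit r + Lit 1;;
  23 ::= Lit 4 << $22;;
  24 ::= $20 @ Lit 1;;
  27 ::= $21 / $22;;
  40 ::= $20;;
  45 ::= $23)%code.

(** The quotient test says that at least three block sizes of items follow the blocks of this
    level. *)
Definition combine : cmd :=
 (If ($30 + Lit 2 < $24 / $29)
   (41 ::= $30 * $29;;
    42 ::= $29;;
    43 ::= $26;;
    44 ::= $28;;
    transfer;;
    Store $20 $28 ($30 + Lit 1))
   Skip)%code.

Definition split_block : cmd :=
 (If $30
   (If ($24 / $29 < $30 + Lit 1)
     (30 ::= $30 - Lit 1;;
      41 ::= $30 * $29;;
      42 ::= $29;;
      43 ::= $28;;
      44 ::= $26;;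
      transfer;;
      Store $20 $28 $30)
     Skip)
   Skip)%code.

Definition push (r : nat) : cmd :=
 (set_parameters r;;
  Alloc 25 (Lit 1);;
  Store $20 (Lit 1 + Lit 2 + $24 mod $23) $25;;
  Store $25 (Lit 0) $2;;
  24 ::= $24 + Lit 1;;
  Store $20 (Lit 1) $24;;
  26 ::= Lit 1;;
  While $27
   (28 ::= $26 + $23 + Lit 2;;
    29 ::= $20 @ ($28 + Lit 1);;
    30 ::= $20 @ $28;;
    combine;;
    26 ::= $28;;
    27 ::= $27 - Lit 1))%code.

Definition pop (r : nat) : cmd :=
 (set_parameters r;;
  24 ::= $24 - Lit 1;;
  Free ($20 @ (Lit 1 + Lit 2 + $24 mod $23));;
  Store $20 (Lit 1) $24;;
  28 ::= Lit 1 + $27 * ($23 + Lit 2);;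
  While $27
   (26 ::= $28 - ($23 + Lit 2);;
    29 ::= $20 @ ($28 + Lit 1);;
    30 ::= $20 @ $28;;
    split_block;;
    28 ::= $26;;
    27 ::= $27 - Lit 1))%code.

(** * Effect of a move on the set of live blocks *)

Section Moves.
Variables (A : Type) (r m : nat) (g : nat -> value A).
Notation k := (top r m).
Notation sz := (size r m).
Implicit Types (G : blocks A).

Lemma mul_lt_cancel x y s : x * s < y * s -> x < y.
Proof. nia. Qed.

Lemma mul_le_cancel x y s : 0 < s -> x * s <= y * s -> x <= y.
Proof. nia. Qed.

Lemma pred_mul x s : x <> 0 -> (x - 1) * s + s = x * s.
Proof. destruct x; lia. Qed.

(** Contents are described by positions through [g], so a change of levels only alters which blocks
    exist. Appending and removing an item are covered with an empty source or target. *)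
Lemma represents_move hi hi' G G' js qs ns jd qd nd :
  represents r m hi g G ->
  (forall j q, live r m hi' j q <->
     live r m hi j q /\ ~ in_source js qs ns j q \/ in_target jd qd nd j q) ->
  (forall j q, in_source js qs ns j q -> ~ in_target jd qd nd j q) ->
  (forall j q, in_source js qs ns j q -> G' j q = None) ->
  (forall q, in_target jd qd nd jd q ->
     exists b c, G' jd q = Some (b, c) /\ holds r m g jd q c) ->
  (forall j q, ~ in_source js qs ns j q -> ~ in_target jd qd nd j q ->
     G' j q = G j q) ->
  represents r m hi' g G'.
Proof.
  intros [HL HG] Hl Hst Hs Ht Ho.
  assert (Hds : forall j q, in_source js qs ns j q \/ ~ in_source js qs ns j q)
    by (unfold in_source; lia).
  assert (Hdt : forall j q, in_target jd qd nd j q \/ ~ in_target jd qd nd j q)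
    by (unfold in_target; lia).
  split; intros j q.
  - rewrite Hl. destruct (Hds j q) as [H|H].
    + rewrite Hs by easy. specialize (Hst j q H). tauto.
    + destruct (Hdt j q) as [H'|H'].
      * pose proof H' as [-> _]. destruct (Ht q H') as (b & c & -> & _).
        split; [tauto|discriminate].
      * rewrite Ho by easy. rewrite HL. tauto.
  - intros b c E. destruct (Hds j q) as [H|H]; [rewrite Hs in E by easy; easy|].
    destruct (Hdt j q) as [H'|H'].
    + pose proof H' as [-> _]. destruct (Ht q H') as (b' & c' & E' & Hh).
      rewrite E' in E. now injection E as <- <-.
    + rewrite Ho in E by easy. eauto.
Qed.

(** Raising [hi (S j)] does two things at once: it admits one more block at level [S j], and it
    moves the lower limit of level [j] past [R] blocks. *)
Lemma live_combine hi j R :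
  sz (S j) = R * sz j -> S j <= k ->
  (hi (S j) + 1) * sz (S j) <= hi j * sz j ->
  (S j < k -> hi (S (S j)) * sz (S (S j)) <= hi (S j) * sz (S j)) ->
  forall i q, live r m (upd hi (S j) (hi (S j) + 1)) i q <->
     live r m hi i q /\ ~ in_source j (hi (S j) * R) R i q \/
     in_target (S j) (hi (S j)) 1 i q.
Proof.
  intros HR Hj Hle Hup i q. unfold live, in_source, in_target.
  pose proof (size_pos r m j).
  destruct (Nat.eq_dec i (S j)) as [->|Hi].
  - rewrite upd_eq, upd_neq by lia. split.
    + intros (H1 & H2 & H3). destruct (Nat.eq_dec q (hi (S j))); [right; lia|left].
      split; [|lia]. split; [easy|]. split; [lia|easy].
    + intros [[(H1 & H2 & H3) _]|[_ H1]]; (split; [easy|]); (split; [lia|]).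
      * exact H3.
      * replace q with (hi (S j)) by lia. exact Hup.
  - rewrite upd_neq by easy. destruct (Nat.eq_dec i j) as [->|Hi'].
    + rewrite upd_eq. rewrite HR in *. split.
      * intros (H1 & H2 & H3). left. specialize (H3 ltac:(lia)).
        assert ((hi (S j) + 1) * R <= q) by nia. split; [|nia].
        split; [easy|]. split; [easy|]. nia.
      * intros [[(H1 & H2 & H3) H4]|]; [|lia]. split; [easy|]. split; [easy|].
        intros H5. specialize (H3 H5). assert (hi (S j) * R <= q) by nia.
        assert (hi (S j) * R + R <= q) by lia. nia.
    + rewrite upd_neq by lia. split; [intros; left; split; [easy|lia]|].
      intros [[]|]; [easy|lia].
Qed.

Lemma live_split hi j R :
  sz (S j) = R * sz j -> S j <= k -> hi (S j) <> 0 ->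
  hi (S j) * sz (S j) <= hi j * sz j ->
  (S j < k -> hi (S (S j)) * sz (S (S j)) <= (hi (S j) - 1) * sz (S j)) ->
  forall i q, live r m (upd hi (S j) (hi (S j) - 1)) i q <->
     live r m hi i q /\ ~ in_source (S j) (hi (S j) - 1) 1 i q \/
     in_target j ((hi (S j) - 1) * R) R i q.
Proof.
  intros HR Hj H0 Hle Hup i q. unfold live, in_source, in_target.
  pose proof (size_pos r m j).
  destruct (Nat.eq_dec i (S j)) as [->|Hi].
  - rewrite upd_eq, upd_neq by lia. split.
    + intros (H1 & H2 & H3). left. split; [|lia]. split; [easy|]. split; [lia|easy].
    + intros [[(H1 & H2 & H3) H4]|[H1 _]]; [|lia]. split; [easy|]. split; [lia|easy].
  - rewrite upd_neq by easy. destruct (Nat.eq_dec i j) as [->|Hi'].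
    + rewrite upd_eq. rewrite HR in *.
      destruct (hi (S j)) as [|y]; [easy|]. replace (S y - 1) with y in * by lia.
      assert (Hy : S y * R <= hi j) by nia. split.
      * intros (H1 & H2 & H3). specialize (H3 ltac:(lia)).
        assert (y * R <= q) by nia.
        destruct (Nat.lt_ge_cases q (y * R + R)); [right; lia|left].
        split; [|lia]. split; [easy|]. split; [easy|]. nia.
      * intros [[(H1 & H2 & H3) H4]|[_ H1]]; (split; [lia|]); (split; [lia|]).
        -- intros H5. specialize (H3 H5). nia.
        -- intros _. nia.
    + rewrite upd_neq by lia. split; [intros; left; split; [easy|lia]|].
      intros [[]|]; [easy|lia].
Qed.

End Moves.

Section Resizing.
Variables (A : Type) (w M r m : nat) (D : nat -> list (value A) -> Prop)
  (p : nat) (g : nat -> value A) (N : nat).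

Notation W := (width r m).
Notation k := (top r m).
Notation sz := (size r m).

Hypothesis Hr : 2 <= r.
Hypothesis Hrlim : r < lim w.
Hypothesis Hlim : index_length r m < lim w.
Hypothesis Hmlim : 2 ^ (m + 2) + 4 < lim w.

Implicit Types (rho : registers A) (h : heap A) (G : blocks A).

Record level_registers rho hi j : Prop := {
  lr_20 : rho 20 = Ptr p;
  lr_40 : rho 40 = Ptr p;
  lr_45 : rho 45 = Int W;
  lr_24 : rho 24 = Int N;
  lr_26 : rho 26 = Int (record r m j);
  lr_28 : rho 28 = Int (record r m (S j));
  lr_29 : rho 29 = Int (sz (S j));
  lr_30 : rho 30 = Int (hi (S j)) }.

(** The factor 150 is the price per item in [transfer_spec], so the drop of the potential pays for
    the transfer and only the tests remain. *)
Lemma combine_spec rho h hi G s j :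
  stored r D h p m hi G s -> s + 2 ^ (m - m / r) <= M ->
  represents r m hi g G -> balanced r m hi N 0 j -> S j <= k ->
  level_registers rho hi j ->
  wp w M combine rho h (fun t rho' h' => exists hi' G',
    stored r D h' p m hi' G' s /\ represents r m hi' g G' /\
    balanced r m hi' N 0 (S j) /\
    t + 150 * potential r m hi' N k <= 150 * potential r m hi N k + 40).
Proof.
  intros HS HM HR HB Hj [R20 R40 R45 R24 R26 R28 R29 R30].
  pose proof (bal_max HB) as HN.
  pose proof (bal_le Hr HB (j:=S j) ltac:(lia)) as HhiN.
  pose proof (size_pos r m (S j)) as Hs1. pose proof (size_pos r m j) as Hs0.
  assert (hi (S j) <= hi (S j) * sz (S j)) by nia.
  eapply wp_if; [ev|intros Hlt%less_true|intros Hle%less_false].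
  2: { apply wp_skip. exists hi, G. split; [easy|]. split; [easy|].
       split; [apply bal_no_combine; easy|]. cbn [cost]. lia. }
  destruct (bal_combine Hr HB Hj Hlt) as (HNe & Hle & HB').
  destruct (@size_ratio r m Hr j Hj) as (R & HRs & HR2).
  destruct (bal_window Hr HB (j:=S j)) as (q0 & Hq0 & Hq0W); [lia|].
  pose proof (bal_le Hr HB (j:=j) ltac:(lia)).
  assert (HW : hi (S j) + 1 < q0 + W) by (apply mul_lt_cancel with (sz (S j)); lia).
  assert (HRj : (hi (S j) + 1) * R <= hi j)
    by (apply mul_le_cancel with (sz j); [easy|rewrite HRs in Hle; lia]).
  step_assign. step_assign. step_assign. step_assign.
  eapply wp_seq_spec.
  { apply transfer_spec with (m := m) (r := r) (p := p) (D := D) (js := j)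
      (jd := S j) (qs := hi (S j) * R) (qd := hi (S j)) (ns := R) (nd := 1)
      (a := hi (S j) * sz (S j)) (len := sz (S j)) (q0 := q0) (hi := hi)
      (g := g) (G := G) (s := s);
      try lia.
    - apply Hq0. intros. apply (bal_mono HB). lia.
    - exact HS.
    - pose proof (size_le m Hr (S j)). lia.
    - split; reg.
    - intros q [_ Hq]. eapply represents_live; [eassumption|].
      split; [lia|]. split; [lia|]. rewrite HRs, Nat.mul_assoc.
      intros. apply Nat.mul_le_mono_r. lia.
    - intros q b c E. assert (HL : live r m hi (S j) q) by (apply HR; congruence).
      destruct HL as (_ & HL1 & HL2). split; [|intros [_ ?]; lia].
      split; [now apply Hq0|]. lia. }
  intros t1 rho1 h1 (Ht1 & G1 & HS1 & E1 & E2 & E3) Hf1.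
  destruct (store_hi HS1 (j:=S j) (hi (S j) + 1) Hj) as (h2 & Est & HS2).
  eapply wp_store; [ev|ev|ev|exact Est|].
  exists (upd hi (S j) (hi (S j) + 1)), G1. split; [exact HS2|]. split; [|split].
  - eapply represents_move;
      [exact HR|apply live_combine; [exact HRs|lia..|]| |exact E1|exact E2|exact E3].
    + apply (bal_mono HB).
    + unfold in_source, in_target. lia.
  - exact HB'.
  - pose proof (@potential_upd r m hi N (S j) (hi (S j) + 1) k ltac:(lia)) as HP.
    destruct (level_potential_combine (hi (S j)) (sz (S j))) as [HP1 HP2].
    rewrite <- HNe in HP1, HP2. cbn [cost]. lia.
Qed.

Lemma split_spec rho h hi G s j :
  stored r D h p m hi G s -> s + 2 ^ (m - m / r) <= M ->
  represents r m hi g G -> balanced r m hi N (S j) k -> S j <= k ->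
  level_registers rho hi j ->
  wp w M split_block rho h (fun t rho' h' => exists hi' G',
    stored r D h' p m hi' G' s /\ represents r m hi' g G' /\
    balanced r m hi' N j k /\
    t + 150 * potential r m hi' N k <= 150 * potential r m hi N k + 200).
Proof.
  intros HS HM HR HB Hj [R20 R40 R45 R24 R26 R28 R29 R30].
  pose proof (bal_max HB) as HN.
  pose proof (bal_le Hr HB (j:=S j) ltac:(lia)) as HhiN.
  pose proof (size_pos r m (S j)) as Hs1. pose proof (size_pos r m j) as Hs0.
  assert (hi (S j) <= hi (S j) * sz (S j)) by nia.
  eapply wp_if; [ev|intros Hpos|intros Hz].
  2: { apply wp_skip. exists hi, G. split; [easy|]. split; [easy|].
       split; [apply bal_no_split; [easy..|lia]|]. cbn [cost]. lia. }
  eapply wp_if; [ev|intros Hlt%less_true|intros Hle%less_false].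
  2: { apply wp_skip. exists hi, G. split; [easy|]. split; [easy|].
       split; [apply bal_no_split; [easy..|lia]|]. cbn [cost]. lia. }
  destruct (bal_split Hr HB Hj Hpos Hlt) as (HNe & HB').
  destruct (@size_ratio r m Hr j Hj) as (R & HRs & HR2).
  (* The window is taken after the split, since the new blocks of level [j] precede those that level
     already has. *)
  destruct (bal_window Hr HB' (j:=j)) as (q0 & Hq0 & Hq0W); [lia|].
  rewrite upd_eq in Hq0.
  pose proof (bal_le Hr HB (j:=j) ltac:(lia)) as HjN.
  pose proof (bal_mono HB (j:=j) ltac:(lia)) as Hmono.
  assert (Hp : (hi (S j) - 1) * sz (S j) + sz (S j) = hi (S j) * sz (S j)) by (now apply pred_mul).
  assert (HpR : (hi (S j) - 1) * R + R = hi (S j) * R) by (now apply pred_mul).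
  assert (Hup : S j < k ->
    hi (S (S j)) * sz (S (S j)) <= (hi (S j) - 1) * sz (S j)).
  { intros Hk. pose proof (bal_mono HB' (j:=S j) Hk) as Hm.
    rewrite upd_eq, upd_neq in Hm by lia. exact Hm. }
  assert (HRj : hi (S j) * R <= hi j)
    by (apply mul_le_cancel with (sz j); [easy|rewrite HRs in Hmono; lia]).
  assert (HW : hi j < q0 + W) by (apply mul_lt_cancel with (sz j); lia).
  step_assign. step_assign. step_assign. step_assign. step_assign.
  eapply wp_seq_spec.
  { apply transfer_spec with (m := m) (r := r) (p := p) (D := D) (js := S j)
      (jd := j) (qs := hi (S j) - 1) (qd := (hi (S j) - 1) * R) (ns := 1) (nd := R)
      (a := (hi (S j) - 1) * sz (S j)) (len := sz (S j)) (q0 := q0) (hi := hi)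
      (g := g) (G := G) (s := s);
      try lia.
    - apply Hq0. intros. rewrite HRs. lia.
    - exact HS.
    - pose proof (size_le m Hr (S j)). lia.
    - split; reg.
    - intros q [_ Hq]. eapply represents_live; [eassumption|].
      replace q with (hi (S j) - 1) by lia.
      split; [lia|]. split; [lia|]. exact Hup.
    - intros q b c E. assert (HL : live r m hi j q) by (apply HR; congruence).
      destruct HL as (_ & HL1 & HL2). specialize (HL2 ltac:(lia)).
      split; [split|intros [_ ?]].
      + apply Hq0. intros. lia.
      + lia.
      + rewrite HRs, Nat.mul_assoc in HL2. apply mul_le_cancel in HL2; lia. }
  intros t1 rho1 h1 (Ht1 & G1 & HS1 & E1 & E2 & E3) Hf1.
  destruct (store_hi HS1 (j:=S j) (hi (S j) - 1) Hj) as (h2 & Est & HS2).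
  eapply wp_store; [ev|ev|ev|exact Est|].
  exists (upd hi (S j) (hi (S j) - 1)), G1. split; [exact HS2|]. split; [|split].
  - eapply represents_move;
      [exact HR|apply live_split; [exact HRs|lia..|]| |exact E1|exact E2|exact E3].
    + exact Hup.
    + unfold in_source, in_target. lia.
  - exact HB'.
  - pose proof (@potential_upd r m hi N (S j) (hi (S j) - 1) k ltac:(lia)) as HP.
    destruct (@level_potential_split _ _ _ Hpos HNe) as [HP1 HP2].
    cbn [cost]. lia.
Qed.

End Resizing.

(** * Appending and removing the last item, without rebuilding *)

Section PushPop.
Variables (A : Type) (w M r m : nat) (D : nat -> list (value A) -> Prop)
  (p : nat) (g : nat -> value A) (N : nat).

Notation W := (width r m).
Notation k := (top r m).
Notation sz := (size r m).

Hypothesis Hr : 2 <= r.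
Hypothesis Hrlim : r < lim w.
Hypothesis Hlim : index_length r m < lim w.
Hypothesis Hmlim : 2 ^ (m + 2) + 4 < lim w.

Implicit Types (rho : registers A) (h : heap A) (G : blocks A).

Lemma exponent_lt : m < lim w.
Proof.
  pose proof (pow2_gt m).
  assert (2 ^ m <= 2 ^ (m + 2)) by (apply Nat.pow_le_mono_r; lia). lia.
Qed.

Lemma set_parameters_spec rho h hi G s :
  stored r D h p m hi G s -> rho 20 = Ptr p ->
  wp w M (set_parameters r) rho h (fun t rho' h' => t <= 30 /\ h' = h /\
    rho' 21 = Int m /\ rho' 23 = Int W /\ rho' 24 = Int (hi 0) /\
    rho' 27 = Int k /\ rho' 40 = Ptr p /\ rho' 45 = Int W).
Proof.
  intros HS R20. pose proof (load_exponent (stored_index HS)) as L0.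
  pose proof (load_hi (stored_index HS) (j:=0) ltac:(lia)) as L1.
  change (record r m 0) with 1 in L1.
  pose proof exponent_lt. pose proof (@record_le r m 0 ltac:(lia)) as HW.
  pose proof (div_r_le m Hr).
  assert (EW : 4 * 2 ^ (m / r + 1) = W) by (unfold width, bits; do 2 f_equal; lia).
  assert (Hm : 2 ^ m <= 2 ^ (m + 2)) by (apply Nat.pow_le_mono_r; lia).
  pose proof (pow2_gt m).
  do 6 step_assign. eapply wp_assign; [ev|].
  rewrite EW. replace (m / r + 1) with (bits r m) by (unfold bits; lia).
  split; [cbn; lia|]. repeat split; reg.
Qed.

Lemma push_spec rho h hi G s :
  stored r D h p m hi G s -> s + 1 + 2 ^ (m - m / r) <= M ->
  represents r m hi g G -> balanced r m hi N 0 k -> N < 2 ^ (m + 2) ->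
  rho 20 = Ptr p -> rho 2 = g N ->
  wp w M (push r) rho h (fun t rho' h' => exists hi' G',
    stored r D h' p m hi' G' (s + 1) /\ represents r m hi' g G' /\
    balanced r m hi' (N + 1) 0 k /\
    t + 150 * potential r m hi' (N + 1) k <=
      150 * potential r m hi N k + 250 * (k + 1) /\
    rho' 21 = Int m /\ rho' 24 = Int (N + 1)).
Proof.
  intros HS HM HR HB HN R20 R2.
  pose proof (pow2_pos (m - m / r)) as Hpow.
  pose proof (width_pos r m) as HWpos.
  pose proof (@record_le r m 0 ltac:(lia)) as HW.
  assert (Hmod : N mod W < W) by (apply Nat.mod_upper_bound; lia).
  apply wp_seq_spec with (1 := set_parameters_spec _ HS R20).
  intros t1 rho1 h1 (Ht1 & -> & Q21 & Q23 & Q24 & Q27 & Q40 & Q45) Hf1.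
  rewrite (bal_0 HB) in Q24.
  apply wp_seq. eapply wp_alloc; [ev|rewrite (stored_space HS); lia|].
  destruct (new_block HS N 1 (j:=0)) as (h2 & E2 & HS2); [lia| |].
  { intros q b c E Hm. assert (HL : live r m hi 0 q) by (apply HR; congruence).
    destruct HL as (_ & HL1 & HL2). rewrite (bal_0 HB) in HL1.
    destruct (bal_window Hr HB (j:=0)) as (q0 & Hq0 & Hq0W); [lia|].
    rewrite size_0 in *.
    assert (q0 <= q) by (apply Hq0; lia).
    assert (q0 <= N).
    { apply Hq0. intros Hk. pose proof (bal_mono HB (j:=0) Hk) as Hm0.
      rewrite (bal_0 HB), size_0 in Hm0. lia. }
    apply mod_window with (q0 := q0) in Hm; lia. }
  apply wp_seq. eapply wp_store; [ev|ev|ev|exact E2|].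
  destruct (store_block HS2 (x := 0) 0 N (g N) (bupd_eq _ _ _ _))
    as (h3 & E3 & HS3); [cbn; lia|].
  apply wp_seq. eapply wp_store; [ev|ev|ev|exact E3|].
  step_assign.
  destruct (store_hi HS3 (j:=0) (N + 1)) as (h4 & E4 & HS4); [lia|].
  apply wp_seq. eapply wp_store; [ev|ev|ev|exact E4|].
  step_assign.
  match type of HS4 with stored _ _ _ _ _ _ ?G _ => set (G4 := G) in * end.
  assert (HR4 : represents r m (upd hi 0 (N + 1)) g G4).
  (* Appending is a move with an empty source and the block of the new item as target. *)
  { eapply represents_move with (js := 0) (qs := 0) (ns := 0) (jd := 0) (qd := N)
      (nd := 1); [exact HR|..].
    - intros j q. unfold live, in_source, in_target.
      rewrite (upd_neq _ _ (i:=S j)) by lia.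
      destruct (Nat.eq_dec j 0) as [->|Hj].
      + rewrite upd_eq, (bal_0 HB). split.
        * intros (H1 & H2 & H3). destruct (Nat.eq_dec q N); [right; lia|left].
          repeat split; try easy; lia.
        * intros [[(H1 & H2 & H3) _]|[_ Hq]]; (split; [lia|]); (split; [lia|easy || idtac]).
          intros Hk. replace q with N by lia.
          pose proof (bal_mono HB (j:=0) Hk) as Hm0. now rewrite (bal_0 HB) in Hm0.
      + rewrite upd_neq by easy. split; [intros; left; split; [easy|lia]|].
        intros [[]|]; [easy|lia].
    - unfold in_source, in_target. lia.
    - unfold in_source. lia.
    - intros q [_ Hq]. replace q with N by lia. unfold G4. rewrite bupd_eq.
      do 2 eexists. split; [reflexivity|]. split; [reflexivity|].
      intros x Hx. rewrite size_0 in *. replace x with 0 by lia. cbn.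
      do 2 f_equal. lia.
    - intros j q _ Hn. unfold G4, in_target in *. rewrite !bupd_neq by lia. easy. }
  clearbody G4. clear HS2 HS3 E2 E3 E4.
  pose proof (bal_grow Hr HB HN) as HB4.
  set (hi4 := upd hi 0 (N + 1)) in *.
  assert (HP4 : potential r m hi4 (N + 1) k <= potential r m hi N k + k).
  (* The potential starts at level 1, so changing [hi 0] affects it only through [N]. *)
  { rewrite (@potential_ext r m hi4 hi) by (intros; apply upd_neq; lia).
    apply potential_succ. }
  clearbody hi4.
  apply wp_while with (n := k) (I := fun x t rho5 h5 =>
    rho5 27 = Int (k - x) /\ rho5 26 = Int (record r m x) /\
    exists hi5 G5, stored r D h5 p m hi5 G5 (s + 1) /\
      represents r m hi5 g G5 /\ balanced r m hi5 (N + 1) 0 x /\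
      t + 150 * potential r m hi5 (N + 1) k <=
        150 * potential r m hi4 (N + 1) k + 100 * x).
  - split; [rewrite Nat.sub_0_r; reg|]. split; [reg|].
    exists hi4, G4. repeat (split; [easy|]). lia.
  - intros x t5 rho5 h5 Hx (P27 & P26 & hi5 & G5 & HS5 & HR5 & HB5 & HP5) Hf5.
    pose proof exponent_lt. pose proof (top_le_exponent r m).
    pose proof (record_S r m x) as HrS.
    pose proof (@record_le r m (S x) Hx).
    pose proof (load_hi (stored_index HS5) Hx) as Lhi.
    pose proof (load_size (stored_index HS5) Hx) as Lsz.
    rewrite HrS in Lhi, Lsz.
    eexists. split; [ev|]. split; [lia|].
    do 3 step_assign. eapply wp_seq_spec.
    { apply combine_spec with (D := D) (p := p) (g := g) (N := N + 1) (m := m) (r := r)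
        (hi := hi5) (G := G5) (s := s + 1) (j := x); try easy.
      rewrite <- HrS. split; reg. }
    intros t6 rho6 h6 (hi6 & G6 & HS6 & HR6 & HB6 & HP6) Hf6.
    step_assign. eapply wp_assign; [ev|].
    split; [unfold set_reg; cbn [Nat.eqb]; f_equal; lia|].
    split; [rewrite HrS; reg|].
    exists hi6, G6. split; [easy|]. split; [easy|]. split; [easy|]. cbn [cost]. lia.
  - intros t5 rho5 h5 (P27 & P26 & hi5 & G5 & HS5 & HR5 & HB5 & HP5) Hf5.
    rewrite Nat.sub_diag in P27.
    split; [ev|]. exists hi5, G5. split; [easy|]. split; [easy|]. split; [easy|].
    split; [cbn [cost]; lia|]. split; reg.
Qed.

Lemma pop_spec rho h hi G s :
  stored r D h p m hi G s -> s + 2 ^ (m - m / r) <= M ->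
  represents r m hi g G -> balanced r m hi (N + 1) 0 k ->
  rho 20 = Ptr p ->
  wp w M (pop r) rho h (fun t rho' h' => exists hi' G',
    stored r D h' p m hi' G' (s - 1) /\ represents r m hi' g G' /\
    balanced r m hi' N 0 k /\
    t + 150 * potential r m hi' N k <=
      150 * potential r m hi (N + 1) k + 450 * (k + 1) /\
    rho' 21 = Int m /\ rho' 24 = Int N).
Proof.
  intros HS HM HR HB R20.
  pose proof (width_pos r m) as HWpos.
  pose proof (@record_le r m 0 ltac:(lia)) as HW.
  assert (Hmod : N mod W < W) by (apply Nat.mod_upper_bound; lia).
  pose proof (bal_max HB) as HN.
  apply wp_seq_spec with (1 := set_parameters_spec _ HS R20).
  intros t1 rho1 h1 (Ht1 & -> & Q21 & Q23 & Q24 & Q27 & Q40 & Q45) Hf1.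
  rewrite (bal_0 HB) in Q24.
  step_assign.
  assert (Hl0 : 0 < k -> hi 1 * sz 1 <= N * sz 0).
  { intros Hk. rewrite size_0. pose proof (size_pos r m 1).
    destruct (bal_low HB (j:=1)) as [->|[_ Hb]]; [lia|lia|]. specialize (Hb Nat.lt_0_1). lia. }
  destruct (represents_live (j:=0) (q:=N) HR) as (b & c & E & [Lc _]).
  { split; [lia|]. split; [rewrite (bal_0 HB); lia|exact Hl0]. }
  rewrite size_0 in Lc.
  pose proof (load_slot (stored_index HS) _ _ E) as Ls.
  change (slot r m 0 N) with (1 + 2 + N mod W) in Ls.
  destruct (free_block HS _ _ E) as (Hs1 & h2 & E2 & HS2).
  rewrite Lc in HS2.
  replace (N + 1 - 1) with N by lia.
  apply wp_seq. eapply wp_free; [ev|exact E2|].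
  destruct (store_hi HS2 (j:=0) N) as (h4 & E4 & HS4); [lia|].
  apply wp_seq. eapply wp_store; [ev|ev|ev|exact E4|].
  pose proof (@record_le r m k (le_n k)) as HrK.
  assert (HrK' : k * (W + 2) + 1 = record r m k) by (unfold record; lia).
  step_assign. replace (1 + k * (W + 2)) with (record r m k) by lia.
  match type of HS4 with stored _ _ _ _ _ _ ?G _ => set (G4 := G) in * end.
  assert (HR4 : represents r m (upd hi 0 N) g G4).
  (* Removing the last item is a move with an empty target. *)
  { eapply represents_move with (js := 0) (qs := N) (ns := 1) (jd := 0) (qd := 0)
      (nd := 0); [exact HR|..].
    - intros j q. unfold live, in_source, in_target.
      rewrite (upd_neq _ _ (i:=S j)) by lia.
      destruct (Nat.eq_dec j 0) as [->|Hj].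
      + rewrite upd_eq, (bal_0 HB). split.
        * intros (H1 & H2 & H3). left. split; [|lia]. split; [lia|]. split; [lia|easy].
        * intros [[(H1 & H2 & H3) H4]|]; [|lia]. split; [lia|]. split; [lia|easy].
      + rewrite upd_neq by easy. split; [intros; left; split; [easy|lia]|].
        intros [[]|]; [easy|lia].
    - unfold in_source, in_target. lia.
    - intros j q [-> Hq]. replace q with N by lia. apply bupd_eq.
    - unfold in_target. lia.
    - intros j q Hn _. unfold G4, in_source in *. rewrite bupd_neq by lia. easy. }
  clearbody G4. clear HS2 E2 E4.
  assert (HB4 : balanced r m (upd hi 0 N) N k k) by now apply bal_shrink.
  set (hi4 := upd hi 0 N) in *.
  assert (HP4 : potential r m hi4 N k <= potential r m hi (N + 1) k + k).
  { rewrite (@potential_ext r m hi4 hi) by (intros; apply upd_neq; lia).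
    apply potential_pred. }
  clearbody hi4.
  apply wp_while with (n := k) (I := fun x t rho5 h5 =>
    rho5 27 = Int (k - x) /\ rho5 28 = Int (record r m (k - x)) /\
    exists hi5 G5, stored r D h5 p m hi5 G5 (s - 1) /\
      represents r m hi5 g G5 /\ balanced r m hi5 N (k - x) k /\
      t + 150 * potential r m hi5 N k <=
        150 * potential r m hi4 N k + 300 * x).
  - rewrite Nat.sub_0_r. split; [reg|]. split; [reg|].
    exists hi4, G4. repeat (split; [easy|]). lia.
  - intros x t5 rho5 h5 Hx (P27 & P28 & hi5 & G5 & HS5 & HR5 & HB5 & HP5) Hf5.
    pose proof exponent_lt. pose proof (top_le_exponent r m).
    destruct (k - x) as [|y] eqn:Hy; [lia|]. replace (k - S x) with y by lia.
    assert (Hyk : S y <= k) by lia.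
    pose proof (record_S r m y) as HrS.
    pose proof (@record_le r m (S y) Hyk).
    pose proof (load_hi (stored_index HS5) Hyk) as Lhi.
    pose proof (load_size (stored_index HS5) Hyk) as Lsz.
    eexists. split; [ev|]. split; [lia|].
    step_assign. replace (record r m (S y) - (W + 2)) with (record r m y) by lia.
    do 2 step_assign. eapply wp_seq_spec.
    { apply split_spec with (D := D) (p := p) (g := g) (N := N) (m := m) (r := r)
        (hi := hi5) (G := G5) (s := s - 1) (j := y); try easy; [lia|].
      split; reg. }
    intros t6 rho6 h6 (hi6 & G6 & HS6 & HR6 & HB6 & HP6) Hf6.
    step_assign. eapply wp_assign; [ev|].
    split; [unfold set_reg; cbn [Nat.eqb]; f_equal; lia|].
    split; [reg|].
    exists hi6, G6. split; [easy|]. split; [easy|]. split; [easy|]. cbn [cost]. lia.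
  - intros t5 rho5 h5 (P27 & P28 & hi5 & G5 & HS5 & HR5 & HB5 & HP5) Hf5.
    rewrite Nat.sub_diag in *.
    split; [ev|]. exists hi5, G5. split; [easy|]. split; [easy|]. split; [easy|].
    split; [cbn [cost]; lia|]. split; reg.
Qed.

End PushPop.

(** * Finding an item *)

(** Registers: 1 position, 10 index block, 11 exponent, 12 bits per level, 13
    width, 15 record of the level; 16 to 18 receive the block size, the block
    and the offset. *)

Definition level_has_item : expr :=
  ($1 / ($10 @ ($15 + Lit 1)) < $10 @ $15)%code.

Definition find_level : cmd :=
 (If level_has_item
   Skip
   (15 ::= $15 - ($13 + Lit 2);;
    If level_has_item
      Skip
      (15 ::= $15 - ($13 + Lit 2))))%code.

Definition locate (r : nat) : cmd :=
 (11 ::= $10 @ Lit 0;;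
  12 ::= $11 / Lit r + Lit 1;;
  13 ::= Lit 4 << $12;;
  14 ::= Unop Msb ($10 @ Lit 1 - $1);;
  If ($14 + $12 < $11 + Lit 1) (15 ::= $14 / $12) (15 ::= $11 / $12);;
  15 ::= Lit 1 + $15 * ($13 + Lit 2);;
  find_level;;
  16 ::= $10 @ ($15 + Lit 1);;
  17 ::= $10 @ slot_expr $15 $13 $16 $1;;
  18 ::= $1 mod $16)%code.

Section Locate.
Variables (A : Type) (w M r m : nat) (p : nat) (N i : nat) (hi : nat -> nat)
  (G : blocks A).

Notation W := (width r m).
Notation k := (top r m).
Notation sz := (size r m).

Hypothesis Hr : 2 <= r.
Hypothesis Hrlim : r < lim w.
Hypothesis Hlim : index_length r m < lim w.
Hypothesis Hmlim : 2 ^ (m + 2) + 4 < lim w.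
Hypothesis HB : balanced r m hi N 0 k.
Hypothesis Hi : i < N.

Implicit Types (rho : registers A) (h : heap A).

Lemma find_level_spec rho h :
  index_at r h p m hi G ->
  rho 1 = Int i -> rho 10 = Ptr p -> rho 13 = Int W ->
  rho 15 = Int (record r m (guess r m N i)) ->
  wp w M find_level rho h (fun t rho' h' => t <= 40 /\ h' = h /\
    exists j, j <= k /\ live r m hi j (i / sz j) /\ rho' 15 = Int (record r m j)).
Proof.
  intros HI R1 R10 R13 R15. pose proof (guess_le m Hr N i) as Hg.
  pose proof (fun j => @guess_upper r m Hr hi N i j HB Hi) as Hup.
  pose proof (guess_lower Hr HB Hi) as Hlow.
  set (j := guess r m N i) in *. clearbody j.
  pose proof (load_hi HI Hg) as Lhi. pose proof (load_size HI Hg) as Lsz.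
  pose proof (size_pos r m j). pose proof (record_le r m Hg).
  pose proof (width_pos r m).
  unfold find_level, level_has_item.
  eapply wp_if; [ev|intros Hlt%less_true|intros Hle%less_false].
  { apply wp_skip. split; [cbn; lia|]. split; [easy|]. exists j.
    split; [easy|]. split; [|exact R15]. apply live_div; try easy.
    - apply lt_div in Hlt; [|easy]. lia.
    - intros. apply Hup. lia. }
  apply div_ge in Hle; [|easy].
  (* Level 0 cannot fail the test, as [hi 0 * size r m 0] is [N]. *)
  destruct j as [|j]; [rewrite (bal_0 HB), size_0 in Hle; lia|].
  pose proof (record_S r m j). clear Lhi Lsz.
  pose proof (load_hi HI (j:=j) ltac:(lia)) as Lhi.
  pose proof (load_size HI (j:=j) ltac:(lia)) as Lsz.
  pose proof (size_pos r m j).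
  step_assign. replace (record r m (S j) - (W + 2)) with (record r m j) by lia.
  eapply wp_if; [ev|intros Hlt%less_true|intros Hle'%less_false].
  { apply wp_skip. split; [cbn; lia|]. split; [easy|]. exists j.
    split; [lia|]. split; [|reg]. apply live_div; [easy|lia| |easy].
    apply lt_div in Hlt; [|easy]. lia. }
  apply div_ge in Hle'; [|easy].
  destruct j as [|j]; [rewrite (bal_0 HB), size_0 in Hle'; lia|].
  pose proof (record_S r m j).
  (* Two failed tests leave one candidate, which [guess_lower] confirms without a third test. *)
  eapply wp_assign; [ev|].
  split; [cbn; lia|]. split; [easy|]. exists j.
  split; [lia|]. split.
  - replace (S (S j) - 2) with j in Hlow by lia. apply live_div; [easy|lia..].
  - unfold set_reg. cbn [Nat.eqb]. f_equal. lia.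
Qed.

Lemma locate_spec rho h :
  index_at r h p m hi G -> (forall j q, live r m hi j q -> G j q <> None) ->
  rho 1 = Int i -> rho 10 = Ptr p ->
  wp w M (locate r) rho h (fun t rho' h' => t <= 130 /\ h' = h /\
    exists j b c, live r m hi j (i / sz j) /\ G j (i / sz j) = Some (b, c) /\
      rho' 16 = Int (sz j) /\ rho' 17 = Ptr b /\ rho' 18 = Int (i mod sz j)).
Proof.
  intros HI HG R1 R10.
  pose proof (load_exponent HI) as L0.
  pose proof (load_hi HI (j:=0) ltac:(lia)) as L1.
  change (record r m 0) with 1 in L1. rewrite (bal_0 HB) in L1.
  pose proof (bal_max HB) as HN.
  pose proof (exponent_lt _ Hr Hrlim Hlim Hmlim).
  pose proof (record_le r m (Nat.le_0_l k)) as HW.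
  pose proof (div_r_le m Hr). pose proof (width_pos r m).
  assert (EW : 4 * 2 ^ (m / r + 1) = W) by (unfold width, bits; do 2 f_equal; lia).
  assert (Eb : m / r + 1 = bits r m) by (unfold bits; lia).
  assert (Hb : 0 < bits r m) by (unfold bits; lia).
  assert (Hx : Nat.log2 (N - i) <= m + 2).
  { rewrite <- (Nat.log2_pow2 (m + 2)) by lia. apply Nat.log2_le_mono. lia. }
  pose proof (pow2_gt (m + 2)).
  (* Keeps the sum of [Nat.log2 (N - i)] and [bits r m], computed by the test of the guess, within a
     word. *)
  assert (H2m : 2 * (m + 2) <= 2 ^ (m + 2)).
  { pose proof (pow2_gt (m + 1)). replace (m + 2) with (S (m + 1)) by lia.
    rewrite Nat.pow_succ_r'. lia. }
  pose proof (guess_le m Hr N i) as Hg.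
  pose proof (record_le r m Hg) as Hrec.
  do 4 step_assign. rewrite EW, Eb.
  eapply wp_seq_spec with (Q1 := fun t rho' h' =>
    t <= 20 /\ h' = h /\ rho' 15 = Int (guess r m N i)).
  { unfold guess. eapply wp_if; [ev|intros Hlt%less_true|intros Hle%less_false].
    - eapply wp_assign; [ev|]. split; [cbn; lia|]. split; [easy|].
      destruct (Nat.ltb_spec (Nat.log2 (N - i) + bits r m) (m + 1)); [|lia]. reg.
    - eapply wp_assign; [ev|]. split; [cbn; lia|]. split; [easy|].
      destruct (Nat.ltb_spec (Nat.log2 (N - i) + bits r m) (m + 1)); [lia|]. reg. }
  intros t1 rho1 h1 (Ht1 & -> & Q15) Hf1.
  assert (Er : 1 + guess r m N i * (W + 2) = record r m (guess r m N i)) by reflexivity.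
  step_assign. rewrite Er.
  eapply wp_seq_spec.
  { apply find_level_spec; [exact HI|reg..]. }
  intros t2 rho2 h2 (Ht2 & -> & j & Hj & HL & Q15') Hf2.
  destruct (G j (i / sz j)) as [[b c]|] eqn:E; [|now apply HG in E].
  pose proof (load_size HI Hj) as Lsz. pose proof (load_slot HI _ _ E) as Ls.
  pose proof (slot_lt r m (i / sz j) Hj) as Hsl. unfold slot in Ls, Hsl.
  pose proof (record_le r m Hj). pose proof (size_pos r m j).
  step_assign.
  apply wp_seq. eapply wp_assign; [unfold slot_expr; ev|].
  eapply wp_assign; [ev|].
  split; [cbn; lia|]. split; [easy|]. exists j, b, c.
  split; [exact HL|]. split; [exact E|]. repeat split; reg.
Qed.

End Locate.

(** * Creating an index *)

(** Registers: 21 exponent, 24 loop counter, 26 record, 29 and 30 block size of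
    the current level and its maximum; 20 receives the index block. *)

Definition new_index (r : nat) : cmd :=
 (22 ::= $21 / Lit r + Lit 1;;
  23 ::= Lit 4 << $22;;
  24 ::= $21 / $22 + Lit 1;;
  30 ::= Lit 1 << ($21 - $21 / Lit r);;
  Alloc 20 (Lit 1 + $24 * ($23 + Lit 2));;
  Store $20 (Lit 0) $21;;
  26 ::= Lit 1;;
  29 ::= Lit 1;;
  While $24
   (Store $20 $26 (Lit 0);;
    Store $20 ($26 + Lit 1) $29;;
    26 ::= $26 + $23 + Lit 2;;
    29 ::= $29 << $22;;
    If ($30 < $29) (29 ::= $30) Skip;;
    24 ::= $24 - Lit 1))%code.

Section NewIndex.
Variables (A : Type) (w M r m : nat) (D : nat -> list (value A) -> Prop).

Notation W := (width r m).
Notation k := (top r m).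
Notation sz := (size r m).

Hypothesis Hr : 2 <= r.
Hypothesis Hrlim : r < lim w.
Hypothesis Hlim : index_length r m < lim w.
Hypothesis Hmlim : 2 ^ (m + 2) + 4 < lim w.

Implicit Types (rho : registers A) (h : heap A).

(** Here [D] describes all memory present before, so that a new array can be set up beside an old
    one. *)
Lemma new_index_spec rho h :
  (forall b c, block_at h b = Some c <-> D b c) -> rho 21 = Int m ->
  space h + index_length r m <= M ->
  wp w M (new_index r) rho h (fun t rho' h' => t <= 120 * (k + 1) /\ exists p,
    rho' 20 = Ptr p /\
    stored r D h' p m (fun _ => 0) (fun _ _ => None) (space h + index_length r m)).
Proof.
  intros HD R21 HM.
  pose proof (exponent_lt _ Hr Hrlim Hlim Hmlim).
  pose proof (record_le r m (Nat.le_0_l k)) as HW.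
  pose proof (div_r_le m Hr). pose proof (width_pos r m).
  pose proof (top_le_exponent r m). pose proof (pow2_gt m).
  assert (EW : 4 * 2 ^ (m / r + 1) = W) by (unfold width, bits; do 2 f_equal; lia).
  assert (Eb : m / r + 1 = bits r m) by (unfold bits; lia).
  assert (Hb : 0 < bits r m) by (unfold bits; lia).
  assert (Hm : 2 ^ (m + 2) = 4 * 2 ^ m)
    by (rewrite Nat.add_comm, Nat.pow_add_r; reflexivity).
  assert (HT : 2 ^ (m - m / r) <= 2 ^ m) by (apply Nat.pow_le_mono_r; lia).
  assert (HTb : 2 ^ (m - m / r) * 2 ^ bits r m = 2 * 2 ^ m)
    by (now apply pow_exponent_bits).
  assert (Ek : m / bits r m = k) by reflexivity.
  assert (El : 1 + (k + 1) * (W + 2) = index_length r m)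
    by (unfold index_length, record; lia).
  do 2 step_assign. rewrite EW, Eb. do 2 step_assign. rewrite Ek, Nat.mul_1_l.
  apply wp_seq. eapply wp_alloc; [ev|lia|]. rewrite El.
  set (p := length h).
  assert (Hp : block_at (heap_alloc h (index_length r m)) p =
    Some (repeat Undef (index_length r m)))
    by (rewrite block_at_alloc; unfold p; now rewrite Nat.eqb_refl).
  destruct (heap_store_block _ p (i := 0) (Int m) Hp) as (h2 & E2 & Hs2 & _ & Hb2).
  { rewrite repeat_length. lia. }
  apply wp_seq. eapply wp_store; [ev|ev|ev|exact E2|]. rewrite space_alloc in Hs2.
  do 2 step_assign.
  (* Invariant while the index is only partly written and [index_ok] does not hold yet. *)
  set (own := fun h' C => block_at h' p = Some C /\ length C = index_length r m /\
    nth_error C 0 = Some (Int m) /\ space h' = space h + index_length r m /\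
    forall b, b <> p -> block_at h' b = block_at h b).
  assert (Hstore : forall h' C i v, own h' C -> 0 < i < index_length r m ->
    exists h'', heap_store h' p i v = Some h'' /\ own h'' (set_nth C i v)).
  { intros h' C i v (K1 & K2 & K3 & K4 & K5) Hi.
    destruct (heap_store_block h' p (i := i) v K1) as (h'' & E & Hs & _ & Hb''); [lia|].
    exists h''. split; [exact E|]. split; [|split; [|split; [|split]]].
    - now rewrite Hb'', Nat.eqb_refl.
    - now rewrite length_set_nth by lia.
    - rewrite nth_error_set_nth by lia. destruct (Nat.eqb_spec 0 i); [lia|easy].
    - lia.
    - intros b Hn. rewrite Hb''. destruct (Nat.eqb_spec b p); [easy|auto]. }
  apply wp_while with (n := k + 1) (I := fun x t rho1 h1 =>
    rho1 24 = Int (k + 1 - x) /\ rho1 26 = Int (record r m x) /\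
    rho1 29 = Int (sz x) /\ t <= 40 * x /\
    exists C, own h1 C /\ forall j, j < x ->
      nth_error C (record r m j) = Some (Int 0) /\
      nth_error C (record r m j + 1) = Some (Int (sz j))).
  - split; [rewrite Nat.sub_0_r; reg|]. split; [reg|]. split; [reg|]. split; [lia|].
    eexists. split; [|lia]. split; [now rewrite Hb2, Nat.eqb_refl|].
    rewrite length_set_nth, repeat_length by (rewrite repeat_length; lia).
    split; [easy|]. split; [rewrite nth_error_set_nth by (rewrite repeat_length; lia); easy|].
    split; [lia|]. intros b Hn. rewrite Hb2, block_at_alloc. unfold p in *.
    destruct (Nat.eqb_spec b (length h)); easy.
  - intros x t rho1 h1 Hx (P24 & P26 & P29 & Ht & C & HC & HCj) Hf.
    assert (Hxk : x <= k) by lia. pose proof (record_le r m Hxk).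
    pose proof (record_S r m x). pose proof (size_le m Hr x) as Hszx.
    pose proof HC as (_ & HlC & _).
    eexists. split; [ev|]. split; [lia|].
    destruct (Hstore h1 C (record r m x) (Int 0) HC) as (h3 & E3 & HC3);
      [unfold record in *; lia|].
    apply wp_seq. eapply wp_store; [ev|ev|ev|exact E3|].
    destruct (Hstore h3 _ (record r m x + 1) (Int (sz x)) HC3) as (h4 & E4 & HC4);
      [unfold record in *; lia|].
    apply wp_seq. eapply wp_store; [ev|ev|ev|exact E4|].
    assert (sz x * 2 ^ bits r m <= 2 ^ (m - m / r) * 2 ^ bits r m)
      by (apply Nat.mul_le_mono_r; lia).
    step_assign. step_assign.
    eapply wp_seq_spec with (Q1 := fun t rho' h' =>
      t <= 8 /\ h' = h4 /\ rho' 29 = Int (sz (S x))).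
    { rewrite size_S by exact Hr.
      eapply wp_if; [ev|intros Hlt%less_true|intros Hle%less_false].
      - eapply wp_assign; [ev|]. split; [cbn; lia|]. split; [easy|].
        rewrite Nat.min_r by lia. reg.
      - apply wp_skip. split; [cbn; lia|]. split; [easy|].
        rewrite Nat.min_l by lia. reg. }
    intros t5 rho5 h5 (Ht5 & -> & P29') Hf5.
    eapply wp_assign; [ev|].
    split; [unfold set_reg; cbn [Nat.eqb]; f_equal; lia|].
    split; [rewrite record_S; reg|].
    split; [reg|]. split; [cbn [cost]; lia|].
    eexists. split; [exact HC4|]. intros j Hj.
    pose proof (@record_slot_inj r m j 0 x 0).
    pose proof (@record_slot_inj r m j 0 x 1).
    pose proof (@record_slot_inj r m j 1 x 0).
    pose proof (@record_slot_inj r m j 1 x 1).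
    rewrite !nth_error_set_nth by (rewrite ?length_set_nth by lia; lia).
    destruct (Nat.eq_dec j x) as [->|].
    + rewrite !Nat.eqb_refl.
      destruct (Nat.eqb_spec (record r m x) (record r m x + 1)); [lia|].
      split; reflexivity.
    + repeat match goal with |- context [?a =? ?b] =>
        destruct (Nat.eqb_spec a b); [lia|] end.
      apply HCj. lia.
  - intros t rho1 h1 (P24 & P26 & P29 & Ht & C & (K1 & K2 & K3 & K4 & K5) & HCj) Hf.
    rewrite Nat.sub_diag in P24. split; [ev|]. split; [cbn [cost]; lia|].
    exists p. split; [reg|]. exists C.
    assert (Hpn : block_at h p = None).
    { destruct (block_at h p) eqn:E; [|easy]. apply block_at_lt in E. unfold p in E. lia. }
    split; [exact K1| |easy|easy| | |exact K4].
    + split; [easy|easy|intros j Hj; apply HCj; lia|intros j Hj; apply HCj; lia|easy].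
    + intros b c Hd. apply HD in Hd. assert (b <> p) by congruence.
      rewrite K5 by easy. easy.
    + intros b c E. destruct (Nat.eq_dec b p); [tauto|]. right. right.
      apply HD. now rewrite <- K5.
Qed.

End NewIndex.

(** * Rebuilding *)

(** Registers: 0 and 10 old index block, 21 new exponent, 1 position, 3 number of
    items. *)

Definition rebuild (r : nat) : cmd :=
 (10 ::= $0;;
  new_index r;;
  3 ::= $10 @ Lit 1;;
  1 ::= Lit 0;;
  While ($1 < $3)
   (locate r;;
    2 ::= $17 @ $18;;
    If ($18 + Lit 1 == $16) (Free $17) Skip;;
    push r;;
    1 ::= $1 + Lit 1);;
  Free $10;;
  0 ::= $20)%code.

Definition nothing (A : Type) : nat -> list (value A) -> Prop := fun _ _ => False.
Arguments nothing {A}.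

Section Rebuild.
Variables (A : Type) (w M r m m' p N : nat) (g : nat -> value A) (hi : nat -> nat)
  (G : blocks A) (C : list (value A)).

Notation sz := (size r m).
Notation k' := (top r m').

Hypothesis Hr : 2 <= r.
Hypothesis Hrlim : r < lim w.
Hypothesis Hlim : index_length r m < lim w.
Hypothesis Hmlim : 2 ^ (m + 2) + 4 < lim w.
Hypothesis Hlim' : index_length r m' < lim w.
Hypothesis Hmlim' : 2 ^ (m' + 2) + 4 < lim w.
Hypothesis HN : N <= 2 ^ (m' + 1).

Implicit Types (rho : registers A) (h : heap A).

(** What is left of the old array when the items before [i] have been moved. *)
Definition remaining (i b : nat) (c : list (value A)) : Prop :=
  b = p /\ c = C \/ exists j q, G j q = Some (b, c) /\ i < (q + 1) * sz j.

(** Both arrays hold the same items only within the old block being read, which accounts for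
    [2 ^ (m - m / r)] words; the last term of the limit is for the merges made by [push] in the new
    array. *)
Lemma rebuild_spec rho h s :
  stored_with r nothing h p m hi G s C -> s = N + index_length r m ->
  represents r m hi g G -> balanced r m hi N 0 (top r m) ->
  rho 0 = Ptr p -> rho 21 = Int m' ->
  N + index_length r m + index_length r m' + 2 ^ (m - m / r) + 2 ^ (m' - m' / r) <= M ->
  wp w M (rebuild r) rho h (fun t rho' h' => exists p' hi' G',
    rho' 0 = Ptr p' /\ stored r nothing h' p' m' hi' G' (N + index_length r m') /\
    represents r m' hi' g G' /\ balanced r m' hi' N 0 k' /\
    t + 150 * potential r m' hi' N k' <= (N + 1) * (500 * (k' + 1))).
Proof.
  intros HS Hs HR HB R0 R21 HM.
  assert (HI : index_at r h p m hi G) by (exists C; split; apply HS).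
  pose proof (load_hi HI (j:=0) ltac:(lia)) as L1.
  change (record r m 0) with 1 in L1. rewrite (bal_0 HB) in L1.
  pose proof (bal_max HB) as HNm.
  pose proof (st_space HS) as Hsp.
  assert (Hpm' : 2 ^ (m' + 2) = 2 * 2 ^ (m' + 1))
    by (replace (m' + 2) with (S (m' + 1)) by lia; apply Nat.pow_succ_r').
  pose proof (pow2_pos (m' + 1)) as Hpp.
  step_assign. eapply wp_seq_spec.
  { apply new_index_spec with (m := m') (D := remaining 0); [easy|easy|easy|easy| |reg|lia].
    intros b c. split.
    - intros E. destruct (st_all HS _ E) as [->|[(j & q & E')|[]]].
      + left. split; [easy|]. rewrite (st_index HS) in E. congruence.
      + right. exists j, q. split; [easy|]. pose proof (size_pos r m j). nia.
    - intros [[-> ->]|(j & q & E & _)]; [apply (st_index HS)|apply (st_block HS _ _ E)]. }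
  intros t1 rho1 h1 (Ht1 & p' & Q20 & HS1) Hf1.
  assert (HI1 : forall x h' hi' G' s',
    stored r (remaining x) h' p' m' hi' G' s' -> index_at r h' p m hi G).
  { intros x h' hi' G' s' [C' HS']. exists C. split; [|apply HS].
    apply (st_other HS'). now left. }
  assert (L1' : heap_load h1 p 1 = Some (Int N)).
  { pose proof (load_hi (HI1 _ _ _ _ _ HS1) (j:=0) ltac:(lia)) as E.
    now rewrite (bal_0 HB) in E. }
  do 2 step_assign.
  apply wp_seq_spec with (Q1 := fun t rho2 h2 =>
    rho2 20 = Ptr p' /\ exists hi' G',
    stored r (remaining N) h2 p' m' hi' G' (N + index_length r m' + index_length r m) /\
    represents r m' hi' g G' /\ balanced r m' hi' N 0 k' /\
    t + 150 * potential r m' hi' N k' <= N * (250 * (k' + 1) + 200) + 4).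
  (* [f] counts the old items whose blocks are deallocated; it is the start of the old block
     containing the next item, and [N] at the end. *)
  { apply wp_while with (n := N) (I := fun x t rho2 h2 =>
      rho2 1 = Int x /\ exists hi' G' f,
      stored r (remaining x) h2 p' m' hi' G'
        (index_length r m' + index_length r m + x + (N - f)) /\
      represents r m' hi' g G' /\ balanced r m' hi' x 0 k' /\
      t + 150 * potential r m' hi' x k' <= x * (250 * (k' + 1) + 200) /\
      f <= x /\ (x = N -> f = N) /\
      forall j q, live r m hi j q -> q * sz j <= x < (q + 1) * sz j -> f = q * sz j).
    - split; [reg|]. exists (fun _ => 0), (fun _ _ => None), 0.
      split; [replace (index_length r m' + index_length r m + 0 + (N - 0))
        with (space h + index_length r m') by lia; exact HS1|].
      split.
      { split; [|easy]. intros j q. split; [easy|]. intros (_ & Hq & _). lia. }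
      split.
      { split; [easy|lia|easy|intros; now left|].
        intros j _. pose proof (size_pos r m' j). lia. }
      split.
      { replace (potential r m' (fun _ => 0) 0 k') with 0; [lia|].
        clear. induction k'; [easy|]. cbn [potential]. rewrite <- IHn. reflexivity. }
      split; [lia|]. split; [easy|]. intros j q _ Hq. lia.
    - intros x t rho2 h2 Hx (P1 & hi' & G' & f & HS2 & HR2 & HB2 & Ht & Hf & HfN & Hfq) Hf2.
      eexists. split; [ev|]. less_tac Hlt; [|lia]. split; [lia|].
      eapply wp_seq_spec.
      { apply locate_spec with (m := m) (N := N) (i := x) (hi := hi) (G := G) (p := p);
          try easy; [eapply HI1; exact HS2|intros j q Hl; now apply HR|reg]. }
      intros t3 rho3 h3 (Ht3 & -> & j & b & c & Hl & E & Q16 & Q17 & Q18) Hf3.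
      set (q := x / sz j) in *.
      pose proof (size_pos r m j) as Hsz.
      pose proof (size_le m Hr j) as Hsz'.
      assert (Hq : x = q * sz j + x mod sz j)
        by (rewrite Nat.mul_comm; apply Nat.div_mod_eq).
      pose proof (Nat.mod_upper_bound x (sz j) ltac:(lia)) as Hmod.
      set (o := x mod sz j) in *. clearbody q o.
      destruct HR as [HRl HRh]. destruct (HRh _ _ _ _ E) as [Lc Hc].
      assert (Hrem : remaining x b c) by (right; exists j, q; split; [easy|lia]).
      assert (Lv : heap_load h2 b o = Some (g x)).
      { replace (g x) with (g (q * sz j + o)) by now rewrite <- Hq.
        eapply stored_other; [exact HS2|exact Hrem|now apply Hc]. }
      assert (Huniq : forall j' q' b' c', G j' q' = Some (b', c') ->
        q' * sz j' <= x < (q' + 1) * sz j' -> j' = j /\ q' = q).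
      { intros j1 q1 b1 c1 E1 Hx1. eapply live_unique; [exact Hr|exact HB| |exact Hl|exact Hx1|lia].
        apply HRl. congruence. }
      assert (Hfx : f = q * sz j) by (apply Hfq; [exact Hl|lia]).
      assert (HqN : (q + 1) * sz j <= N).
      { destruct Hl as (Hj & Hql & _). pose proof (bal_le Hr HB Hj).
        assert ((q + 1) * sz j <= hi j * sz j) by (apply Nat.mul_le_mono_r; lia). lia. }
      step_assign.
      eapply wp_seq_spec with (Q1 := fun t rho4 h4 => t <= 12 /\ exists f',
        stored r (remaining (x + 1)) h4 p' m' hi' G'
          (index_length r m' + index_length r m + x + (N - f')) /\
        x < f' + sz j /\ f' <= x + 1 /\ (x + 1 = N -> f' = N) /\
        forall j q, live r m hi j q -> q * sz j <= x + 1 < (q + 1) * sz j ->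
          f' = q * sz j).
      { eapply wp_if; [ev|intros Heq%equal_true|intros Hneq%equal_false].
        - destruct (free_other HS2 _ _ Hrem) as (_ & h4 & E4 & HS4).
          eapply wp_free; [ev|exact E4|]. split; [cbn; lia|]. exists (x + 1).
          split; [|split; [lia|split; [lia|split; [easy|]]]].
          + replace (index_length r m' + index_length r m + x + (N - (x + 1))) with
              (index_length r m' + index_length r m + x + (N - f) - length c) by lia.
            eapply stored_ext; [exact HS4|]. intros b1 c1. split.
            * intros [[H1|(j1 & q1 & E1 & Hx1)] Hn]; [now left|].
              right. exists j1, q1. split; [easy|].
              (* A block that ends at [x + 1] contains [x], hence is the one just deallocated. *)
              destruct (Nat.eq_dec ((q1 + 1) * sz j1) (x + 1)) as [He|]; [|lia].
              pose proof (size_pos r m j1).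
              destruct (Huniq _ _ _ _ E1) as [-> ->]; [lia|]. congruence.
            * intros [[-> ->]|(j1 & q1 & E1 & Hx1)].
              -- split; [now left|]. intros <-. now destruct (st_block HS _ _ E).
              -- split; [right; exists j1, q1; split; [easy|lia]|]. intros ->.
                 destruct (st_inj HS _ _ _ _ E E1) as [<- <-]. lia.
          + intros j1 q1 Hl1 Hx1. destruct (G j1 q1) as [[b1 c1]|] eqn:E1;
              [|now apply HRl in Hl1].
            destruct (Nat.eq_dec (q1 * sz j1) (x + 1)) as [|Hne]; [easy|].
            destruct (Huniq _ _ _ _ E1) as [-> ->]; lia.
        - apply wp_skip. split; [cbn; lia|]. exists f.
          split; [|split; [lia|split; [lia|split; [lia|]]]].
          + eapply stored_ext; [exact HS2|]. intros b1 c1. split.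
            * intros [H1|(j1 & q1 & E1 & Hx1)]; [now left|].
              right. exists j1, q1. split; [easy|].
              destruct (Nat.eq_dec ((q1 + 1) * sz j1) (x + 1)) as [He|]; [|lia].
              pose proof (size_pos r m j1).
              destruct (Huniq _ _ _ _ E1) as [-> ->]; lia.
            * intros [H1|(j1 & q1 & E1 & Hx1)]; [now left|].
              right. exists j1, q1. split; [easy|lia].
          + intros j1 q1 Hl1 Hx1.
            destruct (live_unique Hr (i:=x + 1) HB Hl1 Hl) as [-> ->]; [easy|lia|easy]. }
      intros t4 rho4 h4 (Ht4 & f' & HS4 & Hf'1 & Hf'2 & Hf'3 & Hf'4) Hf4.
      eapply wp_seq_spec.
      { apply push_spec with (D := remaining (x + 1)) (m := m') (p := p') (g := g)
          (N := x) (hi := hi') (G := G')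
          (s := index_length r m' + index_length r m + x + (N - f')); try easy;
          [lia|lia|reg|reg]. }
      intros t5 rho5 h5 (hi5 & G5 & HS5 & HR5 & HB5 & Ht5 & _) Hf5.
      eapply wp_assign; [ev|].
      split; [unfold set_reg; cbn [Nat.eqb]; f_equal; lia|].
      exists hi5, G5, f'. replace (S x) with (x + 1) by lia.
      split; [replace (index_length r m' + index_length r m + (x + 1) + (N - f')) with
        (index_length r m' + index_length r m + x + (N - f') + 1) by lia; exact HS5|].
      split; [exact HR5|]. split; [exact HB5|]. split; [cbn [cost]; lia|].
      split; [easy|]. split; easy.
    - intros t2 rho2 h2 (P1 & hi' & G' & f & HS2 & HR2 & HB2 & Ht & Hf & HfN & Hfq) Hf2.
      split.
      + replace (Int 0) with (@Int A (bool_word (N <? N)))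
          by (now rewrite Nat.ltb_irrefl). ev.
      + split; [reg|]. exists hi', G'. rewrite HfN in HS2 by easy.
        split; [|split; [exact HR2|split; [exact HB2|cbn [cost]; lia]]].
        replace (N + index_length r m' + index_length r m) with
          (index_length r m' + index_length r m + N + (N - N)) by lia. exact HS2. }
  intros t2 rho2 h2 (P20 & hi' & G' & HS2 & HR2 & HB2 & Ht2) Hf2.
  destruct (free_other HS2 p C) as (_ & h3 & E3 & HS3); [now left|].
  apply wp_seq. eapply wp_free; [ev|exact E3|].
  eapply wp_assign; [ev|].
  exists p', hi', G'. split; [reg|]. split; [|split; [exact HR2|split; [exact HB2|]]].
  - rewrite (ix_length (st_ok HS)), Nat.add_sub in HS3.
    eapply stored_ext; [exact HS3|]. intros b c. split; [|easy].
    intros [[[-> _]|(j & q & E & Hq)] Hn]; [easy|]. destruct HR as [HRl _].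
    assert (Hl : live r m hi j q) by (apply HRl; congruence).
    destruct Hl as (Hj & Hql & _). pose proof (bal_le Hr HB Hj).
    assert ((q + 1) * sz j <= hi j * sz j) by (apply Nat.mul_le_mono_r; lia). lia.
  - cbn [cost]. lia.
Qed.

End Rebuild.

(** * The implementation *)

Definition resizable_array (r : nat) : implementation := {|
  create_code := (21 ::= Lit 0;; new_index r;; 0 ::= $20)%code;
  length_code := (1 ::= $0 @ Lit 1)%code;
  read_code := (10 ::= $0;; locate r;; 1 ::= $17 @ $18)%code;
  overwrite_code := (10 ::= $0;; locate r;; Store $17 $18 $2)%code;
  grow_code :=
   (20 ::= $0;;
    push r;;
    If ($24 == Lit 4 << $21) (21 ::= $21 + Lit 1;; rebuild r) Skip)%code;
  shrink_code :=
   (20 ::= $0;;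
    pop r;;
    If $21
      (If ($24 == Lit 1 << $21) (21 ::= $21 - Lit 1;; rebuild r) Skip)
      Skip)%code |}.

(** A function of [N] alone: [Nat.log2 N] stands in for the exponent [m] in use, which it dominates
    by [log2_ge]. *)
Definition rest_bound (r N : nat) : nat := 11 * r * 2 ^ (Nat.log2 N / r).
Definition peak_bound (r N : nat) : nat :=
  100 * 2 ^ (Nat.log2 N - Nat.log2 N / r).

Section Implementation.
Variables (A : Type) (r w : nat).
Hypothesis Hr : 2 <= r.
Notation k := (top r).
Implicit Types (l : list A) (h : heap A).

Definition item l (i : nat) : value A :=
  match nth_error l i with Some a => Item a | None => Undef end.

(** The second and third terms pay for the next rebuilding, in which all items
    are moved. *)
Definition credit (m : nat) (hi : nat -> nat) (N : nat) : nat :=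
  150 * potential r m hi N (k m) + 1000 * r * (N - 2 ^ (m + 1)) +
  2000 * r * (2 ^ (m + 1) - N).

Definition represented_with l p h m hi (G : blocks A) : Prop :=
  stored r nothing h p m hi G (length l + index_length r m) /\
  represents r m hi (item l) G /\ balanced r m hi (length l) 0 (k m) /\
  length l < 2 ^ (m + 2) /\ (m = 0 \/ 2 ^ m < length l).

(** [F] is the balance of the amortization, large enough to cover the credit. *)
Definition represented l p h (F : nat) : Prop :=
  exists m hi G, represented_with l p h m hi G /\ credit m hi (length l) <= F.

Lemma item_app l a i : i <= length l -> item (l ++ [a]) i =
  if i =? length l then Item a else item l i.
Proof.
  intros Hi. unfold item. destruct (Nat.eqb_spec i (length l)) as [->|].
  - now rewrite nth_error_app2, Nat.sub_diag.
  - now rewrite nth_error_app1 by lia.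
Qed.

Lemma represents_ext m hi g g' (G : blocks A) N :
  represents r m hi g G -> balanced r m hi N 0 (k m) ->
  (forall i, i < N -> g i = g' i) -> represents r m hi g' G.
Proof.
  intros [H1 H2] HB Hg. split; [exact H1|]. intros j q b c E.
  destruct (H2 _ _ _ _ E) as [Hl Hx]. split; [exact Hl|]. intros x Hlt.
  rewrite <- Hg; [now apply Hx|].
  assert (HL : live r m hi j q) by (apply H1; congruence).
  destruct HL as (Hj & Hq & _). pose proof (bal_le Hr HB Hj).
  assert ((q + 1) * size r m j <= hi j * size r m j) by (apply Nat.mul_le_mono_r; lia).
  lia.
Qed.

Lemma log2_ge m N : m = 0 \/ 2 ^ m < N -> m <= Nat.log2 N.
Proof.
  intros [->|H]; [lia|]. rewrite <- (Nat.log2_pow2 m) by lia.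
  apply Nat.log2_le_mono. lia.
Qed.

(** When the argument grows by one, its quotient grows by at most one. *)
Lemma sub_div_mono a b : a <= b -> a - a / r <= b - b / r.
Proof.
  intros H. induction H as [|b H IH]; [easy|].
  assert (S b / r <= S (b / r)).
  { apply Nat.Div0.div_le_upper_bound. pose proof (Nat.div_mod_eq b r).
    assert (b mod r < r) by (apply Nat.mod_upper_bound; lia). nia. }
  assert (b / r <= b) by (apply Nat.Div0.div_le_upper_bound; nia). lia.
Qed.

Lemma index_le_rest m N : m = 0 \/ 2 ^ m < N -> index_length r m <= rest_bound r N.
Proof.
  intros H%log2_ge. eapply Nat.le_trans; [now apply index_length_le_r|].
  apply Nat.mul_le_mono_l, Nat.pow_le_mono_r; [lia|].
  apply Nat.Div0.div_le_mono. lia.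
Qed.

(** In units of [2 ^ (m - m / r)], the two indexes take 22 and 44 and the two largest blocks 1 and
    2, since one more exponent at most doubles the unit; with the summand 2 this stays below 100. *)
Lemma peak_le m m' N :
  m = 0 \/ 2 ^ m < N -> m' <= m + 1 ->
  2 + index_length r m + index_length r m' + 2 ^ (m - m / r) + 2 ^ (m' - m' / r)
    <= peak_bound r N.
Proof.
  intros H%log2_ge Hm. unfold peak_bound.
  pose proof (@index_length_le r m Hr). pose proof (@index_length_le r m' Hr).
  assert (2 ^ (m - m / r) <= 2 ^ (Nat.log2 N - Nat.log2 N / r))
    by (apply Nat.pow_le_mono_r; [lia|]; apply sub_div_mono; lia).
  assert (2 ^ (m' - m' / r) <= 2 * 2 ^ (m - m / r)).
  { rewrite <- Nat.pow_succ_r'. apply Nat.pow_le_mono_r; [lia|].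
    pose proof (sub_div_mono Hm).
    assert (m / r <= (m + 1) / r) by (apply Nat.Div0.div_le_mono; lia).
    assert (m / r <= m) by (apply Nat.Div0.div_le_upper_bound; nia). lia. }
  pose proof (pow2_pos (m - m / r)). lia.
Qed.

(** Here [n] is the size for which the word-length assumption is made, which for a shrink is one
    less than [N]. In either case [2 ^ m <= n + r], and the numbers concerned are below
    [200 * (n + r)]. The bounds for [m + 1] serve the rebuilding of a grow. *)
Lemma limits m n N :
  fits 200 r w n -> N <= n + 1 -> m = 0 \/ 2 ^ m < N ->
  r < lim w /\ index_length r m < lim w /\ 2 ^ (m + 2) + 4 < lim w /\
  index_length r (m + 1) < lim w /\ 2 ^ (m + 1 + 2) + 4 < lim w.
Proof.
  unfold fits. fold (lim w). intros Hf HN Hm.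
  pose proof (@index_length_le r m Hr). pose proof (@index_length_le r (m + 1) Hr).
  assert (2 ^ (m - m / r) <= 2 ^ m) by (apply Nat.pow_le_mono_r; lia).
  assert (2 ^ (m + 1 - (m + 1) / r) <= 2 ^ (m + 1)) by (apply Nat.pow_le_mono_r; lia).
  rewrite !Nat.pow_add_r in *. cbn [Nat.pow] in *.
  assert (2 ^ m <= n + r).
  { destruct Hm as [->|]; cbn [Nat.pow]; lia. }
  lia.
Qed.

Lemma create_spec rho :
  fits 200 r w 0 ->
  wp w (rest_bound r 0) (create_code (resizable_array r)) rho []
    (fun t rho' h' => exists p F, rho' 0 = Ptr p /\
       represented [] p h' F /\ t + F <= 5000 * r).
Proof.
  intros Hf. destruct (@limits 0 0 0 Hf) as (L1 & L2 & L3 & _ & _); [lia..|].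
  cbn [create_code resizable_array].
  step_assign. eapply wp_seq_spec.
  { apply new_index_spec with (m := 0) (D := nothing); try easy.
    - intros b c. split; [|easy]. unfold block_at. now destruct b.
    - apply index_le_rest. lia. }
  intros t1 rho1 h1 (Ht & p & Q20 & HS) _.
  eapply wp_assign; [ev|].
  assert (Htop : k 0 = 0) by (unfold top; apply Nat.Div0.div_0_l).
  (* The empty array with [m = 0] lacks 2 items to [2 ^ (m + 1)], at [2000 * r] each. *)
  exists p, (4000 * r). split; [reg|]. split.
  - exists 0, (fun _ => 0), (fun _ _ => None). split.
    + split; [exact HS|]. split; [|split; [|split; [cbn; lia|lia]]].
      * split; [|easy]. intros j q. split; [easy|]. intros (_ & ? & _). lia.
      * rewrite Htop. split; [easy|apply Nat.le_0_l|intros; lia..].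
    + unfold credit. rewrite Htop. cbn [potential length]. cbn [Nat.add Nat.pow]. lia.
  - rewrite Htop in Ht. cbn [cost]. lia.
Qed.

Lemma length_spec l p h m hi G rho :
  1 < lim w -> represented_with l p h m hi G -> rho 0 = Ptr p ->
  wp w (space h) (length_code (resizable_array r)) rho h
    (fun t rho' h' => t <= 200 /\ h' = h /\ rho' 0 = Ptr p /\
       rho' 1 = Int (length l)).
Proof.
  intros Hw (HS & _ & HB & _) R0. cbn [length_code resizable_array].
  pose proof (load_hi (stored_index HS) (j:=0) ltac:(lia)) as L.
  rewrite (bal_0 HB) in L. change (record r m 0) with 1 in L.
  eapply wp_assign; [ev|]. split; [cbn; lia|]. split; [easy|]. split; reg.
Qed.

Lemma read_spec l p h m hi G rho i :
  fits 200 r w (length l) -> i < length l ->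
  represented_with l p h m hi G -> rho 0 = Ptr p -> rho 1 = Int i ->
  wp w (space h) (read_code (resizable_array r)) rho h
    (fun t rho' h' => t <= 200 /\ h' = h /\ rho' 0 = Ptr p /\
       rho' 1 = item l i).
Proof.
  intros Hf Hi (HS & HR & HB & HN & Hm) R0 R1. cbn [read_code resizable_array].
  destruct (@limits m _ (length l) Hf) as (L1 & L2 & L3 & _ & _); [lia|easy|].
  step_assign. eapply wp_seq_spec.
  { apply locate_spec with (m := m) (N := length l) (i := i) (hi := hi) (G := G) (p := p);
      try easy;
      first [exact (stored_index HS)|intros j q; apply HR|reg]. }
  intros t1 rho1 h1 (Ht1 & -> & j & b & c & Hl & E & Q16 & Q17 & Q18) Hf1.
  destruct (proj2 HR _ _ _ _ E) as [Lc Hc]. pose proof (size_pos r m j).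
  assert (Hmod : i mod size r m j < size r m j) by (apply Nat.mod_upper_bound; lia).
  pose proof (load_block HS _ _ _ E (Hc _ Hmod)) as Lv.
  rewrite (Nat.mul_comm (i / _)), <- Nat.div_mod_eq in Lv.
  eapply wp_assign; [ev|]. split; [cbn; lia|]. split; [easy|]. split; reg.
Qed.

Lemma overwrite_spec l p h m hi G rho i a F :
  fits 200 r w (length l) -> i < length l ->
  represented_with l p h m hi G -> credit m hi (length l) <= F ->
  rho 0 = Ptr p -> rho 1 = Int i -> rho 2 = Item a ->
  wp w (space h) (overwrite_code (resizable_array r)) rho h
    (fun t rho' h' => t <= 200 /\ rho' 0 = Ptr p /\
       represented (set_nth l i a) p h' F).
Proof.
  intros Hf Hi (HS & HR & HB & HN & Hm) HF R0 R1 R2.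
  cbn [overwrite_code resizable_array].
  destruct (@limits m _ (length l) Hf) as (L1 & L2 & L3 & _ & _); [lia|easy|].
  step_assign. eapply wp_seq_spec.
  { apply locate_spec with (m := m) (N := length l) (i := i) (hi := hi) (G := G) (p := p);
      try easy;
      first [exact (stored_index HS)|intros j q; apply HR|reg]. }
  intros t1 rho1 h1 (Ht1 & -> & j & b & c & Hl & E & Q16 & Q17 & Q18) Hf1.
  destruct HR as [HRl HRh].
  destruct (HRh _ _ _ _ E) as [Lc Hc]. pose proof (size_pos r m j).
  assert (Hmod : i mod size r m j < size r m j) by (apply Nat.mod_upper_bound; lia).
  pose proof (Nat.div_mod_eq i (size r m j)) as Hdiv.
  destruct (store_block HS _ _ (x := i mod size r m j) (Item a) E) as (h2 & E2 & HS2);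
    [lia|].
  eapply wp_store; [ev|ev|ev|exact E2|].
  split; [cbn; lia|]. split; [reg|].
  eexists m, hi, _. unfold represented_with. rewrite length_set_nth by easy.
  split; [|exact HF]. split; [exact HS2|]. split; [|easy]. split.
  - intros j' q'. rewrite <- HRl.
    destruct (Nat.eq_dec j' j) as [->|], (Nat.eq_dec q' (i / size r m j)) as [->|];
      [rewrite bupd_eq; now rewrite E|rewrite bupd_neq by tauto; easy..].
  - assert (Hitem : forall x, item (set_nth l i a) x = if x =? i then Item a else item l x).
    { intros x. unfold item. rewrite nth_error_set_nth by easy. now destruct (x =? i). }
    intros j' q' b' c' E'.
    destruct (Nat.eq_dec j' j) as [->|Hj];
      [destruct (Nat.eq_dec q' (i / size r m j)) as [->|Hq]|].
    + rewrite bupd_eq in E'. injection E' as <- <-.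
      split; [now rewrite length_set_nth by lia|]. intros x Hx.
      rewrite nth_error_set_nth by lia. rewrite Hitem, Hc by easy.
      destruct (Nat.eqb_spec x (i mod size r m j)), (Nat.eqb_spec (i / size r m j * size r m j + x) i);
        try easy; lia.
    + rewrite bupd_neq in E' by tauto. destruct (HRh _ _ _ _ E') as [Lc' Hc'].
      split; [easy|]. intros x Hx. rewrite Hc', Hitem by easy.
      destruct (Nat.eqb_spec (q' * size r m j + x) i); [|easy].
      destruct Hq. apply Nat.div_unique with x; lia.
    + rewrite bupd_neq in E' by tauto. destruct (HRh _ _ _ _ E') as [Lc' Hc'].
      split; [easy|]. intros x Hx. rewrite Hc', Hitem by easy.
      destruct (Nat.eqb_spec (q' * size r m j' + x) i) as [He|]; [|easy].
      assert (Hl' : live r m hi j' q') by (apply HRl; congruence).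
      destruct (live_unique Hr (i:=i) HB Hl' Hl) as [-> _]; [lia|lia|easy].
Qed.

Lemma grow_spec l p h m hi G rho a F :
  fits 200 r w (length l + 1) ->
  represented_with l p h m hi G -> credit m hi (length l) <= F ->
  rho 0 = Ptr p -> rho 2 = Item a ->
  wp w (length l + peak_bound r (length l)) (grow_code (resizable_array r)) rho h
    (fun t rho' h' => exists p' F', rho' 0 = Ptr p' /\
       represented (l ++ [a]) p' h' F' /\ t + F' <= F + 5000 * r).
Proof.
  intros Hf (HS & HR & HB & HN & Hm) HF R0 R2. cbn [grow_code resizable_array].
  set (N := length l) in *.
  destruct (@limits m _ N Hf) as (L1 & L2 & L3 & L4 & L5); [lia|easy|].
  pose proof (@peak_le m (m + 1) N Hm (Nat.le_refl _)) as Hpk.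
  pose proof (@top_lt r m Hr) as Hk. pose proof (@top_lt r (m + 1) Hr) as Hk'.
  assert (HR' : represents r m hi (item (l ++ [a])) G).
  { eapply represents_ext; [exact HR|exact HB|]. intros i Hi. fold N in Hi.
    rewrite item_app by (fold N; lia). fold N.
    destruct (Nat.eqb_spec i N); [lia|easy]. }
  assert (Hlen : length (l ++ [a]) = N + 1) by (rewrite length_app; easy).
  step_assign. eapply wp_seq_spec.
  { apply push_spec with (m := m) (D := nothing) (p := p) (g := item (l ++ [a])) (N := N)
      (hi := hi) (G := G) (s := N + index_length r m); try easy;
      first [lia|rewrite item_app by easy; fold N; rewrite Nat.eqb_refl; reg|reg]. }
  intros t1 rho1 h1 (hi1 & G1 & HS1 & HR1 & HB1 & Ht1 & Q21 & Q24) Hf1.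
  replace (N + index_length r m + 1) with (N + 1 + index_length r m) in HS1 by lia.
  pose proof (pow2_pos m) as Hp0. pose proof (pow2_add_1 m) as Hp1.
  pose proof (pow2_add_2 m) as Hp2. pose proof (pow2_add_2 (m + 1)) as Hp3.
  pose proof (pow2_add_1 (m + 1)) as Hp4. pose proof (pow2_gt (m + 2)) as Hp5.
  unfold credit in HF.
  eapply wp_if; [ev|intros Heq%equal_true|intros Hne%equal_false].
  - destruct HS1 as [C HS1]. step_assign. eapply wp_conseq.
    { apply rebuild_spec with (m := m) (m' := m + 1) (p := p) (N := N + 1)
        (g := item (l ++ [a])) (hi := hi1) (G := G1) (C := C)
        (s := N + 1 + index_length r m); try easy; first [lia|reg]. }
    intros t2 rho2 h2 (p' & hi2 & G2 & Q0 & HS2 & HR2 & HB2 & Ht2) _.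
    exists p', (150 * potential r (m + 1) hi2 (N + 1) (k (m + 1))).
    split; [exact Q0|]. split.
    + exists (m + 1), hi2, G2. unfold represented_with, credit. rewrite Hlen.
      split; [|replace (N + 1 - 2 ^ (m + 1 + 1)) with 0 by lia;
        replace (2 ^ (m + 1 + 1) - (N + 1)) with 0 by lia; lia].
      split; [exact HS2|]. split; [exact HR2|]. split; [exact HB2|]. lia.
    + replace (N - 2 ^ (m + 1)) with (2 * 2 ^ m - 1) in HF by lia.
      (* The surplus of [2 * 2 ^ m - 1] items has saved [1000 * r] each, which moves all [4 * 2 ^ m]
         items at [500 * r] each up to a constant multiple of [r]. *)
      assert (Hc : (N + 1 + 1) * (500 * (k (m + 1) + 1)) <=
        1000 * r * (2 * 2 ^ m - 1) + 2000 * r).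
      { apply Nat.le_trans with ((N + 1 + 1) * (500 * r));
          [apply Nat.mul_le_mono_l; lia|].
        replace (N + 1 + 1) with (4 * 2 ^ m + 1) by lia. nia. }
      cbn [cost]. lia.
  - apply wp_skip. exists p, (credit m hi1 (N + 1)). split; [reg|]. split.
    + exists m, hi1, G1. unfold represented_with. rewrite Hlen.
      split; [|lia]. split; [exact HS1|]. split; [exact HR1|]. split; [exact HB1|]. lia.
    + unfold credit.
      assert (1000 * r * (N + 1 - 2 ^ (m + 1)) <= 1000 * r * (N - 2 ^ (m + 1)) + 1000 * r)
        by nia.
      assert (2000 * r * (2 ^ (m + 1) - (N + 1)) <= 2000 * r * (2 ^ (m + 1) - N))
        by (apply Nat.mul_le_mono_l; lia).
      cbn [cost]. lia.
Qed.

Lemma shrink_spec l p h m hi G rho F :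
  fits 200 r w (length l - 1) -> l <> [] ->
  represented_with l p h m hi G -> credit m hi (length l) <= F ->
  rho 0 = Ptr p ->
  wp w (length l + peak_bound r (length l)) (shrink_code (resizable_array r)) rho h
    (fun t rho' h' => exists p' F', rho' 0 = Ptr p' /\
       represented (removelast l) p' h' F' /\ t + F' <= F + 5000 * r).
Proof.
  intros Hf Hl (HS & HR & HB & HN & Hm) HF R0. cbn [shrink_code resizable_array].
  destruct (exists_last Hl) as (l' & a & ->). rewrite removelast_last.
  rewrite length_app in *. cbn [length] in *. rewrite Nat.add_sub in Hf.
  set (N := length l') in *.
  destruct (@limits m _ (N + 1) Hf) as (L1 & L2 & L3 & _ & _); [lia|easy|].
  pose proof (@peak_le m (m - 1) (N + 1) Hm ltac:(lia)) as Hpk.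
  pose proof (@top_lt r m Hr) as Hk. pose proof (@top_lt r (m - 1) Hr) as Hk'.
  step_assign. eapply wp_seq_spec.
  { apply pop_spec with (m := m) (D := nothing) (p := p) (g := item (l' ++ [a])) (N := N)
      (hi := hi) (G := G) (s := N + 1 + index_length r m); try easy; first [lia|reg]. }
  intros t1 rho1 h1 (hi1 & G1 & HS1 & HR1 & HB1 & Ht1 & Q21 & Q24) Hf1.
  replace (N + 1 + index_length r m - 1) with (N + index_length r m) in HS1 by lia.
  assert (HR1' : represents r m hi1 (item l') G1).
  { eapply represents_ext; [exact HR1|exact HB1|]. intros i Hi.
    rewrite item_app by (fold N; lia). fold N.
    destruct (Nat.eqb_spec i N); [lia|easy]. }
  pose proof (pow2_pos m) as Hp0. pose proof (pow2_add_1 m) as Hp1.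
  pose proof (pow2_add_2 m) as Hp2.
  pose proof (exponent_lt _ Hr L1 L2 L3) as Hmw.
  unfold credit in HF.
  assert (Hskip : m = 0 \/ N <> 2 ^ m -> represented l' p h1 (credit m hi1 N)).
  { intros H. exists m, hi1, G1. fold N. split; [|lia].
    split; [exact HS1|]. split; [exact HR1'|]. split; [exact HB1|]. fold N. lia. }
  assert (Hcost : credit m hi1 N + t1 <= F + 2000 * r + 450 * r).
  { unfold credit.
    assert (1000 * r * (N - 2 ^ (m + 1)) <= 1000 * r * (N + 1 - 2 ^ (m + 1)))
      by (apply Nat.mul_le_mono_l; lia).
    assert (2000 * r * (2 ^ (m + 1) - N) <=
      2000 * r * (2 ^ (m + 1) - (N + 1)) + 2000 * r) by nia. lia. }
  eapply wp_if; [ev|intros Hm0|intros Hm0].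
  - eapply wp_if; [ev|intros Heq%equal_true|intros Hne%equal_false].
    + rewrite Nat.mul_1_l in Heq.
      pose proof (pow2_pos (m - 1)) as Hq0. pose proof (pow2_add_1 (m - 1)) as Hq1.
      pose proof (pow2_add_2 (m - 1)) as Hq2.
      assert (Hmm : 2 ^ (m - 1 + 1) = 2 ^ m) by (f_equal; lia).
      pose proof (@index_length_le r (m - 1) Hr) as Hil.
      assert (2 ^ (m - 1 - (m - 1) / r) <= 2 ^ (m - 1)) by (apply Nat.pow_le_mono_r; lia).
      unfold fits in Hf. fold (lim w) in Hf.
      destruct HS1 as [C HS1]. step_assign. eapply wp_conseq.
      { apply rebuild_spec with (m := m) (m' := m - 1) (p := p) (N := N)
          (g := item l') (hi := hi1) (G := G1) (C := C)
          (s := N + index_length r m); try easy; first [lia|reg]. }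
      intros t2 rho2 h2 (p' & hi2 & G2 & Q0 & HS2 & HR2 & HB2 & Ht2) _.
      exists p', (150 * potential r (m - 1) hi2 N (k (m - 1))).
      split; [exact Q0|]. split.
      * exists (m - 1), hi2, G2. unfold represented_with, credit. fold N.
        split; [|replace (N - 2 ^ (m - 1 + 1)) with 0 by lia;
          replace (2 ^ (m - 1 + 1) - N) with 0 by lia; lia].
        split; [exact HS2|]. split; [exact HR2|]. split; [exact HB2|]. lia.
      * assert (Hc : (N + 1) * (500 * (k (m - 1) + 1)) <= 500 * r * N + 500 * r).
        { apply Nat.le_trans with ((N + 1) * (500 * r));
            [apply Nat.mul_le_mono_l; lia|]. lia. }
        (* At [N = 2 ^ m] the deficit to [2 ^ (m + 1)] is [N] itself, so every item to be moved has
           credit. *)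
        assert (Hc' : 1000 * r * N <= credit m hi1 N).
        { unfold credit. replace (2 ^ (m + 1) - N) with N by lia. lia. }
        cbn [cost]. lia.
    + rewrite Nat.mul_1_l in Hne. apply wp_skip.
      exists p, (credit m hi1 N). split; [reg|]. split; [auto|]. cbn [cost]. lia.
  - apply wp_skip. exists p, (credit m hi1 N).
    split; [reg|]. split; [auto|]. cbn [cost]. lia.
Qed.

Lemma represented_pointed l p h F : represented l p h F -> pointed p h.
Proof.
  intros (m & hi & G & ([C HS] & _) & _).
  assert (Hp : allocated h p C) by (apply block_at_nth_error, (st_index HS)).
  split; [now exists C|].
  intros b c Hb%block_at_nth_error Hn. exists p, C. split; [exact Hp|].
  destruct (st_all HS _ Hb) as [|[(j & q & E)|[]]]; [easy|].
  eapply nth_error_In. apply (ix_slot (st_ok HS) _ _ E).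
Qed.

Definition peak (o : operation A) (N : nat) : nat :=
  N + (if resizes o then peak_bound r else rest_bound r) N.

Lemma represented_space l p h F :
  represented l p h F -> space h <= length l + rest_bound r (length l) /\
    space h <= length l + peak_bound r (length l).
Proof.
  intros (m & hi & G & (HS & _ & _ & _ & Hm) & _). rewrite (stored_space HS).
  pose proof (@index_le_rest m (length l) Hm).
  pose proof (@peak_le m m (length l) Hm ltac:(lia)). lia.
Qed.

Lemma operation_spec l p h F (o : operation A) :
  represented l p h F -> legal l o -> fits 200 r w (length (effect l o)) ->
  wp w (peak o (length l)) (code (resizable_array r) o) (call p o) h
    (fun t rho' h' => exists p' F', rho' 0 = Ptr p' /\ answer l o (rho' 1) /\
       represented (effect l o) p' h' F' /\
       if resizes o then t + F' <= F + 5000 * r else t <= 200 /\ F' = F).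
Proof.
  intros HR Hl Hf. destruct (represented_space HR) as [Hs1 Hs2].
  (* Length, read and overwrite never exceed the space they start with; this lifts their
     specifications to the bound between operations. *)
  assert (Hw : forall (M : nat) c rho (Q : nat -> registers A -> heap A -> Prop),
    space h <= M -> wp w (space h) c rho h Q -> wp w M c rho h Q).
  { intros M c rho Q HM H _. destruct (H (Nat.le_refl _)) as (t & m & rho' & h' & ? & ? & ?).
    exists t, m, rho', h'. split; [easy|]. split; [lia|easy]. }
  pose proof HR as (m & hi & G & HR' & HF).
  destruct o; cbn [code effect legal answer resizes peak] in *.
  - apply Hw; [exact Hs1|]. eapply wp_conseq.
    { eapply length_spec; [|exact HR'|reflexivity].
      unfold fits in Hf. fold (lim w) in Hf. lia. }
    intros t rho' h' (Ht & -> & Q0 & Q1) _. exists p, F. auto.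
  - apply Hw; [exact Hs1|]. eapply wp_conseq.
    { eapply read_spec; [exact Hf|exact Hl|exact HR'|reflexivity|reflexivity]. }
    intros t rho' h' (Ht & -> & Q0 & Q1) _. exists p, F. split; [easy|]. split; [|auto].
    unfold item in Q1. destruct (nth_error l n) as [a|] eqn:E; [eauto|].
    apply nth_error_None in E. lia.
  - rewrite length_set_nth in Hf by easy. apply Hw; [exact Hs1|]. eapply wp_conseq.
    { eapply overwrite_spec; [exact Hf|exact Hl|exact HR'|exact HF|reflexivity..]. }
    intros t rho' h' (Ht & Q0 & Q1) _. exists p, F. auto.
  - rewrite length_app in Hf. eapply wp_conseq.
    { eapply grow_spec; [exact Hf|exact HR'|exact HF|reflexivity..]. }
    intros t rho' h' (p' & F' & Q0 & Q1 & Q2) _. exists p', F'. auto.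
  - eapply wp_conseq.
    { eapply shrink_spec; [|exact Hl|exact HR'|exact HF|reflexivity..].
      destruct (exists_last Hl) as (l' & a & ->). rewrite removelast_last in Hf.
      rewrite length_app. cbn. now rewrite Nat.add_sub. }
    intros t rho' h' (p' & F' & Q0 & Q1 & Q2) _. exists p', F'. auto.
Qed.

Lemma wp_exec M c rho h (Q : nat -> registers A -> heap A -> Prop) t m rho' h' :
  wp w M c rho h Q -> space h <= M -> exec w c rho h t m rho' h' ->
  m <= M /\ Q t rho' h'.
Proof.
  intros H Hs He. destruct (H Hs) as (t1 & m1 & rho1 & h1 & He1 & Hm & HQ).
  destruct (exec_deterministic He He1) as (-> & -> & -> & ->). auto.
Qed.

(** The amortization telescopes: each resize adds [5000 * r] to the sum of elapsed time and balance,
    creation counts as one resize, and accesses change neither summand. *)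
Lemma reachable_represented l p h n T :
  reachable 200 r w (resizable_array r) l p h n T ->
  exists F, represented l p h F /\ T + F <= 5000 * r * (n + 1).
Proof.
  induction 1 as [t m rho p h Hf He Hp|l p h n T o t m rho p' h' HR IH Hl Hf He Hp].
  - destruct (wp_exec (create_spec no_registers Hf) (Nat.le_0_l _) He)
      as (_ & p' & F & Hp' & HR & HF).
    rewrite Hp in Hp'. injection Hp' as <-. exists F. split; [easy|lia].
  - destruct IH as (F & HF & HT). destruct (represented_space HF) as [Hs1 Hs2].
    assert (Hs : space h <= peak o (length l)) by (unfold peak; destruct (resizes o); easy).
    destruct (wp_exec (operation_spec o HF Hl Hf) Hs He)
      as (_ & p'' & F' & Hp' & _ & HR' & Hres).
    rewrite Hp in Hp'. injection Hp' as <-. exists F'. split; [easy|].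
    destruct (resizes o); lia.
Qed.

End Implementation.

(** * From the invariant to the required properties, and from powers of two to real powers of [N] *)

Section Correctness.
Variable r : nat.
Hypothesis Hr : 2 <= r.

Lemma resizable_array_implements : implements 200 r (resizable_array r).
Proof.
  intros A w. split.
  - intros Hf. destruct (@create_spec A r w Hr no_registers Hf)
      as (t & m & rho & h & He & _ & p & F & Hp & _); [apply Nat.le_0_l|].
    now exists t, m, rho, p, h.
  - intros l p h n T HR. destruct (reachable_represented Hr HR) as (F & HF & _).
    split; [now apply (represented_pointed HF)|]. intros o Hl Hf.
    destruct (represented_space Hr HF) as [Hs1 Hs2].
    destruct (operation_spec Hr o HF Hl Hf)
      as (t & m & rho & h' & He & _ & p' & F' & Hp & Ha & _).
    { unfold peak. destruct (resizes o); easy. }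
    exists t, m, rho, p', h'. auto.
Qed.

Lemma resizable_array_space :
  space_bounds 200 r (rest_bound r) (peak_bound r) (resizable_array r).
Proof.
  intros A w. split.
  - intros tm m rho h Hf He.
    apply (wp_exec (@create_spec A r w Hr no_registers Hf) (Nat.le_0_l _) He).
  - intros l p h n T HR. destruct (reachable_represented Hr HR) as (F & HF & _).
    destruct (represented_space Hr HF) as [Hs1 Hs2].
    split; [exact Hs1|]. intros o tm m rho h' Hl Hf He.
    assert (Hs : space h <= peak r o (length l))
      by (unfold peak; destruct (resizes o); easy).
    apply (wp_exec (operation_spec Hr o HF Hl Hf) Hs He).
Qed.

Lemma resizable_array_resize_time :
  resize_amortized_time 200 r (resizable_array r) (5000 * r).
Proof.
  intros A w l p h n T HR.
  destruct (reachable_represented Hr HR) as (F & _ & HF). lia.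
Qed.

Lemma resizable_array_access_time :
  access_worst_case_time 200 r (resizable_array r) 5000.
Proof.
  intros A w l p h n T o t m rho h' HR Hl Ho Hf He.
  destruct (reachable_represented Hr HR) as (F & HF & _).
  destruct (represented_space Hr HF) as [Hs1 Hs2].
  assert (Hf' : fits 200 r w (length (effect l o))).
  { destruct o; cbn in *; rewrite ?length_set_nth; easy. }
  assert (Hs : space h <= peak r o (length l)) by (unfold peak; now rewrite Ho).
  destruct (wp_exec (operation_spec Hr o HF Hl Hf') Hs He)
    as (_ & p' & F' & _ & _ & _ & Ht).
  rewrite Ho in Ht. lia.
Qed.

Lemma rest_bound_nondecreasing : nondecreasing (rest_bound r).
Proof.
  intros a b H. apply Nat.mul_le_mono_l, Nat.pow_le_mono_r; [lia|].
  apply Nat.Div0.div_le_mono, Nat.log2_le_mono, H.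
Qed.

Lemma peak_bound_nondecreasing : nondecreasing (peak_bound r).
Proof.
  intros a b H. apply Nat.mul_le_mono_l, Nat.pow_le_mono_r; [lia|].
  apply sub_div_mono, Nat.log2_le_mono, H. exact Hr.
Qed.

End Correctness.

(** Rests on [2 ^ Nat.log2 N <= N]; the slack [d] in the exponent absorbs the rounding of
    [Nat.log2 N / r]. *)
Lemma INR_pow2_le_Rpower (N a : nat) (e d : R) :
  1 <= N -> (0 <= e)%R -> (INR a <= INR (Nat.log2 N) * e + d)%R ->
  (INR (2 ^ a) <= Rpower 2 d * Rpower (INR N) e)%R.
Proof.
  intros HN He Ha. rewrite pow_INR, <- Rpower_pow by (cbn; lra).
  replace (INR 2) with 2%R by (cbn; lra).
  apply Rle_trans with (Rpower 2 (INR (Nat.log2 N) * e + d)).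
  { apply Rle_Rpower; lra. }
  rewrite Rpower_plus, Rmult_comm. apply Rmult_le_compat_l.
  { left. apply exp_pos. }
  rewrite <- Rpower_mult. apply Rle_Rpower_l; [exact He|]. split; [apply exp_pos|].
  rewrite Rpower_pow by lra.
  replace 2%R with (INR 2) by (cbn; lra). rewrite <- pow_INR.
  apply le_INR, Nat.log2_spec. lia.
Qed.

Theorem theorem6p1 :
  exists K C : nat, forall r : nat, 2 <= r ->
  exists (s t : nat -> nat) (I : implementation),
    (forall N : nat, 1 <= N ->
       (INR (s N) <= INR C * (INR r * Rpower (INR N) (1 / INR r)))%R) /\
    (forall N : nat, 1 <= N ->
       (INR (t N) <= INR C * Rpower (INR N) (1 - 1 / INR r))%R) /\
    st_implementation K r s t I /\
    resize_amortized_time K r I (C * r) /\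
    access_worst_case_time K r I C.
Proof.
  (* 200 is the constant of [limits]. 5000 covers the factors 11 and [2 * 100] of the space bounds,
     the access time 200 and the amortized time per factor [r]. *)
  exists 200, 5000. intros r Hr. exists (rest_bound r), (peak_bound r), (resizable_array r).
  assert (Hr0 : (2 <= INR r)%R) by (change 2%R with (INR 2); now apply le_INR).
  assert (Hinv : (0 < 1 / INR r <= 1)%R).
  { split; [apply Rdiv_lt_0_compat; lra|].
    apply Rmult_le_reg_r with (INR r); [lra|]. unfold Rdiv.
    rewrite Rmult_assoc, Rinv_l; lra. }
  assert (HC : (100 <= INR 5000)%R)
    by (replace 100%R with (INR 100) by (cbn; lra); apply le_INR; lia).
  split; [|split; [|split; [|split]]].
  - intros N HN. unfold rest_bound. set (L := Nat.log2 N).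
    assert (HL : (INR (L / r) * INR r <= INR L)%R).
    { rewrite <- mult_INR. apply le_INR. rewrite Nat.mul_comm.
      apply Nat.Div0.mul_div_le. }
    assert (HP : (INR (2 ^ (L / r)) <= Rpower 2 0 * Rpower (INR N) (1 / INR r))%R).
    { apply INR_pow2_le_Rpower; [easy|lra|]. fold L.
      apply Rmult_le_reg_r with (INR r); [lra|].
      replace ((INR L * (1 / INR r) + 0) * INR r)%R with (INR L) by (field; lra).
      exact HL. }
    rewrite Rpower_O, Rmult_1_l in HP by lra.
    rewrite !mult_INR, Rmult_assoc.
    apply Rmult_le_compat; [apply pos_INR| | |].
    + apply Rmult_le_pos; apply pos_INR.
    + apply le_INR. lia.
    + apply Rmult_le_compat_l; [lra|exact HP].
  - intros N HN. unfold peak_bound. set (L := Nat.log2 N).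
    assert (HLr : L / r <= L) by (apply Nat.Div0.div_le_upper_bound; nia).
    (* Rounding the quotient down adds less than one to the exponent, hence [d = 1] and a factor
       2. *)
    assert (HL : (INR L <= INR (L / r) * INR r + INR r)%R).
    { rewrite <- mult_INR, <- plus_INR. apply le_INR.
      pose proof (Nat.mul_succ_div_gt L r ltac:(lia)). lia. }
    assert (HP : (INR (2 ^ (L - L / r)) <=
      Rpower 2 1 * Rpower (INR N) (1 - 1 / INR r))%R).
    { apply INR_pow2_le_Rpower; [easy|lra|]. fold L. rewrite minus_INR by easy.
      apply Rmult_le_reg_r with (INR r); [lra|].
      replace ((INR L * (1 - 1 / INR r) + 1) * INR r)%R
        with (INR L * INR r - INR L + INR r)%R by (field; lra). nra. }
    rewrite Rpower_1 in HP by lra. rewrite mult_INR.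
    assert (HR : (0 < Rpower (INR N) (1 - 1 / INR r))%R) by apply exp_pos.
    assert (H100 : INR 100 = 100%R) by (cbn; lra).
    assert (H5000 : (200 <= INR 5000)%R)
      by (replace 200%R with (INR 200) by (cbn; lra); apply le_INR; lia).
    rewrite H100. nra.
  - split; [|split; [|split]].
    + now apply rest_bound_nondecreasing.
    + now apply peak_bound_nondecreasing.
    + now apply resizable_array_implements.
    + now apply resizable_array_space.
  - now apply resizable_array_resize_time.
  - now apply resizable_array_access_time.
Qed.
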